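(* Let $\wp(z)$ be the Weierstrass $\wp$-function whose period lattice is the hexagonal lattice $\mathbb{T} = \{m\varpi + n e^{\pi i/3}\varpi : m,n\in\mathbb{Z}\}$, where $\varpi = \frac{1}{2\pi}\Gamma(1/3)^3$. The zeros of $\wp'(z)+\sqrt{3}$ are exactly the points $$\frac{\varpi}{3}+\omega,\qquad e^{\pi i/3}\,\frac{2\varpi}{3}+\omega,\qquad e^{2\pi i/3}\,\frac{\varpi}{3}+\omega,\qquad \omega\in\mathbb{T},$$ and they are all simple.
   Context: Let $\varpi = \int_{4^{-1/3}}^{\infty}\frac{dx}{\sqrt{x^3-1/4}} = \frac{1}{2\pi}\Gamma(1/3)^3 > 0$ and $\mathbb{T} = \{m\varpi + n e^{\pi i/3}\varpi : m,n\in\mathbb{Z}\}$. The Weierstrass $\wp$-function of $\mathbb{T}$ is $$\wp(z) = \frac{1}{z^2} + \sum_{\omega\in\mathbb{T}\setminus\{0\}}\left[\frac{1}{(z-\omega)^2} - \frac{1}{\omega^2}\right];$$ it is the $\wp$-function with invariants $g_2 = 0$, $g_3 = 1$, i.e. it satisfies $\wp'(z)^2 = 4\wp(z)^3 - 1$ and $\lim_{z\to 0} z^2\wp(z) = 1$. Its derivative is $\wp'(z) = -\sum_{\omega\in\mathbb{T}}\frac{2}{(z-\omega)^3}$. *)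

(* Defs.v *)
From Stdlib Require Import Reals List.
From Coquelicot Require Import Coquelicot.

Open Scope C_scope.

(* Euler's integral of the second kind, for a real argument s > 0. *)
Definition Gamma (s : R) : R :=
  RInt_gen (fun t : R => Rpower t (s - 1) * exp (- t))%R
    (at_right 0) (Rbar_locally p_infty).

Definition varpi : R := (1 / (2 * PI) * Gamma (1 / 3) ^ 3)%R.

(* exp (i theta), for real theta. *)
Definition expi (theta : R) : C := (cos theta, sin theta).

Definition hexT (w : C) : Prop :=
  exists m n : Z,
    w = RtoC (IZR m) * varpi + RtoC (IZR n) * expi (PI / 3) * varpi.

(* The sum of f over the set A is s: convergence along the finite subsets of A
   directed by inclusion, i.e. unconditional (equivalently, absolute)
   convergence.  The finite subsets are encoded as duplicate-free lists; l0 must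
   itself lie in A, since otherwise no list l would qualify. *)
Definition is_sum_over (A : C -> Prop) (f : C -> C) (s : C) : Prop :=
  forall eps : posreal, exists l0 : list C, List.Forall A l0 /\
    forall l : list C, NoDup l -> List.Forall A l -> incl l0 l ->
      (Cmod (fold_right Cplus 0 (map f l) - s) < eps)%R.

Definition sum_over (A : C -> Prop) (f : C -> C) : C :=
  iota (T := CompleteNormedModule.CompleteSpace C_AbsRing C_CompleteNormedModule)
    (is_sum_over A f).

(* The Weierstrass function of the lattice L; its value at a point of L (a pole)
   is meaningless. *)
Definition weierstrass_p (L : C -> Prop) (z : C) : C :=
  1 / z ^ 2 +
  sum_over (fun w => L w /\ w <> 0) (fun w => 1 / (z - w) ^ 2 - 1 / w ^ 2).

Definition wp : C -> C := weierstrass_p hexT.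

Definition holomorphic_at (f : C -> C) (a : C) : Prop :=
  locally a (fun z : C => ex_derive (K := C_AbsRing) (V := C_NormedModule) f z).

(* C_derive f z is computed as a limit along the real direction: it is the
   complex derivative of f at z only where f is complex differentiable. *)
Definition wp' : C -> C := C_derive wp.

(* a is a zero of order exactly one. *)
Definition simple_zero (f : C -> C) (a : C) : Prop :=
  holomorphic_at f a /\ f a = 0 /\ C_derive f a <> 0.

(* Main.v *)
(** Write T for the lattice and y = wp'.  Since wp(rho z) = rho^(-2) wp(z) for
    rho = e^(i pi/3), the Eisenstein sums of weight 3 and 4 vanish, so
    wp'' - 6 wp^2 tends to 0 at the lattice points; being T-periodic and
    holomorphic elsewhere, it vanishes by the maximum principle.  Hence
    y^2 = 4 wp^3 - g3 for a constant g3, which is real and positive.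

    Put k = g3^(1/6).  On the real interval (0, varpi) the functions
    u, v = (y -+ sqrt 3 k^3) / (2 sqrt 3 k wp) satisfy v^3 - u^3 = 1 and
    u' = sqrt 3 k v^2.  The substitution (u, v) -> (-v/u, -1/u) preserves this
    system and permutes the three pieces of (0, varpi) cut out by v = 0 and u = 0,
    so these zeros are varpi/3 and 2 varpi/3, and
    sqrt 3 k varpi / 3 = int_0^oo (1+s^3)^(-2/3) ds = 2 I, where I is the integral over [0, 1].
    On the other side Gamma(1/3) = 3 int_0^oo e^(-x^3) dx, and differentiating
    products of truncated integrals gives varpi = 2 sqrt 3 I.  Therefore k = 1,
    wp(varpi/3) = 1 and y(varpi/3) = - sqrt 3.

    If y(z) = - sqrt 3 then wp(z)^3 = 1, and after a rotation by a cube root of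
    unity wp(z) = 1.  Then wp has the same initial values at z and at varpi/3, so by
    uniqueness for wp'' = 6 wp^2 the two solutions reach a pole simultaneously:
    z - varpi/3 lies in T.  Zeros are simple because y' = 6 wp^2 <> 0 there. *)

Require Import Defs.
From Stdlib Require Import Reals Ranalysis5 ZArith List FinFun Lra Lia Psatz.
From Stdlib Require Import Classical ClassicalEpsilon.
From Coquelicot Require Import Coquelicot.

(** * The value of Gamma(1/3)^3 *)

Open Scope R_scope.

(** The lattice is given through Gamma(1/3), so nothing ties it to g3 = 1 in advance: the real
    period is computed once from Gamma and once from the flow of wp, and both computations are
    brought to the same integral I on the Fermat cubic v^3 = 1 + u^3. On the Gamma side, I enters
    through B(1/3,1/3) = Gamma(1/3)^2 / Gamma(2/3) = 6 I, and the reflection formula Gamma(1/3)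
    Gamma(2/3) = 2 pi / sqrt 3 eliminates Gamma(2/3). On the other side, (u, v) -> (-v/u, -1/u) has
    order three and commutes with the flow: it is the translation by varpi/3, that is, by a
    3-torsion point of the cubic. This is why thirds of the period appear. The complex analysis
    rests on one tool, the mean value property on circles, obtained by differentiating under the
    integral sign. It asks for a continuous derivative, so the lattice series are followed up to the
    third derivative of wp. *)

Lemma ex_derive_cont (f : R -> R) (x : R) : ex_derive f x -> continuous f x.
Proof. exact (ex_derive_continuous (V := R_NormedModule) f x). Qed.

Lemma is_derive_continuity_pt (f : R -> R) (x l : R) : is_derive f x l -> continuity_pt f x.
Proof. intros H. apply derivable_continuous_pt; exists l; now apply is_derive_Reals. Qed.

Lemma ex_RInt_cont (f : R -> R) (a b : R) :
  (forall x, Rmin a b <= x <= Rmax a b -> continuous f x) -> ex_RInt f a b.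
Proof. exact (ex_RInt_continuous (V := R_CompleteNormedModule) f a b). Qed.

Lemma is_derive_primitive (f : R -> R) (t : R) :
  (forall x, continuous f x) -> is_derive (fun t => RInt f 0 t) t (f t).
Proof.
  intros Hf. apply is_derive_RInt with (a := 0); [|apply Hf].
  apply filter_forall; intros b.
  apply (RInt_correct (V := R_CompleteNormedModule)), ex_RInt_cont; auto.
Qed.

(** Differentiation under the integral sign. The margins [lo < a] and [b < hi] let the formula for
    the derivative hold in a full neighbourhood of each point (x, v), the endpoints included, so
    that continuity of [df] passes to [Derive]. *)
Lemma is_derive_RInt_parameter (f df : R -> R -> R) (lo hi a b x e : R) :
  lo < a -> a <= b -> b < hi -> 0 < e ->
  (forall u v, Rabs (u - x) < e -> lo < v < hi -> is_derive (fun u => f u v) u (df u v)) ->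
  (forall v, a <= v <= b -> continuity_2d_pt df x v) ->
  (forall u v, Rabs (u - x) < e -> a <= v <= b -> continuous (f u) v) ->
  is_derive (fun x => RInt (f x) a b) x (RInt (df x) a b).
Proof.
  intros Hlo Hab Hhi He0 Hd Hc Hi.
  assert (Hx : Rabs (x - x) < e) by (rewrite Rminus_diag, Rabs_R0; assumption).
  assert (Hmin : Rmin a b = a) by (apply Rmin_left; lra).
  assert (Hmax : Rmax a b = b) by (apply Rmax_right; lra).
  rewrite (RInt_ext (df x) (fun t => Derive (fun u => f u t) x)).
  2:{ rewrite Hmin, Hmax; intros t Ht; symmetry; apply is_derive_unique, Hd; [assumption|lra]. }
  apply is_derive_RInt_param; rewrite ?Hmin, ?Hmax.
  - exists (mkposreal e He0); intros y Hy t Ht; exists (df y t); apply Hd; [exact Hy|lra].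
  - intros t Ht. apply continuity_2d_pt_ext_loc with (f := df); [|now apply Hc].
    assert (He : 0 < Rmin e (Rmin (a - lo) (hi - b))) by (repeat apply Rmin_pos; lra).
    exists (mkposreal _ He); simpl; intros u v Hu Hv.
    pose proof (Rmin_l e (Rmin (a - lo) (hi - b))); pose proof (Rmin_r e (Rmin (a - lo) (hi - b))).
    symmetry; apply is_derive_unique, Hd; [lra|].
    apply Rabs_def2 in Hv.
    pose proof (Rmin_l (a - lo) (hi - b)); pose proof (Rmin_r (a - lo) (hi - b)); lra.
  - exists (mkposreal e He0); intros y Hy. apply ex_RInt_cont; rewrite Hmin, Hmax; auto.
Qed.

Lemma eq_of_is_derive (f g df : R -> R) (a t : R) :
  (forall t, a <= t -> is_derive f t (df t)) ->
  (forall t, a <= t -> is_derive g t (df t)) ->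
  f a = g a -> a <= t -> f t = g t.
Proof.
  intros Hf Hg H0 Ht.
  destruct Ht as [Ht| <-]; [|assumption].
  assert (E : f a - g a = f t - g t).
  { apply (eq_is_derive (V := R_NormedModule) (fun t => f t - g t) a t); [|assumption].
    intros s Hs. evar_last.
    - apply (is_derive_minus (V := R_NormedModule)); [apply Hf | apply Hg]; lra.
    - unfold minus, plus, opp, zero; simpl; ring. }
  lra.
Qed.

Lemma RInt_mult_l (c : R) (f : R -> R) (a b : R) :
  ex_RInt f a b -> c * RInt f a b = RInt (fun x => c * f x) a b.
Proof.
  intros H; symmetry; exact (RInt_scal (V := R_CompleteNormedModule) f a b c H).
Qed.

(** In the variable s = x^3 this is a truncation of Gamma(1/3) / 3, and [expcubeI1] is one of
    Gamma(2/3) / 3. *)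
Definition expcubeI (t : R) : R := RInt (fun x => exp (- x ^ 3)) 0 t.

Definition expcubeI1 (t : R) : R := RInt (fun x => x * exp (- x ^ 3)) 0 t.

Lemma is_derive_expcubeI (t : R) : is_derive expcubeI t (exp (- t ^ 3)).
Proof.
  apply (is_derive_primitive (fun x => exp (- x ^ 3))).
  intros x; apply ex_derive_cont; auto_derive; auto; try nra.
Qed.

Lemma is_derive_expcubeI1 (t : R) : is_derive expcubeI1 t (t * exp (- t ^ 3)).
Proof.
  apply (is_derive_primitive (fun x => x * exp (- x ^ 3))).
  intros x; apply ex_derive_cont; auto_derive; auto; try nra.
Qed.

Lemma RInt_scale (f : R -> R) (t : R) : (forall x, continuous f x) ->
  RInt f 0 t = t * RInt (fun u => f (t * u)) 0 1.
Proof.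
  intros Hf. rewrite RInt_mult_l.
  - pose proof (RInt_comp_lin (V := R_CompleteNormedModule) f t 0 0 1) as H.
    rewrite !Rplus_0_r, Rmult_0_r, Rmult_1_r in H.
    rewrite <- H by (apply ex_RInt_cont; auto).
    apply RInt_ext; intros x _. now rewrite Rplus_0_r.
  - apply ex_RInt_cont; intros x _.
    apply (continuous_comp (fun u => t * u) f); [apply ex_derive_cont; auto_derive; auto|apply Hf].
Qed.

Lemma expcubeI_scale (t : R) :
  expcubeI t = t * RInt (fun u => exp (- (t * u) ^ 3)) 0 1.
Proof.
  apply (RInt_scale (fun x => exp (- x ^ 3))). intros x; apply ex_derive_cont; auto_derive; auto.
Qed.

Lemma expcubeI1_scale (t : R) :
  expcubeI1 t = t ^ 2 * RInt (fun u => u * exp (- (t * u) ^ 3)) 0 1.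
Proof.
  unfold expcubeI1. rewrite (RInt_scale (fun x => x * exp (- x ^ 3))).
  - rewrite (RInt_ext _ (fun u => t * (u * exp (- (t * u) ^ 3)))) by (intros; apply Rmult_assoc).
    rewrite <- RInt_mult_l; [ring|]. apply ex_RInt_cont; intros x _.
    apply ex_derive_cont; auto_derive; auto.
  - intros x; apply ex_derive_cont; auto_derive; auto.
Qed.

Lemma continuity_2d_exp (P : R -> R -> R) (x y : R) :
  continuity_2d_pt P x y -> continuity_2d_pt (fun u v => exp (P u v)) x y.
Proof.
  intros H; apply continuity_1d_2d_pt_comp; [|assumption].
  apply derivable_continuous_pt, derivable_pt_exp.
Qed.

Ltac cont2d :=
  repeat first
    [ apply continuity_2d_pt_id1 | apply continuity_2d_pt_id2
    | apply continuity_2d_pt_const | apply continuity_2d_exp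
    | apply continuity_2d_pt_mult | apply continuity_2d_pt_plus
    | apply continuity_2d_pt_minus | apply continuity_2d_pt_opp ].

Ltac by_derivable :=
  apply ex_derive_cont; auto_derive; auto; try nra.

Lemma exp_cubes (t u : R) : exp (- t ^ 3) * exp (- (t * u) ^ 3) = exp (- t ^ 3 * (1 + u ^ 3)).
Proof. rewrite <- exp_plus; f_equal; ring. Qed.

(* Both sides vanish at 0 and have the same derivative, by the scaling x = t u. *)
Lemma expcubeI_mul_expcubeI1 (t : R) : 0 <= t ->
  expcubeI t * expcubeI1 t =
  / 3 * RInt (fun u => (1 - exp (- t ^ 3 * (1 + u ^ 3))) / (1 - u + u ^ 2)) 0 1.
Proof.
  assert (Hden : forall u, 1 - u + u ^ 2 <> 0) by (intros u; nra).
  apply (eq_of_is_derive (fun t => expcubeI t * expcubeI1 t)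
           (fun t => / 3 * RInt (fun u => (1 - exp (- t ^ 3 * (1 + u ^ 3))) / (1 - u + u ^ 2)) 0 1)
           (fun t => t ^ 2 * RInt (fun u => (1 + u) * exp (- t ^ 3 * (1 + u ^ 3))) 0 1)).
  - intros s _. evar_last.
    + apply (is_derive_mult (K := R_AbsRing));
        [apply is_derive_expcubeI | apply is_derive_expcubeI1 | intros; apply Rmult_comm].
    + unfold plus, mult; simpl. rewrite expcubeI_scale, expcubeI1_scale.
      set (J0 := RInt (fun u => exp (- (s * u) ^ 3)) 0 1).
      set (J1 := RInt (fun u => u * exp (- (s * u) ^ 3)) 0 1).
      transitivity (s ^ 2 * (exp (- s ^ 3) * (J1 + J0))); [simpl; ring|].
      f_equal. unfold J0, J1.
      rewrite <- (RInt_plus (V := R_CompleteNormedModule)).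
      * change (exp (- s ^ 3) * ?x) with (scal (exp (- s ^ 3)) x).
        rewrite <- (RInt_scal (V := R_CompleteNormedModule)).
        -- apply RInt_ext; intros u _. unfold scal, plus; simpl; unfold mult; simpl.
           pose proof (exp_cubes s u) as E; simpl in E; rewrite <- E; ring.
        -- apply ex_RInt_cont; intros u _.
           unfold plus; simpl. by_derivable.
      * apply ex_RInt_cont; intros u _; by_derivable.
      * apply ex_RInt_cont; intros u _; by_derivable.
  - intros s _. evar_last.
    + apply is_derive_scal.
      apply (is_derive_RInt_parameter
               (fun s u => (1 - exp (- s ^ 3 * (1 + u ^ 3))) / (1 - u + u ^ 2))
               (fun s u => 3 * s ^ 2 * (1 + u) * exp (- s ^ 3 * (1 + u ^ 3))) (-1) 2 0 1 s 1);
        try lra.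
      * intros x u _ _. auto_derive; [auto|]. simpl; field. clear; nra.
      * intros v _. simpl; cont2d.
      * intros x u _ _. by_derivable.
    + rewrite !RInt_mult_l.
      * apply RInt_ext; intros u _; simpl; field.
      * apply ex_RInt_cont; intros u _; by_derivable.
      * apply ex_RInt_cont; intros u _; by_derivable.
  - unfold expcubeI. rewrite RInt_point. unfold zero; simpl.
    rewrite (RInt_ext _ (fun _ => 0)).
    + rewrite RInt_const; unfold scal; simpl; unfold mult; simpl; ring.
    + intros u _. replace (- _ * _) with 0 by ring. rewrite exp_0, Rminus_diag; apply Rmult_0_l.
Qed.

(** * The Beta integral on the Fermat cubic *)

(** The coordinate v on the curve v^3 = 1 + u^3. Since the power is taken through the logarithm, it
    is the cube root only for u > -1. *)
Definition cbrt1 (u : R) : R := Rpower (1 + u ^ 3) (1 / 3).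

Lemma cube_pos (u : R) : -1 < u -> 0 < 1 + u ^ 3.
Proof. intros Hu. replace (1 + u ^ 3) with ((1 + u) * (1 - u + u ^ 2)) by ring. apply Rmult_lt_0_compat; nra. Qed.

Lemma cbrt1_pos (u : R) : 0 < cbrt1 u.
Proof. apply exp_pos. Qed.

Lemma cbrt1_cube (u : R) : -1 < u -> cbrt1 u ^ 3 = 1 + u ^ 3.
Proof.
  intros Hu. pose proof (cube_pos u Hu).
  rewrite <- (Rpower_pow 3 (cbrt1 u) (cbrt1_pos u)). unfold cbrt1.
  rewrite Rpower_mult. simpl (INR 3). replace (1 / 3 * (1 + 1 + 1)) with 1 by field.
  now apply Rpower_1.
Qed.

Lemma Rpower_cbrt1 (u : R) : -1 < u -> Rpower (1 + u ^ 3) (- 2 / 3) = / cbrt1 u ^ 2.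
Proof.
  intros Hu. pose proof (cube_pos u Hu).
  rewrite <- (Rpower_pow 2 (cbrt1 u) (cbrt1_pos u)). unfold cbrt1.
  rewrite Rpower_mult, <- Rpower_Ropp. f_equal; simpl; field.
Qed.

Lemma cbrt1_bounds (u : R) : 0 <= u <= 1 -> 1 <= cbrt1 u <= 2.
Proof.
  intros Hu. pose proof (cbrt1_cube u ltac:(lra)). pose proof (cbrt1_pos u).
  assert (0 <= u ^ 3 <= 1) by (simpl; nra). simpl in *. nra.
Qed.

(** One sixth of the Beta value B(1/3,1/3). *)
Definition fermatI : R := RInt (fun u => Rpower (1 + u ^ 3) (- 2 / 3)) 0 1.

Lemma ex_derive_Rpower_cube (u p : R) : -1 < u -> ex_derive (fun u => Rpower (1 + u ^ 3) p) u.
Proof.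
  intros Hu. pose proof (cube_pos u Hu). unfold Rpower. auto_derive. simpl in *; lra.
Qed.

(** The square is the integral of exp(-x^3-y^3) over [0,t]^2. Folding along the diagonal gives the
    factor 2; slicing along the rays y = u x and rescaling the radius by v = [cbrt1 u] gives the
    inner integral [expcubeI1 (t v)] with the factor v^(-2). The proof replaces the double integral
    by a comparison of derivatives in t. *)
Lemma expcubeI_sq (t : R) : 0 <= t ->
  expcubeI t ^ 2 =
  2 * RInt (fun u => / cbrt1 u ^ 2 * expcubeI1 (t * cbrt1 u)) 0 1.
Proof.
  apply (eq_of_is_derive (fun t => expcubeI t ^ 2)
           (fun t => 2 * RInt (fun u => / cbrt1 u ^ 2 * expcubeI1 (t * cbrt1 u)) 0 1)
           (fun t => 2 * RInt (fun u => t * exp (- t ^ 3 * (1 + u ^ 3))) 0 1)).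
  - intros s _. evar_last.
    + apply (is_derive_pow expcubeI 2), is_derive_expcubeI.
    + simpl. rewrite expcubeI_scale.
      rewrite (RInt_ext (fun u => s * exp (- (s * (s * (s * 1))) * (1 + u * (u * (u * 1)))))
                 (fun u => scal (s * exp (- s ^ 3)) (exp (- (s * u) ^ 3)))).
      * rewrite (RInt_scal (V := R_CompleteNormedModule)).
        -- unfold scal; simpl; unfold mult; simpl; ring.
        -- apply ex_RInt_cont; intros u _; by_derivable.
      * intros u _. unfold scal; simpl; unfold mult; simpl.
        pose proof (exp_cubes s u) as E; simpl in E; rewrite <- E; ring.
  - intros s _.
    apply is_derive_scal.
    apply (is_derive_RInt_parameter
             (fun s u => / cbrt1 u ^ 2 * expcubeI1 (s * cbrt1 u))
             (fun s u => s * exp (- s ^ 3 * (1 + u ^ 3))) (-1) 2 0 1 s 1); try lra.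
    + intros x u _ Hu. evar_last.
      * apply is_derive_scal.
        apply (is_derive_comp (V := R_NormedModule) expcubeI1 (fun s => s * cbrt1 u)).
        -- apply is_derive_expcubeI1.
        -- auto_derive; [auto|reflexivity].
      * unfold scal; simpl; unfold mult; simpl.
        replace (- (x * cbrt1 u * (x * cbrt1 u * (x * cbrt1 u * 1))))
          with (- (x * (x * (x * 1))) * cbrt1 u ^ 3) by ring.
        rewrite (cbrt1_cube u) by lra. simpl. field. apply Rgt_not_eq, cbrt1_pos.
    + intros v _. simpl; cont2d.
    + intros x u _ Hu. apply ex_derive_cont.
      assert (H : ex_derive cbrt1 u) by (apply ex_derive_Rpower_cube; lra).
      apply (ex_derive_mult (fun u => / cbrt1 u ^ 2) (fun u => expcubeI1 (x * cbrt1 u))).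
      * auto_derive. split; [assumption|split; [|auto]].
        simpl; pose proof (cbrt1_pos u); nra.
      * apply (ex_derive_comp (V := R_NormedModule) expcubeI1 (fun u => x * cbrt1 u)).
        -- eexists; apply is_derive_expcubeI1.
        -- auto_derive; assumption.
  - unfold expcubeI at 1. rewrite RInt_point. unfold zero; simpl.
    rewrite (RInt_ext _ (fun _ => 0)).
    + rewrite RInt_const; unfold scal; simpl; unfold mult; simpl; ring.
    + intros u _. unfold expcubeI1. rewrite Rmult_0_l, RInt_point; unfold zero; simpl; ring.
Qed.
Lemma expcubeI1_mono (s t : R) : 0 <= s -> s <= t -> expcubeI1 s <= expcubeI1 t.
Proof.
  intros Hs [Hst| ->]; [|lra].
  destruct (MVT_gen expcubeI1 s t (fun t => t * exp (- t ^ 3))) as [c [Hc E]].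
  - intros x _; apply is_derive_expcubeI1.
  - intros x _; eapply is_derive_continuity_pt, is_derive_expcubeI1.
  - rewrite Rmin_left, Rmax_right in Hc by lra.
    pose proof (exp_pos (- c ^ 3)).
    assert (0 <= c * exp (- c ^ 3)) by (apply Rmult_le_pos; lra). nra.
Qed.

Lemma expcubeI1_nonneg (t : R) : 0 <= t -> 0 <= expcubeI1 t.
Proof.
  intros Ht. replace 0 with (expcubeI1 0) at 1 by exact (RInt_point _ _). apply expcubeI1_mono; lra.
Qed.

Lemma expcubeI_pos (t : R) : 0 < t -> 0 < expcubeI t.
Proof.
  intros Ht.
  destruct (MVT_gen expcubeI 0 t (fun t => exp (- t ^ 3))) as [c [Hc E]].
  - intros x _; apply is_derive_expcubeI.
  - intros x _; eapply is_derive_continuity_pt, is_derive_expcubeI.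
  - replace (expcubeI 0) with 0 in E by (symmetry; exact (RInt_point _ _)).
    pose proof (exp_pos (- c ^ 3)). nra.
Qed.

Lemma fermatI_cbrt1 : fermatI = RInt (fun u => / cbrt1 u ^ 2) 0 1.
Proof.
  apply RInt_ext; rewrite Rmin_left, Rmax_right by lra; intros u Hu.
  apply Rpower_cbrt1; lra.
Qed.

Lemma ex_RInt_inv_cbrt1 : ex_RInt (fun u => / cbrt1 u ^ 2) 0 1.
Proof.
  apply ex_RInt_cont.
  rewrite Rmin_left, Rmax_right by lra; intros u Hu.
  apply ex_derive_cont.
  assert (ex_derive cbrt1 u) by (apply ex_derive_Rpower_cube; lra).
  pose proof (cbrt1_pos u). auto_derive; repeat split; auto. nra.
Qed.

Lemma fermatI_pos : 0 < fermatI.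
Proof.
  rewrite fermatI_cbrt1. apply Rlt_le_trans with (RInt (fun _ => / 4) 0 1).
  - rewrite RInt_const; unfold scal; simpl; unfold mult; simpl; lra.
  - apply RInt_le; try lra; [apply ex_RInt_const | apply ex_RInt_inv_cbrt1 |].
    intros u Hu. pose proof (cbrt1_bounds u ltac:(lra)).
    apply Rinv_le_contravar; nra.
Qed.

(* As t -> oo the square of expcubeI is squeezed against 2 I expcubeI1, without
   any separate knowledge of the limit of expcubeI1. *)
Lemma expcubeI_sq_bounds (t : R) : 0 <= t ->
  2 * fermatI * expcubeI1 t <= expcubeI t ^ 2 <= 2 * fermatI * expcubeI1 (2 * t).
Proof.
  intros Ht. rewrite (expcubeI_sq t Ht), fermatI_cbrt1.
  assert (Hex : ex_RInt (fun u => / cbrt1 u ^ 2 * expcubeI1 (t * cbrt1 u)) 0 1).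
  { apply ex_RInt_cont.
    rewrite Rmin_left, Rmax_right by lra; intros u Hu.
    apply ex_derive_cont.
    assert (H : ex_derive cbrt1 u) by (apply ex_derive_Rpower_cube; lra).
    apply (ex_derive_mult (fun u => / cbrt1 u ^ 2) (fun u => expcubeI1 (t * cbrt1 u))).
    - auto_derive. split; [assumption|split; [|auto]].
      simpl; pose proof (cbrt1_pos u); nra.
    - apply (ex_derive_comp (V := R_NormedModule) expcubeI1 (fun u => t * cbrt1 u)).
      + eexists; apply is_derive_expcubeI1.
      + auto_derive; assumption. }
  set (I0 := RInt (fun u => / cbrt1 u ^ 2) 0 1).
  replace (2 * I0 * expcubeI1 t) with (2 * (expcubeI1 t * I0)) by ring.
  replace (2 * I0 * expcubeI1 (2 * t)) with (2 * (expcubeI1 (2 * t) * I0)) by ring.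
  unfold I0; rewrite (RInt_mult_l (expcubeI1 t)), (RInt_mult_l (expcubeI1 (2 * t)))
    by apply ex_RInt_inv_cbrt1.
  assert (Hp : forall u, 0 <= u <= 1 -> 0 < / cbrt1 u ^ 2).
  { intros u Hu; apply Rinv_0_lt_compat; pose proof (cbrt1_pos u); nra. }
  split; apply Rmult_le_compat_l; try lra; apply RInt_le; try lra; try assumption;
    try (apply (ex_RInt_scal (V := R_NormedModule)), ex_RInt_inv_cbrt1);
    intros u Hu; pose proof (cbrt1_bounds u ltac:(lra)); specialize (Hp u ltac:(lra));
    rewrite (Rmult_comm (expcubeI1 _)); apply Rmult_le_compat_l; try lra;
    apply expcubeI1_mono; nra.
Qed.

Lemma RInt_inv_quadratic : RInt (fun u => / (1 - u + u ^ 2)) 0 1 = 2 * PI / (3 * sqrt 3).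
Proof.
  assert (H3 : sqrt 3 * sqrt 3 = 3) by (apply sqrt_sqrt; lra).
  assert (Hs : 0 < sqrt 3) by (apply sqrt_lt_R0; lra).
  apply is_RInt_unique.
  evar_last.
  - apply (is_RInt_derive (V := R_CompleteNormedModule)
             (fun u => 2 / sqrt 3 * atan ((2 * u - 1) / sqrt 3))).
    + intros u _. auto_derive; [auto|]. field_simplify_eq.
      * replace (sqrt 3 ^ 2) with 3 by (simpl; lra). ring.
      * repeat split; [clear; nra | lra | rewrite H3; clear; nra].
    + intros u _; by_derivable.
  - unfold minus, plus, opp; simpl.
    replace ((2 * 1 - 1) / sqrt 3) with (tan (PI / 6)).
    2:{ rewrite tan_PI6; field; lra. }
    replace ((2 * 0 - 1) / sqrt 3) with (- tan (PI / 6)).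
    2:{ rewrite tan_PI6; field; lra. }
    rewrite atan_opp, atan_tan by (pose proof PI_RGT_0; lra).
    field; lra.
Qed.

Lemma is_lim_exp_neg_cube : is_lim (fun t => exp (- t ^ 3)) p_infty 0.
Proof.
  apply is_lim_comp with m_infty; [apply is_lim_exp_m| |].
  - evar_last.
    + apply is_lim_opp. apply (is_lim_le_p_loc (fun t => t)); [|apply is_lim_id].
      exists 1; intros t Ht; simpl; nra.
    + reflexivity.
  - exists 0; intros t _; discriminate.
Qed.

(** The limit is Gamma(1/3) Gamma(2/3) / 9, so this is the reflection formula at 1/3. Since 1 + u^3
    >= 1 on [0,1], the integrand of the product formula lies between 1 - exp(-t^3) and 1 times 1 /
    (1 - u + u^2). *)
Lemma is_lim_expcubeI_mul :
  is_lim (fun t => expcubeI t * expcubeI1 t) p_infty (2 * PI / (9 * sqrt 3)).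
Proof.
  assert (Hs : 0 < sqrt 3) by (apply sqrt_lt_R0; lra).
  set (c := RInt (fun u => / (1 - u + u ^ 2)) 0 1).
  assert (Hex : ex_RInt (fun u => / (1 - u + u ^ 2)) 0 1).
  { apply ex_RInt_cont; intros u _; by_derivable. }
  apply (is_lim_le_le_loc (fun t => / 3 * ((1 - exp (- t ^ 3)) * c)) (fun t => / 3 * c)).
  - exists 0; intros t Ht.
    rewrite expcubeI_mul_expcubeI1 by lra. unfold c.
    rewrite RInt_mult_l by assumption.
    assert (Hex' : ex_RInt (fun u => (1 - exp (- t ^ 3 * (1 + u ^ 3))) / (1 - u + u ^ 2)) 0 1).
    { apply ex_RInt_cont; intros u _; by_derivable. }
    assert (Ht3 : 0 < t ^ 3) by (apply pow_lt; lra).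
    split; apply Rmult_le_compat_l; try lra; apply RInt_le; try lra; try assumption.
    + apply (ex_RInt_scal (V := R_NormedModule)); assumption.
    + intros u Hu. unfold Rdiv. apply Rmult_le_compat_r.
      * apply Rlt_le, Rinv_0_lt_compat; nra.
      * assert (0 < u ^ 3) by (apply pow_lt; lra).
        assert (exp (- t ^ 3 * (1 + u ^ 3)) <= exp (- t ^ 3)); [|lra].
        apply Rlt_le, exp_increasing; nra.
    + intros u Hu. rewrite <- (Rmult_1_l (/ (1 - u + u ^ 2))). unfold Rdiv. apply Rmult_le_compat_r.
      * apply Rlt_le, Rinv_0_lt_compat; nra.
      * pose proof (exp_pos (- t ^ 3 * (1 + u ^ 3))); lra.
  - replace (2 * PI / (9 * sqrt 3)) with (/ 3 * ((1 - 0) * c)).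
    2:{ unfold c; rewrite RInt_inv_quadratic; field; lra. }
    apply (is_lim_scal_l _ (/ 3) p_infty ((1 - 0) * c)).
    apply (is_lim_scal_r _ c p_infty (1 - 0)).
    apply (is_lim_minus' _ _ p_infty 1 0); [apply is_lim_const | apply is_lim_exp_neg_cube].
  - replace (2 * PI / (9 * sqrt 3)) with (/ 3 * c).
    2:{ unfold c; rewrite RInt_inv_quadratic; field; lra. }
    apply is_lim_const.
Qed.

Definition cubeLim : R := 2 * fermatI * (2 * PI / (9 * sqrt 3)).

Lemma cubeLim_pos : 0 < cubeLim.
Proof.
  unfold cubeLim. pose proof fermatI_pos; pose proof PI_RGT_0.
  assert (0 < sqrt 3) by (apply sqrt_lt_R0; lra).
  apply Rmult_lt_0_compat; [lra|]. apply Rdiv_lt_0_compat; lra.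
Qed.

(** Multiplying the squeeze for the square by [expcubeI] leaves the product [expcubeI expcubeI1] on
    both sides, once [expcubeI t] is enlarged to [expcubeI (2 t)] in the upper bound. The limit of
    that product suffices. *)
Lemma is_lim_expcubeI_cube : is_lim (fun t => expcubeI t ^ 3) p_infty cubeLim.
Proof.
  apply (is_lim_le_le_loc (fun t => 2 * fermatI * (expcubeI t * expcubeI1 t))
           (fun t => 2 * fermatI * (expcubeI (2 * t) * expcubeI1 (2 * t)))).
  - exists 0; intros t Ht.
    pose proof (expcubeI_sq_bounds t ltac:(lra)).
    pose proof (expcubeI_pos t Ht). pose proof fermatI_pos.
    assert (expcubeI t <= expcubeI (2 * t)).
    { destruct (MVT_gen expcubeI t (2 * t) (fun t => exp (- t ^ 3))) as [c [Hc E]].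
      - intros x _; apply is_derive_expcubeI.
      - intros x _; eapply is_derive_continuity_pt, is_derive_expcubeI.
      - pose proof (exp_pos (- c ^ 3)). nra. }
    pose proof (expcubeI1_nonneg (2 * t) ltac:(lra)).
    replace (expcubeI t ^ 3) with (expcubeI t ^ 2 * expcubeI t) by ring.
    split; [nra|].
    apply Rle_trans with (2 * fermatI * expcubeI1 (2 * t) * expcubeI t); [nra|].
    rewrite !Rmult_assoc. do 2 (apply Rmult_le_compat_l; [lra|]).
    rewrite Rmult_comm. apply Rmult_le_compat_r; lra.
  - apply (is_lim_scal_l _ (2 * fermatI) p_infty (2 * PI / (9 * sqrt 3))), is_lim_expcubeI_mul.
  - apply (is_lim_scal_l _ (2 * fermatI) p_infty (2 * PI / (9 * sqrt 3))).
    apply (is_lim_comp (fun t => expcubeI t * expcubeI1 t) (fun t => 2 * t) p_infty _ p_infty).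
    + apply is_lim_expcubeI_mul.
    + apply (is_lim_le_p_loc (fun t => t)); [|apply is_lim_id]. exists 0; intros t Ht; lra.
    + exists 0; intros t _; discriminate.
Qed.

Lemma Rpower_third_cube (x : R) : 0 < x -> Rpower x (1 / 3) ^ 3 = x.
Proof.
  intros Hx. rewrite <- Rpower_pow by apply exp_pos.
  rewrite Rpower_mult. simpl (INR 3). replace (1 / 3 * (1 + 1 + 1)) with 1 by field.
  now apply Rpower_1.
Qed.

Lemma Rpower_cube_third (x : R) : 0 < x -> Rpower (x ^ 3) (1 / 3) = x.
Proof.
  intros Hx. rewrite <- Rpower_pow by assumption. rewrite Rpower_mult.
  simpl (INR 3). replace ((1 + 1 + 1) * (1 / 3)) with 1 by field. now apply Rpower_1.
Qed.

Lemma is_lim_expcubeI : is_lim expcubeI p_infty (Rpower cubeLim (1 / 3)).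
Proof.
  apply (is_lim_ext_loc (fun t => Rpower (expcubeI t ^ 3) (1 / 3))).
  - exists 0; intros t Ht; apply Rpower_cube_third, expcubeI_pos, Ht.
  - apply (filterlim_comp _ _ _ (fun t => expcubeI t ^ 3) (fun x => Rpower x (1 / 3))
             _ (locally cubeLim)); [apply is_lim_expcubeI_cube|].
    apply ex_derive_cont.
    unfold Rpower; auto_derive; apply cubeLim_pos.
Qed.

Lemma Rpower_third_lt (x y : R) : 0 < x -> 0 < y -> x < y ^ 3 -> Rpower x (1 / 3) < y.
Proof.
  intros Hx Hy H. rewrite <- (Rpower_cube_third y Hy). apply Rlt_Rpower_l; lra.
Qed.

Lemma Rpower_third_gt (x y : R) : 0 < x -> 0 < y -> y ^ 3 < x -> y < Rpower x (1 / 3).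
Proof.
  intros Hx Hy H. rewrite <- (Rpower_cube_third y Hy). apply Rlt_Rpower_l; [lra|].
  split; [apply pow_lt|]; lra.
Qed.

Lemma is_derive_Gamma_third (t : R) : 0 < t ->
  is_derive (fun t => 3 * expcubeI (Rpower t (1 / 3))) t (Rpower t (1 / 3 - 1) * exp (- t)).
Proof.
  intros Ht. evar_last.
  - apply is_derive_scal.
    apply (is_derive_comp (V := R_NormedModule) expcubeI (fun t => Rpower t (1 / 3))).
    + apply is_derive_expcubeI.
    + apply is_derive_Reals, derivable_pt_lim_power, Ht.
  - rewrite (Rpower_third_cube t Ht). unfold scal; simpl; unfold mult; simpl. field.
Qed.

(** The substitution t = x^3 is carried out on the antiderivative [F] of the integrand, so that the
    improper integral reduces to the limits of [F] at 0 and at infinity. *)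
Lemma Gamma_third : Gamma (1 / 3) = 3 * Rpower cubeLim (1 / 3).
Proof.
  unfold Gamma. apply (is_RInt_gen_unique (V := R_CompleteNormedModule)).
  set (F := fun t => 3 * expcubeI (Rpower t (1 / 3))).
  assert (Hpos : filter_prod (at_right 0) (Rbar_locally p_infty)
            (fun ab : R * R => forall x, Rmin (fst ab) (snd ab) <= x -> 0 < x)).
  { apply (Filter_prod _ _ _ (fun x => 0 < x) (fun x => 0 < x)).
    - exists (mkposreal 1 Rlt_0_1); intros y _ Hy; exact Hy.
    - exists 0; auto.
    - intros x y Hx Hy z Hz; simpl in Hz. eapply Rlt_le_trans; [|exact Hz].
      now apply Rmin_pos. }
  apply (is_RInt_gen_ext (V := R_NormedModule) (Derive F)).
  - revert Hpos; apply filter_imp; intros ab H x Hx.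
    apply is_derive_unique, is_derive_Gamma_third, H; lra.
  - replace (3 * Rpower cubeLim (1 / 3)) with (3 * Rpower cubeLim (1 / 3) - 0) by ring.
    apply is_RInt_gen_Derive.
    + revert Hpos; apply filter_imp; intros ab H x Hx.
      eexists; apply is_derive_Gamma_third, H; lra.
    + revert Hpos; apply filter_imp; intros ab H x Hx.
      assert (Hx0 : 0 < x) by (apply H; lra).
      apply (continuous_ext_loc _ (fun t => Rpower t (1 / 3 - 1) * exp (- t))).
      * exists (mkposreal x Hx0); intros y Hy.
        symmetry; apply is_derive_unique, is_derive_Gamma_third.
        apply Rabs_def2 in Hy; unfold minus, plus, opp in Hy; simpl in Hy; lra.
      * unfold Rpower; by_derivable.
    + assert (E : expcubeI 0 = 0) by exact (RInt_point _ _).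
      replace (locally 0) with (locally (3 * expcubeI 0)) by (now rewrite E, Rmult_0_r).
      apply (filterlim_comp _ _ _ (fun t => Rpower t (1 / 3)) (fun x => 3 * expcubeI x)
               _ (locally 0)).
      * intros P [e He]. assert (H3 : 0 < e ^ 3) by (apply pow_lt, cond_pos).
        exists (mkposreal _ H3); intros y Hy Hy0. apply He.
        unfold ball; simpl; unfold AbsRing_ball, abs, minus, plus, opp; simpl.
        rewrite Ropp_0, Rplus_0_r, Rabs_pos_eq by (left; apply exp_pos).
        apply Rpower_third_lt; [assumption | apply cond_pos |].
        apply Rabs_def2 in Hy; unfold minus, plus, opp in Hy; simpl in Hy; simpl; lra.
      * apply (ex_derive_cont (fun x => 3 * expcubeI x) 0).
        eexists; apply is_derive_scal, is_derive_expcubeI.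
    + apply (is_lim_comp (fun x => 3 * expcubeI x) (fun t => Rpower t (1 / 3)) p_infty
               (3 * Rpower cubeLim (1 / 3)) p_infty).
      * apply (is_lim_scal_l _ 3 p_infty (Rpower cubeLim (1 / 3))), is_lim_expcubeI.
      * intros P [M HM]. exists (Rmax 1 M ^ 3); intros y Hy. apply HM.
        apply Rle_lt_trans with (Rmax 1 M); [apply Rmax_r|].
        pose proof (Rmax_l 1 M). apply Rpower_third_gt; try lra.
        eapply Rlt_trans; [|exact Hy]. apply pow_lt; lra.
      * exists 0; intros t _; discriminate.
Qed.

(** The factor 2 pi of the reflection formula cancels the 1 / (2 pi) in [varpi]. *)
Lemma varpi_fermatI : varpi = 2 * sqrt 3 * fermatI.
Proof.
  unfold varpi. rewrite Gamma_third, Rpow_mult_distr, (Rpower_third_cube _ cubeLim_pos).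
  unfold cubeLim. pose proof PI_RGT_0.
  assert (H3 : sqrt 3 * sqrt 3 = 3) by (apply sqrt_sqrt; lra).
  assert (Hs : 0 < sqrt 3) by (apply sqrt_lt_R0; lra).
  field_simplify_eq; [|split; lra]. replace (sqrt 3 ^ 2) with 3 by (simpl; lra). ring.
Qed.

Lemma varpi_pos : 0 < varpi.
Proof.
  rewrite varpi_fermatI. pose proof fermatI_pos.
  assert (0 < sqrt 3) by (apply sqrt_lt_R0; lra). apply Rmult_lt_0_compat; lra.
Qed.

(** * Unordered sums *)

Open Scope C_scope.

Definition csum (f : C -> C) (l : list C) : C := fold_right Cplus 0 (map f l).

Definition rsum {T : Type} (g : T -> R) (l : list T) : R :=
  fold_right Rplus 0%R (map g l).

Lemma rsum_app {T : Type} (g : T -> R) (l1 l2 : list T) :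
  rsum g (l1 ++ l2) = (rsum g l1 + rsum g l2)%R.
Proof.
  unfold rsum; induction l1 as [|x l1 IH]; simpl; [ring | rewrite IH; ring].
Qed.

Lemma rsum_nonneg {T : Type} (g : T -> R) (l : list T) :
  (forall x, 0 <= g x) -> 0 <= rsum g l.
Proof.
  intros Hg; unfold rsum; induction l as [|x l IH]; simpl; [lra | specialize (Hg x); lra].
Qed.

Lemma rsum_le {T : Type} (g h : T -> R) (l : list T) :
  List.Forall (fun x => (g x <= h x)) l -> rsum g l <= rsum h l.
Proof.
  unfold rsum; induction 1; simpl; lra.
Qed.

Lemma rsum_scal {T : Type} (c : R) (g : T -> R) (l : list T) :
  rsum (fun x => c * g x)%R l = (c * rsum g l)%R.
Proof.
  unfold rsum; induction l as [|x l IH]; simpl; [ring | rewrite IH; ring].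
Qed.

Lemma rsum_incl {T : Type} (g : T -> R) (l1 l2 : list T) :
  (forall x, 0 <= g x) -> NoDup l1 -> incl l1 l2 -> rsum g l1 <= rsum g l2.
Proof.
  intros Hg; revert l2; induction l1 as [|x l1 IH]; intros l2 Hn Hi.
  - apply rsum_nonneg, Hg.
  - inversion Hn as [|? ? Hx Hn']; subst.
    destruct (in_split x l2) as [a [b ->]]; [apply Hi; now left|].
    assert (H : rsum g l1 <= rsum g (a ++ b)).
    { apply IH; [assumption|].
      intros y Hy; specialize (Hi y (or_intror Hy)).
      rewrite in_app_iff in *; simpl in Hi.
      destruct Hi as [|[->|]]; tauto. }
    rewrite rsum_app in *; unfold rsum in *; simpl; lra.
Qed.

Lemma csum_plus (f g : C -> C) (l : list C) :
  csum (fun w => f w + g w) l = csum f l + csum g l.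
Proof.
  unfold csum; induction l as [|x l IH]; simpl; [ring | rewrite IH; ring].
Qed.

Lemma csum_scal (c : C) (f : C -> C) (l : list C) :
  csum (fun w => c * f w) l = c * csum f l.
Proof.
  unfold csum; induction l as [|x l IH]; simpl; [ring | rewrite IH; ring].
Qed.

Lemma csum_app (f : C -> C) (l1 l2 : list C) :
  csum f (l1 ++ l2) = csum f l1 + csum f l2.
Proof.
  unfold csum; induction l1 as [|x l IH]; simpl; [ring | rewrite IH; ring].
Qed.

Lemma csum_ext (f g : C -> C) (l : list C) :
  List.Forall (fun w => f w = g w) l -> csum f l = csum g l.
Proof.
  unfold csum; induction 1 as [|x l H _ IH]; simpl; [|rewrite H, IH]; reflexivity.
Qed.

Lemma csum_conj (f : C -> C) (l : list C) :
  csum (fun w => Cconj (f w)) l = Cconj (csum f l).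
Proof.
  unfold csum; induction l as [|x l IH]; simpl.
  - unfold Cconj, RtoC; simpl; now rewrite Ropp_0.
  - now rewrite Cplus_conj, IH.
Qed.

Lemma csum_Cmod (f : C -> C) (l : list C) :
  Cmod (csum f l) <= rsum (fun w => Cmod (f w)) l.
Proof.
  unfold csum, rsum; induction l as [|x l IH]; simpl.
  - rewrite Cmod_0; lra.
  - eapply Rle_trans; [apply Cmod_triangle|]; lra.
Qed.

Lemma csum_fst (f : C -> C) (l : list C) :
  fst (csum f l) = rsum (fun w => fst (f w)) l.
Proof.
  unfold csum, rsum; induction l as [|x l IH]; simpl; [|rewrite IH]; reflexivity.
Qed.

Lemma csum_snd (f : C -> C) (l : list C) :
  snd (csum f l) = rsum (fun w => snd (f w)) l.
Proof.
  unfold csum, rsum; induction l as [|x l IH]; simpl; [|rewrite IH]; reflexivity.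
Qed.

Definition abs_bound (A : C -> Prop) (f : C -> C) (B : R) : Prop :=
  forall l : list C, NoDup l -> List.Forall A l ->
    rsum (fun w => Cmod (f w)) l <= B.

Lemma abs_bound_le (A : C -> Prop) (f : C -> C) (g : C -> R) (K B : R) :
  0 <= K ->
  (forall l, NoDup l -> List.Forall A l -> rsum g l <= B) ->
  (forall w, A w -> Cmod (f w) <= K * g w) -> abs_bound A f (K * B).
Proof.
  intros HK HB Hf l Hn HA.
  apply Rle_trans with (rsum (fun w => K * g w)%R l).
  - apply rsum_le. eapply List.Forall_impl; [|exact HA]. exact Hf.
  - rewrite rsum_scal. now apply Rmult_le_compat_l; [|apply HB].
Qed.

(** The limit is the supremum of the finite sums, which grow with the list because the terms are
    nonnegative. *)
Lemma nonneg_net_limit (A : C -> Prop) (g : C -> R) (B : R) :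
  (forall w, 0 <= g w) ->
  (forall l, NoDup l -> List.Forall A l -> rsum g l <= B) ->
  exists s, forall eps : posreal, exists l0, List.Forall A l0 /\
    forall l, NoDup l -> List.Forall A l -> incl l0 l ->
      Rabs (rsum g l - s) < eps.
Proof.
  intros Hg HB.
  destruct (completeness (fun x => exists l, NoDup l /\ List.Forall A l /\ x = rsum g l))
    as [s [Hs1 Hs2]].
  - exists B; intros x [l [H1 [H2 ->]]]; auto.
  - exists 0%R, nil; repeat split; constructor.
  - exists s; intros eps.
    destruct (classic (exists l, NoDup l /\ List.Forall A l /\ (s - eps < rsum g l)))
      as [[l0 [H1 [H2 H3]]]|H].
    + exists l0; split; [assumption|]; intros l Hn HA Hi.
      assert (rsum g l <= s) by (apply Hs1; exists l; auto).
      assert (rsum g l0 <= rsum g l) by (apply rsum_incl; auto).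
      apply Rabs_def1; destruct eps; simpl in *; lra.
    + exfalso. assert (s <= s - eps).
      { apply Hs2; intros x [l [H1 [H2 ->]]].
        apply Rnot_lt_le; intros Hl; apply H; exists l; auto. }
      destruct eps; simpl in *; lra.
Qed.

(** Writing r = (g + r) - g reduces the claim to two nonnegative families, bounded by 2 B and B. *)
Lemma real_net_limit (A : C -> Prop) (r : C -> R) (g : C -> R) (B : R) :
  (forall w, Rabs (r w) <= g w) ->
  (forall l, NoDup l -> List.Forall A l -> rsum g l <= B) ->
  exists s, forall eps : posreal, exists l0, List.Forall A l0 /\
    forall l, NoDup l -> List.Forall A l -> incl l0 l ->
      Rabs (rsum r l - s) < eps.
Proof.
  intros Hr HB.
  assert (Hpos : forall w, 0 <= g w).
  { intros w; eapply Rle_trans; [apply Rabs_pos | apply Hr]. }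
  destruct (nonneg_net_limit A g B Hpos HB) as [s1 H1].
  destruct (nonneg_net_limit A (fun w => (g w + r w)%R) (2 * B)%R) as [s2 H2].
  - intros w; specialize (Hr w); apply Rabs_le_between in Hr; lra.
  - intros l Hn HA. apply Rle_trans with (rsum (fun w => 2 * g w)%R l).
    + apply rsum_le, List.Forall_forall; intros w _.
      specialize (Hr w); apply Rabs_le_between in Hr; lra.
    + rewrite rsum_scal; specialize (HB l Hn HA); lra.
  - exists (s2 - s1)%R; intros eps.
    destruct (H1 (pos_div_2 eps)) as [l1 [A1 L1]].
    destruct (H2 (pos_div_2 eps)) as [l2 [A2 L2]].
    exists (l1 ++ l2); split; [now apply List.Forall_app|].
    intros l Hn HA Hi.
    specialize (L1 l Hn HA (fun x h => Hi x (in_or_app _ _ _ (or_introl h)))).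
    specialize (L2 l Hn HA (fun x h => Hi x (in_or_app _ _ _ (or_intror h)))).
    assert (E : rsum r l = (rsum (fun w => g w + r w)%R l - rsum g l)%R).
    { unfold rsum; clear; induction l as [|x l IH]; simpl; [ring|rewrite IH; ring]. }
    rewrite E. simpl in L1, L2.
    apply Rabs_def2 in L1; apply Rabs_def2 in L2; apply Rabs_def1; lra.
Qed.

Lemma Cmod_le_sum (z : C) : Cmod z <= Rabs (fst z) + Rabs (snd z).
Proof.
  destruct z as [a b]; unfold Cmod; simpl fst; simpl snd.
  apply Rsqr_incr_0_var.
  - rewrite Rsqr_sqrt by nra. unfold Rsqr.
    pose proof (Rabs_pos a); pose proof (Rabs_pos b).
    assert (a ^ 2 = Rabs a * Rabs a)%R by (rewrite <- Rabs_mult, Rabs_pos_eq; nra).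
    assert (b ^ 2 = Rabs b * Rabs b)%R by (rewrite <- Rabs_mult, Rabs_pos_eq; nra).
    nra.
  - pose proof (Rabs_pos a); pose proof (Rabs_pos b); lra.
Qed.

Lemma fst_le_Cmod (z : C) : Rabs (fst z) <= Cmod z.
Proof. eapply Rle_trans; [apply Rmax_l | apply Rmax_Cmod]. Qed.

Lemma snd_le_Cmod (z : C) : Rabs (snd z) <= Cmod z.
Proof. eapply Rle_trans; [apply Rmax_r | apply Rmax_Cmod]. Qed.

Lemma is_sum_over_exists (A : C -> Prop) (f : C -> C) (B : R) :
  abs_bound A f B -> exists s, is_sum_over A f s.
Proof.
  intros HB.
  destruct (real_net_limit A (fun w => fst (f w)) _ B (fun w => fst_le_Cmod (f w)) HB)
    as [s1 H1].
  destruct (real_net_limit A (fun w => snd (f w)) _ B (fun w => snd_le_Cmod (f w)) HB)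
    as [s2 H2].
  exists (s1, s2); intros eps.
  destruct (H1 (pos_div_2 eps)) as [l1 [A1 L1]].
  destruct (H2 (pos_div_2 eps)) as [l2 [A2 L2]].
  exists (l1 ++ l2); split; [now apply List.Forall_app|].
  intros l Hn HA Hi.
  specialize (L1 l Hn HA (fun x h => Hi x (in_or_app _ _ _ (or_introl h)))).
  specialize (L2 l Hn HA (fun x h => Hi x (in_or_app _ _ _ (or_intror h)))).
  change (fold_right Cplus 0 (map f l)) with (csum f l).
  eapply Rle_lt_trans; [apply Cmod_le_sum|].
  change (fst (csum f l - (s1, s2))) with (fst (csum f l) - s1)%R.
  change (snd (csum f l - (s1, s2))) with (snd (csum f l) - s2)%R.
  rewrite csum_fst, csum_snd. simpl in L1, L2; lra.
Qed.

(** The finite subsets are directed: the witnesses of both sums are joined and freed of duplicates,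
    which gives one list that is late enough for both. *)
Lemma is_sum_over_close (A : C -> Prop) (f g : C -> C) (s t : C) :
  is_sum_over A f s -> is_sum_over A g t ->
  forall eps : posreal, exists l, NoDup l /\ List.Forall A l /\
    (Cmod (csum f l - s) < eps) /\ (Cmod (csum g l - t) < eps).
Proof.
  intros Hs Ht eps.
  destruct (Hs eps) as [l1 [A1 L1]]; destruct (Ht eps) as [l2 [A2 L2]].
  assert (HA : List.Forall A (l1 ++ l2)) by now apply List.Forall_app.
  exists (nodup Ceq_dec (l1 ++ l2)).
  assert (Hn : NoDup (nodup Ceq_dec (l1 ++ l2))) by apply NoDup_nodup.
  assert (HA' : List.Forall A (nodup Ceq_dec (l1 ++ l2))).
  { rewrite List.Forall_forall in *; intros x Hx; apply HA; now apply nodup_In in Hx. }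
  repeat split; try assumption.
  - apply L1; auto. intros x Hx; apply nodup_In, in_or_app; now left.
  - apply L2; auto. intros x Hx; apply nodup_In, in_or_app; now right.
Qed.

Lemma Cmod_le_eps_0 (z : C) : (forall eps : posreal, Cmod z < eps) -> z = 0.
Proof.
  intros H; apply Cmod_eq_0.
  destruct (Rle_lt_or_eq_dec 0 (Cmod z) (Cmod_ge_0 z)) as [Hp|]; [|now symmetry].
  specialize (H (mkposreal _ Hp)); simpl in H; lra.
Qed.

Lemma is_sum_over_unique (A : C -> Prop) (f : C -> C) (s t : C) :
  is_sum_over A f s -> is_sum_over A f t -> s = t.
Proof.
  intros Hs Ht. apply Ceq_minus, Cmod_le_eps_0; intros eps.
  destruct (is_sum_over_close A f f s t Hs Ht (pos_div_2 eps)) as [l [_ [_ [H1 H2]]]].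
  replace (s - t) with (- (csum f l - s) + (csum f l - t)) by ring.
  eapply Rle_lt_trans; [apply Cmod_triangle|]; rewrite Cmod_opp; simpl in *; lra.
Qed.

Lemma sum_over_eq (A : C -> Prop) (f : C -> C) (s : C) :
  is_sum_over A f s -> sum_over A f = s.
Proof.
  intros Hs. unfold sum_over.
  apply (iota_unique (V := C_CompleteNormedModule)); [|exact Hs].
  intros y Hy; exact (is_sum_over_unique A f y s Hy Hs).
Qed.

Lemma sum_over_correct (A : C -> Prop) (f : C -> C) (B : R) :
  abs_bound A f B -> is_sum_over A f (sum_over A f).
Proof.
  intros HB; destruct (is_sum_over_exists A f B HB) as [s Hs].
  now rewrite (sum_over_eq A f s Hs).
Qed.

Lemma is_sum_over_bound (A : C -> Prop) (f : C -> C) (s : C) (B : R) :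
  abs_bound A f B -> is_sum_over A f s -> Cmod s <= B.
Proof.
  intros HB Hs. apply le_epsilon; intros eps He.
  destruct (is_sum_over_close A f f s s Hs Hs (mkposreal eps He)) as [l [Hn [HA [H1 _]]]].
  replace s with (- (csum f l - s) + csum f l) by ring.
  eapply Rle_trans; [apply Cmod_triangle|]; rewrite Cmod_opp.
  specialize (HB l Hn HA); pose proof (csum_Cmod f l); simpl in H1; lra.
Qed.

Lemma is_sum_over_ext (A : C -> Prop) (f g : C -> C) (s : C) :
  (forall w, A w -> f w = g w) -> is_sum_over A f s -> is_sum_over A g s.
Proof.
  intros E Hs eps; destruct (Hs eps) as [l0 [H0 H1]].
  exists l0; split; [assumption|]; intros l Hn HA Hi.
  change (Cmod (csum g l - s) < eps).
  rewrite <- (csum_ext f g); [now apply H1|].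
  eapply List.Forall_impl; [|exact HA]; exact E.
Qed.

Lemma is_sum_over_plus (A : C -> Prop) (f g : C -> C) (s t : C) :
  is_sum_over A f s -> is_sum_over A g t ->
  is_sum_over A (fun w => f w + g w) (s + t).
Proof.
  intros Hs Ht eps.
  destruct (Hs (pos_div_2 eps)) as [l1 [A1 L1]].
  destruct (Ht (pos_div_2 eps)) as [l2 [A2 L2]].
  exists (l1 ++ l2); split; [now apply List.Forall_app|].
  intros l Hn HA Hi.
  specialize (L1 l Hn HA (fun x h => Hi x (in_or_app _ _ _ (or_introl h)))).
  specialize (L2 l Hn HA (fun x h => Hi x (in_or_app _ _ _ (or_intror h)))).
  change (Cmod (csum (fun w => f w + g w)%C l - (s + t)) < eps).
  rewrite csum_plus.
  replace (csum f l + csum g l - (s + t)) with ((csum f l - s) + (csum g l - t)) by ring.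
  eapply Rle_lt_trans; [apply Cmod_triangle|].
  simpl in L1, L2; unfold csum; lra.
Qed.

Lemma is_sum_over_scal (A : C -> Prop) (c : C) (f : C -> C) (s : C) :
  is_sum_over A f s -> is_sum_over A (fun w => c * f w) (c * s).
Proof.
  intros Hs eps.
  pose proof (Cmod_ge_0 c) as Hc.
  assert (Hd : 0 < eps / (1 + Cmod c)) by (apply Rdiv_lt_0_compat; [apply cond_pos|lra]).
  destruct (Hs (mkposreal _ Hd)) as [l0 [H0 H1]].
  exists l0; split; [assumption|]; intros l Hn HA Hi.
  change (Cmod (csum (fun w => c * f w)%C l - c * s) < eps).
  rewrite csum_scal. replace (c * csum f l - c * s) with (c * (csum f l - s)) by ring.
  rewrite Cmod_mult. specialize (H1 l Hn HA Hi); simpl in H1; fold (csum f l) in H1.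
  apply Rle_lt_trans with ((1 + Cmod c) * Cmod (csum f l - s))%R.
  - pose proof (Cmod_ge_0 (csum f l - s)); nra.
  - apply (Rmult_lt_compat_l (1 + Cmod c)) in H1; [|lra].
    replace ((1 + Cmod c) * (eps / (1 + Cmod c)))%R with (pos eps) in H1 by (field; lra).
    exact H1.
Qed.

Lemma is_sum_over_conj (A : C -> Prop) (f : C -> C) (s : C) :
  is_sum_over A f s -> is_sum_over A (fun w => Cconj (f w)) (Cconj s).
Proof.
  intros Hs eps; destruct (Hs eps) as [l0 [H0 H1]].
  exists l0; split; [assumption|]; intros l Hn HA Hi.
  change (Cmod (csum (fun w => Cconj (f w)) l - Cconj s) < eps).
  rewrite csum_conj, <- Cminus_conj, Cmod_conj. now apply H1.
Qed.

(** The limit runs over all finite subsets and not along an enumeration, so a bijection of A leaves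
    it unchanged. This lets rotations, conjugation and translations act on the lattice series. *)
Lemma is_sum_over_reindex (A : C -> Prop) (phi psi : C -> C) (f : C -> C) (s : C) :
  (forall w, A w -> A (phi w)) -> (forall w, A w -> A (psi w)) ->
  (forall w, psi (phi w) = w) -> (forall w, phi (psi w) = w) ->
  is_sum_over A f s -> is_sum_over A (fun w => f (phi w)) s.
Proof.
  intros H1 H2 E1 E2 Hs eps; destruct (Hs eps) as [l0 [H0 L0]].
  exists (map psi l0); split.
  - rewrite List.Forall_map; eapply List.Forall_impl; [|exact H0]; exact H2.
  - intros l Hn HA Hi.
    assert (Hm : fold_right Cplus 0 (map (fun w => f (phi w)) l)
                 = fold_right Cplus 0 (map f (map phi l))) by now rewrite map_map.
    rewrite Hm; apply L0.
    + apply Injective_map_NoDup; [|assumption].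
      intros x y Hxy; rewrite <- (E1 x), <- (E1 y), Hxy; reflexivity.
    + rewrite List.Forall_map; eapply List.Forall_impl; [|exact HA]; exact H1.
    + intros x Hx. rewrite <- (E2 x); apply in_map, Hi, in_map, Hx.
Qed.

Lemma csum_remove (f : C -> C) (a : C) (l : list C) :
  NoDup l -> In a l -> csum f l = f a + csum f (remove Ceq_dec a l).
Proof.
  induction l as [|x l IH]; intros Hn Hin; [contradiction|].
  inversion Hn as [|? ? Hx Hn']; subst.
  unfold csum in *; simpl. destruct (Ceq_dec a x) as [->|Hne].
  - now rewrite notin_remove.
  - simpl. destruct Hin as [->|Hin]; [now elim Hne|].
    rewrite IH by assumption; ring.
Qed.

Lemma NoDup_remove_eq (a : C) (l : list C) : NoDup l -> NoDup (remove Ceq_dec a l).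
Proof.
  induction l as [|x l IH]; intros Hn; simpl; [constructor|].
  inversion Hn as [|? ? Hx Hn']; subst.
  destruct (Ceq_dec a x); [now apply IH|].
  constructor; [|now apply IH].
  intros H; apply in_remove in H; tauto.
Qed.

Lemma is_sum_over_insert (A : C -> Prop) (a : C) (f : C -> C) (s : C) :
  A a -> is_sum_over (fun w => A w /\ w <> a) f s -> is_sum_over A f (f a + s).
Proof.
  intros Ha Hs eps; destruct (Hs eps) as [l0 [H0 L0]].
  exists (a :: l0); split.
  - constructor; [assumption|]. eapply List.Forall_impl; [|exact H0]; simpl; tauto.
  - intros l Hn HA Hi. change (Cmod (csum f l - (f a + s)) < eps).
    rewrite (csum_remove f a l Hn) by (apply Hi; now left).
    replace (f a + csum f (remove Ceq_dec a l) - (f a + s))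
      with (csum f (remove Ceq_dec a l) - s) by ring.
    apply L0.
    + now apply NoDup_remove_eq.
    + rewrite List.Forall_forall in *; intros x Hx; apply in_remove in Hx.
      split; [now apply HA | tauto].
    + intros x Hx. apply in_in_remove; [|apply Hi; now right].
      rewrite List.Forall_forall in H0; now apply H0.
Qed.

(** * The hexagonal lattice *)

Definition rho : C := expi (PI / 3).

Lemma rho_eq : rho = ((1 / 2)%R, (sqrt 3 / 2)%R).
Proof. unfold rho, expi. now rewrite cos_PI3, sin_PI3. Qed.

Lemma sqrt3_sq : (sqrt 3 * sqrt 3 = 3)%R.
Proof. apply sqrt_sqrt; lra. Qed.

Lemma sqrt3_pos : 0 < sqrt 3.
Proof. apply sqrt_lt_R0; lra. Qed.

Lemma rho_sq : rho * rho = rho - 1.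
Proof.
  rewrite rho_eq. apply injective_projections; simpl; pose proof sqrt3_sq; lra.
Qed.

Lemma rho_conj : Cconj rho = 1 - rho.
Proof. rewrite rho_eq. apply injective_projections; simpl; lra. Qed.

Lemma rho_pow3 : rho ^ 3 = - (1).
Proof.
  simpl. rewrite Cmult_1_r, rho_sq.
  replace (rho * (rho - 1)) with (rho * rho - rho) by ring. rewrite rho_sq; ring.
Qed.

Lemma rho_neq_0 : rho <> 0.
Proof. rewrite rho_eq; intros E; injection E; intros; lra. Qed.

Definition lat (m n : Z) : C := RtoC (IZR m) * varpi + RtoC (IZR n) * rho * varpi.

Lemma hexT_lat (m n : Z) : hexT (lat m n).
Proof. now exists m, n. Qed.

Lemma hexT_inv (w : C) : hexT w -> exists m n, w = lat m n.
Proof. intros [m [n ->]]; now exists m, n. Qed.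

Lemma hexT_0 : hexT 0.
Proof. exists 0%Z, 0%Z; unfold RtoC; apply injective_projections; simpl; ring. Qed.

Lemma lat_plus (m n p q : Z) : lat m n + lat p q = lat (m + p) (n + q).
Proof. unfold lat; rewrite !plus_IZR, !RtoC_plus; ring. Qed.

Lemma lat_opp (m n : Z) : - lat m n = lat (- m) (- n).
Proof. unfold lat; rewrite !opp_IZR, !RtoC_opp; ring. Qed.

Lemma hexT_plus (v w : C) : hexT v -> hexT w -> hexT (v + w).
Proof. intros Hv Hw. destruct (hexT_inv v Hv) as [m [n ->]]. destruct (hexT_inv w Hw) as [p [q ->]].
  rewrite lat_plus. apply hexT_lat. Qed.

Lemma hexT_opp (w : C) : hexT w -> hexT (- w).
Proof. intros Hw. destruct (hexT_inv w Hw) as [m [n ->]]. rewrite lat_opp. apply hexT_lat. Qed.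

Lemma hexT_minus (v w : C) : hexT v -> hexT w -> hexT (v - w).
Proof. intros; apply hexT_plus; [|apply hexT_opp]; assumption. Qed.

Lemma hexT_rho (w : C) : hexT w -> hexT (rho * w).
Proof.
  intros [m [n ->]]. fold rho.
  replace (rho * _) with (lat (- n) (m + n)); [apply hexT_lat|].
  unfold lat; rewrite opp_IZR, plus_IZR, RtoC_opp, RtoC_plus.
  replace (rho * (RtoC (IZR m) * varpi + RtoC (IZR n) * rho * varpi))
    with (rho * RtoC (IZR m) * varpi + RtoC (IZR n) * (rho * rho) * varpi) by ring.
  rewrite rho_sq; ring.
Qed.

Lemma hexT_rho_div (w : C) : hexT w -> hexT (w / rho).
Proof.
  intros H. replace (w / rho) with (- (rho * (rho * w))).
  - now apply hexT_opp, hexT_rho, hexT_rho.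
  - pose proof rho_pow3 as E. pose proof rho_neq_0.
    replace w with (- (rho ^ 3) * w) at 2 by (rewrite E; ring). field; assumption.
Qed.

Lemma RtoC_conj (x : R) : Cconj x = x.
Proof. apply injective_projections; simpl; ring. Qed.

Lemma Cconj_conj (z : C) : Cconj (Cconj z) = z.
Proof. apply injective_projections; simpl; ring. Qed.

Lemma hexT_conj (w : C) : hexT w -> hexT (Cconj w).
Proof.
  intros [m [n ->]]. fold rho.
  rewrite Cplus_conj, !Cmult_conj, !RtoC_conj, rho_conj.
  replace (_ + _) with (lat (m + n) (- n)); [apply hexT_lat|].
  unfold lat; rewrite opp_IZR, plus_IZR, RtoC_opp, RtoC_plus; ring.
Qed.

(** The norm form |x + y rho|^2 of the Eisenstein integers. *)
Definition hexform (x y : R) : R := (x * x + x * y + y * y)%R.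

Lemma Cmod_sq (z : C) : (Cmod z * Cmod z = fst z * fst z + snd z * snd z)%R.
Proof.
  pose proof (Cmod2_alt z) as H. simpl in H. unfold Re, Im in H.
  rewrite !Rmult_1_r in H. exact H.
Qed.

Lemma Cmod_hexform (x y : R) :
  (Cmod (RtoC x * varpi + RtoC y * rho * varpi) * Cmod (RtoC x * varpi + RtoC y * rho * varpi)
   = varpi * varpi * hexform x y)%R.
Proof.
  rewrite Cmod_sq, rho_eq. unfold hexform, RtoC; simpl. pose proof sqrt3_sq.
  transitivity (varpi * varpi * ((x + y * / 2) * (x + y * / 2) + (y * / 2) * (y * / 2) * (sqrt 3 * sqrt 3)))%R.
  - field.
  - rewrite H; field.
Qed.

Lemma hex_coordinates (z : C) :
  exists x y : R, z = RtoC x * varpi + RtoC y * rho * varpi.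
Proof.
  pose proof varpi_pos; pose proof sqrt3_pos.
  exists ((fst z - snd z / sqrt 3) / varpi)%R, (2 * snd z / (sqrt 3 * varpi))%R.
  rewrite rho_eq; apply injective_projections; simpl; field; lra.
Qed.

Lemma hexform_int_ge_1 (m n : Z) : (m <> 0 \/ n <> 0)%Z -> 1 <= hexform (IZR m) (IZR n).
Proof.
  intros H. unfold hexform. rewrite <- !mult_IZR, <- !plus_IZR.
  apply IZR_le. nia.
Qed.

Lemma Rsq_le_le (a b : R) : (0 <= b -> a * a <= b * b -> a <= b)%R.
Proof. intros; nra. Qed.

Lemma hexT_separated (w : C) : hexT w -> w <> 0 -> varpi <= Cmod w.
Proof.
  intros [m [n ->]] H. fold rho in *.
  pose proof varpi_pos. apply Rsq_le_le; [apply Cmod_ge_0|].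
  rewrite Cmod_hexform.
  assert (1 <= hexform (IZR m) (IZR n)); [|nra].
  apply hexform_int_ge_1.
  destruct (Z.eq_dec m 0) as [->|]; [|now left].
  destruct (Z.eq_dec n 0) as [->|]; [|now right].
  elim H. change (IZR 0) with 0%R. ring.
Qed.

Lemma Z_nearest (x : R) : exists m : Z, Rabs (x - IZR m) <= / 2.
Proof.
  exists (up (x - / 2)). destruct (archimed (x - / 2)). apply Rabs_le; lra.
Qed.

(** Rounding both coordinates leaves |x|, |y| <= 1/2, where x^2 + x y + y^2 <= 3/4. What matters is
    that 3/4 < 1: every point is closer to the lattice than the minimal distance between lattice
    points. *)
Lemma hexT_nearest (z : C) :
  exists w, hexT w /\ (Cmod (z - w) * Cmod (z - w) <= 3 / 4 * (varpi * varpi)).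
Proof.
  destruct (hex_coordinates z) as [x [y ->]].
  destruct (Z_nearest x) as [m Hm]; destruct (Z_nearest y) as [n Hn].
  exists (lat m n); split; [apply hexT_lat|].
  replace (_ - lat m n) with (RtoC (x - IZR m) * varpi + RtoC (y - IZR n) * rho * varpi)
    by (unfold lat; rewrite !RtoC_minus; ring).
  rewrite Cmod_hexform. unfold hexform. pose proof varpi_pos.
  apply Rabs_le_between in Hm; apply Rabs_le_between in Hn.
  rewrite Rmult_comm. apply Rmult_le_compat_r; nra.
Qed.

Lemma hexT_near (z : C) : exists w, hexT w /\ (Cmod (z - w) < varpi).
Proof.
  destruct (hexT_nearest z) as [w [Hw H]]; exists w; split; [assumption|].
  pose proof varpi_pos. pose proof (Cmod_ge_0 (z - w)). nra.
Qed.

Definition separated (A : C -> Prop) (z : C) (d : R) : Prop :=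
  (0 < d) /\ forall w, A w -> d <= Cmod (z - w).

Lemma Cmod_triangle_sub (a b : C) : Cmod a - Cmod b <= Cmod (a - b).
Proof.
  pose proof (Cmod_triangle (a - b) b) as H.
  replace (a - b + b) with a in H by ring. lra.
Qed.

Lemma Cmod_minus_sym (a b : C) : Cmod (a - b) = Cmod (b - a).
Proof. rewrite <- Cmod_opp; f_equal; ring. Qed.

(** Some lattice point w0 is closer to z than varpi. Every other one has distance at least varpi
    from w0, hence at least varpi - |z - w0| from z. *)
Lemma hexT_dist (z : C) : ~ hexT z -> exists d, separated hexT z d.
Proof.
  intros Hz. destruct (hexT_near z) as [w0 [Hw0 H0]].
  exists (Rmin (Cmod (z - w0)) (varpi - Cmod (z - w0))); split.
  - apply Rmin_pos; [|lra]. apply Cmod_gt_0. intros E; apply Hz.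
    replace z with ((z - w0) + w0) by ring. rewrite E.
    now apply hexT_plus; [apply hexT_0|].
  - intros w Hw. destruct (Ceq_dec w w0) as [->|Hne]; [apply Rmin_l|].
    eapply Rle_trans; [apply Rmin_r|].
    assert (varpi <= Cmod (w - w0)).
    { apply hexT_separated; [now apply hexT_minus|]. now apply Cminus_eq_contra. }
    pose proof (Cmod_triangle (z - w0) (w - z)) as T.
    replace (z - w0 + (w - z)) with (w - w0) in T by ring.
    rewrite (Cmod_minus_sym w z) in T. lra.
Qed.

Definition hexT' (w : C) : Prop := hexT w /\ w <> 0.

Lemma hexT'_dist (z : C) : Cmod z < varpi -> separated hexT' z (varpi - Cmod z).
Proof.
  intros Hz; split; [lra|]. intros w [Hw H0].
  pose proof (hexT_separated w Hw H0). pose proof (Cmod_triangle_sub w z).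
  rewrite Cmod_minus_sym; lra.
Qed.

(** The majorant for all lattice series: 3 is the least integral exponent that is summable over a
    planar lattice, and the added 1 keeps the value at w = 0 finite. *)
Definition weight (w : C) : R := (/ (1 + Cmod w) ^ 3)%R.

(** This is (1 + |m|)^(-3/2): half of the exponent 3 falls to each coordinate, and 3/2 > 1 keeps the
    one-dimensional sums bounded. *)
Definition sweight (m : Z) : R := (/ sqrt (1 + Rabs (IZR m)) ^ 3)%R.

Lemma sweight_nonneg (m : Z) : 0 < sweight m.
Proof.
  apply Rinv_0_lt_compat, pow_lt, sqrt_lt_R0. pose proof (Rabs_pos (IZR m)); lra.
Qed.

(* AM-GM: (1+|w|)^2 >= c (1+|m|)(1+|n|), so the weight is dominated by a product. *)
Lemma weight_lat_le :
  exists K, 0 <= K /\ forall m n, weight (lat m n) <= K * (sweight m * sweight n).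
Proof.
  pose proof varpi_pos as Hv.
  (* Since the norm form is at least (m^2 + n^2) / 2, this [c] satisfies 1 + |w|^2 >= c (1 + m^2 +
     n^2). The further factor 1/2 below comes from (1 + |m|)(1 + |n|) <= 2 (1 + m^2 + n^2). *)
  set (c := Rmin 1 (varpi * varpi / 2)).
  assert (Hc : 0 < c) by (apply Rmin_pos; nra).
  assert (Hk : 0 < sqrt (c / 2)) by (apply sqrt_lt_R0; lra).
  exists (/ sqrt (c / 2) ^ 3)%R; split; [left; apply Rinv_0_lt_compat, pow_lt, Hk|].
  intros m n. unfold weight, sweight.
  set (a := (1 + Rabs (IZR m))%R); set (b := (1 + Rabs (IZR n))%R).
  assert (Ha : 1 <= a) by (unfold a; pose proof (Rabs_pos (IZR m)); lra).
  assert (Hb : 1 <= b) by (unfold b; pose proof (Rabs_pos (IZR n)); lra).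
  assert (0 < sqrt a) by (apply sqrt_lt_R0; lra).
  assert (0 < sqrt b) by (apply sqrt_lt_R0; lra).
  rewrite <- !Rinv_mult, <- !Rpow_mult_distr.
  apply Rinv_le_contravar.
  - apply pow_lt. repeat apply Rmult_lt_0_compat; assumption.
  - apply pow_incr; split; [repeat apply Rmult_le_pos; lra|].
    rewrite <- !sqrt_mult by nra.
    pose proof (Cmod_ge_0 (lat m n)) as Hw0.
    rewrite <- (sqrt_Rsqr (1 + Cmod (lat m n))) by lra.
    apply sqrt_le_1_alt. unfold Rsqr.
    assert (Hw : (Cmod (lat m n) * Cmod (lat m n) = varpi * varpi * hexform (IZR m) (IZR n))%R)
      by apply Cmod_hexform.
    assert (Hm : (Rabs (IZR m) * Rabs (IZR m) = IZR m * IZR m)%R)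
      by (rewrite <- Rabs_mult; apply Rabs_pos_eq; nra).
    assert (Hn : (Rabs (IZR n) * Rabs (IZR n) = IZR n * IZR n)%R)
      by (rewrite <- Rabs_mult; apply Rabs_pos_eq; nra).
    assert (Hab : a * b <= 2 * (1 + IZR m * IZR m + IZR n * IZR n))
      by (unfold a, b; rewrite <- Hm, <- Hn; generalize (Rabs (IZR m)) (Rabs (IZR n)); intros r s;
          pose proof (Rle_0_sqr (r - 1)); pose proof (Rle_0_sqr (s - 1));
          pose proof (Rle_0_sqr (r - s)); unfold Rsqr in *; nra).
    assert (Hq : (IZR m * IZR m + IZR n * IZR n) / 2 <= hexform (IZR m) (IZR n))
      by (unfold hexform; pose proof (Rle_0_sqr (IZR m + IZR n)); unfold Rsqr in *; nra).
    assert (H1 : c <= 1) by apply Rmin_l.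
    assert (H2 : c <= varpi * varpi / 2) by apply Rmin_r.
    apply Rle_trans with (c * (1 + (IZR m * IZR m + IZR n * IZR n)))%R; [nra|].
    apply Rle_trans with (1 + varpi * varpi * hexform (IZR m) (IZR n))%R; [|nra].
    assert (0 <= IZR m * IZR m + IZR n * IZR n) by nra.
    apply Rle_trans with (1 + varpi * varpi * ((IZR m * IZR m + IZR n * IZR n) / 2))%R; [nra|].
    apply Rplus_le_compat_l, Rmult_le_compat_l; [nra|assumption].
Qed.

(** Comparison with an integral in telescoping form: the term of index k is at most 4 / sqrt(k+1) -
    4 / sqrt(k+2). The constant 4, in place of the asymptotic 2, absorbs the ratio of consecutive
    square roots, which is at most 3/2: indeed (3/2)(5/2) < 4. *)
Lemma sweight_sum_le (N : nat) :
  rsum (fun k => sweight (Z.of_nat k)) (seq 0 N) <= 4 - 4 / sqrt (INR N + 1).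
Proof.
  induction N as [|N IH].
  - unfold rsum; simpl. rewrite Rplus_0_l, sqrt_1. lra.
  - rewrite seq_S, rsum_app, S_INR. unfold rsum at 2; simpl (fold_right _ _ _).
    rewrite Rplus_0_r. unfold sweight at 2. rewrite <- INR_IZR_INZ.
    rewrite (Rabs_pos_eq (INR N)) by apply pos_INR.
    pose proof (pos_INR N) as HN. rewrite (Rplus_comm 1).
    set (p := sqrt (INR N + 1)) in *. set (q := sqrt (INR N + 1 + 1)).
    assert (Hp : (p * p = INR N + 1)%R) by (apply sqrt_sqrt; lra).
    assert (Hq : (q * q = INR N + 1 + 1)%R) by (apply sqrt_sqrt; lra).
    assert (Hp0 : 0 < p) by (apply sqrt_lt_R0; lra).
    assert (Hq0 : 0 < q) by (apply sqrt_lt_R0; lra).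
    assert (Hqp : q <= 3 / 2 * p) by nra.
    assert (Hd : (q - p = / (p + q))%R) by (field_simplify_eq; nra).
    assert (E : (4 / p - 4 / q = 4 * / (p * q * (p + q)))%R).
    { transitivity (4 * ((q - p) / (p * q)))%R; [field; lra|]. rewrite Hd; field; lra. }
    assert (H : / p ^ 3 <= 4 * / (p * q * (p + q))); [|lra].
    assert (Hx : 0 < p * q * (p + q)) by (repeat apply Rmult_lt_0_compat; lra).
    replace (4 * / (p * q * (p + q)))%R with (/ (p * q * (p + q) / 4))%R by (field; lra).
    apply Rinv_le_contravar; [lra|].
    assert (p * q * (p + q) <= p * (3 / 2 * p) * (5 / 2 * p)); [|simpl; nra].
    apply Rmult_le_compat; nra.
Qed.

(** The entry 0 occurs twice; the list only serves for upper bounds, and [rsum_incl] asks for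
    distinct entries in the smaller list alone. *)
Definition zrange (N : nat) : list Z :=
  map Z.of_nat (seq 0 N) ++ map (fun k => (- Z.of_nat k)%Z) (seq 0 N).

Lemma in_zrange (N : nat) (m : Z) : (Z.abs m < Z.of_nat N)%Z -> In m (zrange N).
Proof.
  intros H. apply in_or_app. destruct (Z.le_gt_cases 0 m).
  - left. rewrite <- (Z2Nat.id m) by lia. apply in_map, in_seq. lia.
  - right. replace m with (- Z.of_nat (Z.to_nat (- m)))%Z by (rewrite Z2Nat.id; lia).
    apply (in_map (fun k => (- Z.of_nat k)%Z)), in_seq. lia.
Qed.

Lemma rsum_map {S T : Type} (f : S -> T) (g : T -> R) (l : list S) :
  rsum g (map f l) = rsum (fun x => g (f x)) l.
Proof. unfold rsum. now rewrite map_map. Qed.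

Lemma sweight_zrange_le (N : nat) : rsum sweight (zrange N) <= 8.
Proof.
  unfold zrange. rewrite rsum_app, !rsum_map.
  assert (E : rsum (fun k => sweight (- Z.of_nat k)) (seq 0 N)
              = rsum (fun k => sweight (Z.of_nat k)) (seq 0 N)).
  { unfold rsum; f_equal. apply map_ext; intros k. unfold sweight.
    now rewrite opp_IZR, Rabs_Ropp. }
  rewrite E. pose proof (sweight_sum_le N).
  assert (0 < 4 / sqrt (INR N + 1)).
  { apply Rdiv_lt_0_compat; [lra|]. apply sqrt_lt_R0. pose proof (pos_INR N); lra. }
  lra.
Qed.

Lemma rsum_list_prod (g : Z -> R) (l1 l2 : list Z) :
  rsum (fun p => (g (fst p) * g (snd p))%R) (list_prod l1 l2) = (rsum g l1 * rsum g l2)%R.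
Proof.
  induction l1 as [|x l1 IH]; simpl.
  - unfold rsum; simpl; ring.
  - rewrite rsum_app, IH, rsum_map. simpl.
    rewrite (rsum_scal (g x) g l2).
    change (rsum g (x :: l1)) with (g x + rsum g l1)%R. ring.
Qed.

Lemma hexT_list (l : list C) :
  List.Forall hexT l -> exists p : list (Z * Z), l = map (fun q => lat (fst q) (snd q)) p.
Proof.
  induction 1 as [|x l Hx _ [p ->]].
  - now exists nil.
  - destruct (hexT_inv x Hx) as [m [n ->]]. now exists ((m, n) :: p).
Qed.

Lemma int_pairs_bounded (p : list (Z * Z)) :
  exists M, forall q, In q p -> (Z.abs (fst q) < M /\ Z.abs (snd q) < M)%Z.
Proof.
  induction p as [|x p [M HM]].
  - exists 0%Z; intros q [].
  - exists (Z.max M (1 + Z.max (Z.abs (fst x)) (Z.abs (snd x)))).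
    intros q [->|Hq]; [lia|]. specialize (HM q Hq); lia.
Qed.

Lemma in_box (p : list (Z * Z)) :
  exists N, incl p (list_prod (zrange N) (zrange N)).
Proof.
  destruct (int_pairs_bounded p) as [M HM]. exists (Z.to_nat M). intros [m n] Hq.
  specialize (HM _ Hq); simpl in HM.
  apply in_prod; apply in_zrange; lia.
Qed.

(** Finitely many lattice points lie in a box, over which the product majorant factors into two
    one-dimensional sums, each at most 8. *)
Lemma hexT_weight_sum :
  exists B, forall l, NoDup l -> List.Forall hexT l -> rsum weight l <= B.
Proof.
  destruct weight_lat_le as [K [HK Hw]].
  exists (K * (8 * 8))%R. intros l Hn HA.
  destruct (hexT_list l HA) as [p ->].
  apply NoDup_map_inv in Hn. rewrite rsum_map.
  apply Rle_trans with (rsum (fun q => (K * (sweight (fst q) * sweight (snd q)))%R) p).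
  - apply rsum_le, List.Forall_forall; intros q _; apply Hw.
  - rewrite (rsum_scal K (fun q => (sweight (fst q) * sweight (snd q))%R)).
    apply Rmult_le_compat_l; [assumption|].
    destruct (in_box p) as [N HN].
    apply Rle_trans with (rsum (fun q => (sweight (fst q) * sweight (snd q))%R) (list_prod (zrange N) (zrange N))); [apply rsum_incl|].
    + intros q; pose proof (sweight_nonneg (fst q)); pose proof (sweight_nonneg (snd q)); nra.
    + assumption.
    + exact HN.
    + rewrite rsum_list_prod. pose proof (sweight_zrange_le N).
      assert (0 <= rsum sweight (zrange N))
        by (apply rsum_nonneg; intros m; left; apply sweight_nonneg).
      apply Rmult_le_compat; assumption.
Qed.

(** * Complex derivatives *)

(** Complex differentiability in terms of increments, the form in which the estimates on series
    arrive; [cder_iff_is_derive] identifies it with the general notion. *)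
Definition cder (f : C -> C) (z l : C) : Prop :=
  forall eps : posreal, exists del : posreal, forall h : C, Cmod h < del ->
    Cmod (f (z + h) - f z - h * l)%C <= eps * Cmod h.

Definition ccont (f : C -> C) (z : C) : Prop :=
  forall eps : posreal, exists del : posreal, forall h : C, Cmod h < del ->
    Cmod (f (z + h) - f z)%C < eps.

Lemma cder_iff_is_derive (f : C -> C) (z l : C) :
  cder f z l <-> is_derive (K := C_AbsRing) (V := AbsRing_NormedModule C_AbsRing) f z l.
Proof.
  assert (E : forall p q : C, p + (q - p) = q) by (intros; ring). split; intros H.
  - split; [apply is_linear_scal_l|].
    intros x Hx.
    apply (is_filter_lim_locally_unique (K := C_AbsRing) (V := AbsRing_NormedModule C_AbsRing)) in Hx.
    subst x. intros eps. destruct (H eps) as [del Hd].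
    exists del. intros y Hy. specialize (Hd (y - z) Hy). rewrite E in Hd. exact Hd.
  - intros eps. destruct (proj2 H z (fun P h => h) eps) as [del Hd].
    exists del. intros h Hh. specialize (Hd (z + h)).
    change ((Cmod (z + h - z)%C < del) ->
            Cmod (f (z + h)%C - f z - (z + h - z) * l)%C <= eps * Cmod (z + h - z)%C) in Hd.
    replace (z + h - z) with h in Hd by ring. now apply Hd.
Qed.

Lemma cder_is_derive (f : C -> C) (z l : C) :
  cder f z l -> is_derive (K := C_AbsRing) (V := C_NormedModule) f z l.
Proof.
  intros H. apply cder_iff_is_derive in H. split; [apply is_linear_scal_l|exact (proj2 H)].
Qed.

Lemma cder_C_derive (f : C -> C) (z l : C) : cder f z l -> C_derive f z = l.
Proof. intros H; apply is_C_derive_unique, cder_is_derive, H. Qed.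

Lemma cder_ext_loc (f g : C -> C) (z l : C) (r : R) :
  0 < r -> (forall h, Cmod h < r -> f (z + h) = g (z + h)) ->
  cder f z l -> cder g z l.
Proof.
  intros Hr E H eps. destruct (H eps) as [del Hd].
  assert (Hm : 0 < Rmin r del) by (apply Rmin_pos; [assumption|apply cond_pos]).
  exists (mkposreal _ Hm); simpl; intros h Hh.
  destruct (Rmin_Rgt_l _ _ _ Hh) as [Hh1 Hh2].
  rewrite <- (E h Hh1).
  assert (E0 : f z = g z).
  { specialize (E 0). rewrite Cplus_0_r in E. apply E. now rewrite Cmod_0. }
  rewrite <- E0. now apply Hd.
Qed.

Lemma cder_ccont (f : C -> C) (z l : C) : cder f z l -> ccont f z.
Proof.
  intros H eps. destruct (H (mkposreal 1 Rlt_0_1)) as [del Hd].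
  pose proof (Cmod_ge_0 l) as Hl.
  assert (Hm : 0 < Rmin del (eps / (1 + Cmod l))).
  { apply Rmin_pos; [apply cond_pos|]. apply Rdiv_lt_0_compat; [apply cond_pos|lra]. }
  exists (mkposreal _ Hm); simpl; intros h Hh.
  destruct (Rmin_Rgt_l _ _ _ Hh) as [Hh1 Hh2].
  specialize (Hd h Hh1); simpl in Hd.
  replace (f (z + h) - f z) with ((f (z + h) - f z - h * l) + h * l) by ring.
  eapply Rle_lt_trans; [apply Cmod_triangle|]. rewrite Cmod_mult.
  apply (Rmult_lt_compat_r (1 + Cmod l)) in Hh2; [|lra].
  unfold Rdiv in Hh2. rewrite Rmult_assoc, Rinv_l in Hh2 by lra. nra.
Qed.

Lemma cder_quadratic (f : C -> C) (z l : C) (K r : R) :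
  0 < r ->
  (forall h, Cmod h < r -> Cmod (f (z + h) - f z - h * l)%C <= K * (Cmod h * Cmod h)) ->
  cder f z l.
Proof.
  intros Hr H eps.
  assert (Hm : 0 < Rmin r (eps / (1 + Rabs K))).
  { apply Rmin_pos; [assumption|]. apply Rdiv_lt_0_compat; [apply cond_pos|].
    pose proof (Rabs_pos K); lra. }
  exists (mkposreal _ Hm); simpl; intros h Hh.
  destruct (Rmin_Rgt_l _ _ _ Hh) as [Hh1 Hh2].
  eapply Rle_trans; [apply H, Hh1|].
  rewrite <- Rmult_assoc. apply Rmult_le_compat_r; [apply Cmod_ge_0|].
  pose proof (Rabs_pos K); pose proof (Rle_abs K); pose proof (Cmod_ge_0 h).
  apply (Rmult_lt_compat_r (1 + Rabs K)) in Hh2; [|lra].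
  unfold Rdiv in Hh2. rewrite Rmult_assoc, Rinv_l in Hh2 by lra. nra.
Qed.

Lemma cder_const (c z : C) : cder (fun _ => c) z 0.
Proof. apply cder_iff_is_derive. exact (is_derive_const (K := C_AbsRing) _ _). Qed.

Lemma cder_plus (f g : C -> C) (z l m : C) :
  cder f z l -> cder g z m -> cder (fun z => f z + g z) z (l + m).
Proof.
  rewrite !cder_iff_is_derive. intros Hf Hg.
  exact (is_derive_plus (K := C_AbsRing) (V := AbsRing_NormedModule C_AbsRing) f g z l m Hf Hg).
Qed.

Lemma cder_mult (f g : C -> C) (z l m : C) :
  cder f z l -> cder g z m -> cder (fun z => f z * g z) z (l * g z + f z * m).
Proof.
  rewrite !cder_iff_is_derive. intros Hf Hg.
  exact (is_derive_mult (K := C_AbsRing) f g z l m Hf Hg Cmult_comm).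
Qed.

Lemma cder_scal (c : C) (f : C -> C) (z l : C) :
  cder f z l -> cder (fun z => c * f z) z (c * l).
Proof.
  intros H. replace (c * l) with (0 * f z + c * l) by ring.
  apply (cder_mult (fun _ => c) f); [apply cder_const | assumption].
Qed.

(** The second order Taylor remainder of u^(-k), uniform in u: the factor |u|^(-k-2) is what later
    makes the remainders summable over the lattice. With x = 1/u and y = 1/(u+h), the induction uses
    y - x = - h x y and |y| <= 2 |x|. *)
Lemma inv_pow_increment (k : nat) :
  exists K, 0 <= K /\ forall u h : C, u <> 0 -> Cmod h <= Cmod u / 2 ->
    Cmod ((/ (u + h)) ^ k - (/ u) ^ k + RtoC (INR k) * h * (/ u) ^ (k + 1))%C
     <= K * (Cmod h * Cmod h * Cmod (/ u) ^ (k + 2)).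
Proof.
  induction k as [|k [K [HK IH]]].
  - exists 0%R; split; [lra|]. intros u h _ _. simpl (_ ^ 0). simpl (INR 0).
    replace (1 - 1 + RtoC 0 * h * (/ u) ^ (0 + 1)) with (RtoC 0) by ring. rewrite Cmod_0; lra.
  - exists (2 * K + 2 * INR k + 2)%R. pose proof (pos_INR k) as Hk. split; [lra|].
    intros u h Hu Hh. specialize (IH u h Hu Hh).
    pose proof (proj1 (Cmod_gt_0 u) Hu) as Hu0.
    assert (Huh : Cmod u / 2 <= Cmod (u + h)).
    { pose proof (Cmod_triangle (u + h) (- h)) as T. rewrite Cmod_opp in T.
      replace (u + h + - h) with u in T by ring. lra. }
    assert (Hv : u + h <> 0) by (apply Cmod_gt_0; lra).
    set (x := / u) in *. set (y := / (u + h)) in *.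
    assert (Hyx : y - x = - (h * x * y)) by (unfold x, y; field; auto).
    assert (Hy : Cmod y <= 2 * Cmod x).
    { unfold x, y. rewrite !Cmod_inv by assumption.
      replace (2 * / Cmod u)%R with (/ (Cmod u / 2))%R by (field; lra).
      apply Rinv_le_contravar; lra. }
    rewrite S_INR, RtoC_plus.
    replace (y ^ S k - x ^ S k + (RtoC (INR k) + 1) * h * x ^ (S k + 1))
      with (y * (y ^ k - x ^ k + RtoC (INR k) * h * x ^ (k + 1))
            - RtoC (INR k) * h * x ^ (k + 1) * (y - x) - h * x ^ (k + 1) * (y - x)).
    2:{ transitivity (y ^ S k - x ^ S k + RtoC (INR k) * h * x ^ (S k + 1)
                      - (x ^ k * ((y - x) + h * x * y)) + h * x ^ (S k + 1)).
        - rewrite !Cpow_add_r; simpl; ring.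
        - rewrite Hyx. rewrite !Cpow_add_r; simpl; ring. }
    rewrite Hyx.
    set (E := y ^ k - x ^ k + RtoC (INR k) * h * x ^ (k + 1)) in *.
    assert (Hx0 : 0 <= Cmod x) by apply Cmod_ge_0.
    assert (Hh0 : 0 <= Cmod h) by apply Cmod_ge_0.
    assert (Hy0 : 0 <= Cmod y) by apply Cmod_ge_0.
    assert (HE0 : 0 <= Cmod E) by apply Cmod_ge_0.
    set (X := (Cmod x ^ k)%R) in *.
    assert (HX : 0 <= X) by (apply pow_le; assumption).
    set (b := (Cmod h * Cmod h * (X * (Cmod x * Cmod x * Cmod x)))%R).
    assert (Hb : 0 <= b) by (unfold b; repeat apply Rmult_le_pos; assumption).
    assert (T1 : Cmod (y * E) <= 2 * K * b).
    { rewrite Cmod_mult.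
      replace (2 * K * b)%R with ((2 * Cmod x) * (K * (Cmod h * Cmod h * Cmod x ^ (k + 2))))%R.
      - apply Rmult_le_compat; assumption.
      - unfold b, X. rewrite pow_add; simpl; ring. }
    assert (T0 : Cmod (h * x ^ (k + 1) * - (h * x * y))%C <= 2 * b).
    { rewrite !Cmod_mult, Cmod_opp, !Cmod_mult, Cmod_pow, pow_add. fold X. simpl (Cmod x ^ 1)%R.
      replace (2 * b)%R with (Cmod h * Cmod h * (X * (Cmod x * Cmod x)) * (2 * Cmod x))%R
        by (unfold b; ring).
      replace (Cmod h * (X * (Cmod x * 1)) * (Cmod h * Cmod x * Cmod y))%R
        with (Cmod h * Cmod h * (X * (Cmod x * Cmod x)) * Cmod y)%R by ring.
      apply Rmult_le_compat_l; [repeat apply Rmult_le_pos; assumption|assumption]. }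
    assert (T2 : Cmod (RtoC (INR k) * h * x ^ (k + 1) * - (h * x * y))%C <= INR k * (2 * b)).
    { replace (RtoC (INR k) * h * x ^ (k + 1) * - (h * x * y))
        with (RtoC (INR k) * (h * x ^ (k + 1) * - (h * x * y))) by ring.
      rewrite Cmod_mult, Cmod_R, Rabs_pos_eq by assumption.
      now apply Rmult_le_compat_l. }
    replace ((2 * K + 2 * INR k + 2) * (Cmod h * Cmod h * Cmod x ^ (S k + 2)))%R
      with (2 * K * b + INR k * (2 * b) + 2 * b)%R.
    2:{ unfold b, X. rewrite pow_add; simpl; ring. }
    unfold Cminus at 1. eapply Rle_trans; [apply Cmod_triangle|]. rewrite Cmod_opp.
    unfold Cminus. pose proof (Cmod_triangle (y * E) (- (RtoC (INR k) * h * x ^ (k + 1) * - (h * x * y)))) as T.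
    rewrite Cmod_opp in T. lra.
Qed.

(** * Lattice series *)

Definition weight_mass : R :=
  proj1_sig (constructive_indefinite_description _ hexT_weight_sum).

Lemma weight_mass_spec (A : C -> Prop) :
  (forall w, A w -> hexT w) ->
  forall l, NoDup l -> List.Forall A l -> rsum weight l <= weight_mass.
Proof.
  intros HA l Hn Hl. unfold weight_mass.
  destruct (constructive_indefinite_description _ hexT_weight_sum) as [B HB]; simpl.
  apply HB; [assumption|]. eapply List.Forall_impl; [|exact Hl]; exact HA.
Qed.

Lemma sum_over_correct_weight (A : C -> Prop) (f : C -> C) (K : R) :
  (forall w, A w -> hexT w) -> 0 <= K ->
  (forall w, A w -> Cmod (f w) <= K * weight w) ->
  is_sum_over A f (sum_over A f).
Proof.
  intros HA HK Hf. apply (sum_over_correct A f (K * weight_mass)).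
  apply (abs_bound_le A f weight K weight_mass); [assumption| |assumption].
  now apply weight_mass_spec.
Qed.

Lemma is_sum_over_weight_bound (A : C -> Prop) (f : C -> C) (s : C) (K : R) :
  (forall w, A w -> hexT w) -> 0 <= K ->
  (forall w, A w -> Cmod (f w) <= K * weight w) ->
  is_sum_over A f s -> Cmod s <= K * weight_mass.
Proof.
  intros HA HK Hf. apply is_sum_over_bound.
  apply (abs_bound_le A f weight K weight_mass); [assumption| |assumption].
  now apply weight_mass_spec.
Qed.

(** For k >= 3 the sum over [hexT] is, up to a factor, the derivative of wp of order k - 2; the sum
    over [hexT'] at z = 0 is, up to sign, the Eisenstein sum of weight k. *)
Definition lsum (A : C -> Prop) (k : nat) (z : C) : C :=
  sum_over A (fun w => (/ (z - w)) ^ k).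

(** A bound for (1 + |w|) / |z - w| when |z - w| >= d, from 1 + |w| <= |z - w| + (1 + |z|). *)
Definition kappa (z : C) (d : R) : R := (1 + (1 + Cmod z) / d)%R.

Lemma kappa_pos (z : C) (d : R) : 0 < d -> 1 <= kappa z d.
Proof.
  intros Hd. unfold kappa. pose proof (Cmod_ge_0 z).
  assert (0 < (1 + Cmod z) / d) by (apply Rdiv_lt_0_compat; lra). lra.
Qed.

Lemma separated_ratio (A : C -> Prop) (z w : C) (d : R) :
  separated A z d -> A w -> 1 + Cmod w <= kappa z d * Cmod (z - w)%C.
Proof.
  intros [Hd H] Hw. specialize (H w Hw). unfold kappa.
  pose proof (Cmod_triangle_sub w z) as T. rewrite (Cmod_minus_sym w z) in T.
  pose proof (Cmod_ge_0 z).
  assert (1 + Cmod z <= (1 + Cmod z) / d * Cmod (z - w)%C); [|lra].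
  apply Rle_trans with ((1 + Cmod z) / d * d)%R.
  - right; field; lra.
  - apply Rmult_le_compat_l; [|assumption]. left; apply Rdiv_lt_0_compat; lra.
Qed.

Lemma separated_neq (A : C -> Prop) (z w : C) (d : R) :
  separated A z d -> A w -> z - w <> 0.
Proof.
  intros [Hd H] Hw E. specialize (H w Hw). rewrite E, Cmod_0 in H. lra.
Qed.

(** Three of the factors are compared with 1 + |w|, the remaining k with the distance d. *)
Lemma inv_pow_weight (A : C -> Prop) (z w : C) (d : R) (k : nat) :
  separated A z d -> A w ->
  Cmod (/ (z - w)) ^ (k + 3) <= kappa z d ^ 3 * (/ d) ^ k * weight w.
Proof.
  intros Hs Hw. pose proof (separated_ratio A z w d Hs Hw) as H1.
  pose proof (separated_neq A z w d Hs Hw) as H0.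
  destruct Hs as [Hd H]. specialize (H w Hw).
  rewrite Cmod_inv by assumption.
  set (r := Cmod (z - w)) in *. assert (Hr : 0 < r) by lra.
  pose proof (Cmod_ge_0 w) as Hw0. pose proof (kappa_pos z d Hd) as Hk.
  rewrite pow_add, (Rmult_comm (_ ^ 3)), Rmult_assoc. apply Rmult_le_compat.
  - apply pow_le. left; now apply Rinv_0_lt_compat.
  - apply pow_le. left; now apply Rinv_0_lt_compat.
  - apply pow_incr; split; [left; now apply Rinv_0_lt_compat|].
    apply Rinv_le_contravar; lra.
  - unfold weight.
    replace (kappa z d ^ 3 * / (1 + Cmod w) ^ 3)%R with ((kappa z d * / (1 + Cmod w)) ^ 3)%R
      by (rewrite Rpow_mult_distr, pow_inv; reflexivity).
    rewrite <- ?pow_inv.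
    apply pow_incr; split; [left; now apply Rinv_0_lt_compat|].
    apply Rmult_le_reg_r with (r * (1 + Cmod w))%R; [nra|].
    field_simplify; lra.
Qed.

Lemma lsum_correct (A : C -> Prop) (z : C) (d : R) (k : nat) :
  (forall w, A w -> hexT w) -> separated A z d -> (3 <= k)%nat ->
  is_sum_over A (fun w => (/ (z - w)) ^ k) (lsum A k z).
Proof.
  intros HA Hs Hk. replace k with (k - 3 + 3)%nat by lia.
  apply (sum_over_correct_weight A _ (kappa z d ^ 3 * (/ d) ^ (k - 3))); [assumption| |].
  - destruct Hs as [Hd _]. pose proof (kappa_pos z d Hd).
    apply Rmult_le_pos; apply pow_le; [lra|]. left; now apply Rinv_0_lt_compat.
  - intros w Hw. rewrite Cmod_pow. now apply (inv_pow_weight A).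
Qed.

Lemma separated_shift (A : C -> Prop) (z h : C) (d : R) :
  separated A z d -> Cmod h <= d / 2 -> separated A (z + h) (d / 2).
Proof.
  intros [Hd H] Hh; split; [lra|]. intros w Hw. specialize (H w Hw).
  pose proof (Cmod_triangle (z + h - w) (- h)) as T. rewrite Cmod_opp in T.
  replace (z + h - w + - h) with (z - w) in T by ring. lra.
Qed.

(** Termwise differentiation: the remainders of the single terms sum to O(|h|^2). The constants
    [c w] cancel in the difference quotient, so the statement covers both the plain sums (c = 0) and
    the series of wp, which converges only with c w = 1/w^2. *)
Lemma cder_lattice_series (A : C -> Prop) (z : C) (d : R) (k : nat) (c : C -> C) (G : C -> C) :
  (forall w, A w -> hexT w) -> separated A z d -> (2 <= k)%nat ->
  (forall h, Cmod h <= d / 2 ->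
     is_sum_over A (fun w => (/ (z + h - w)) ^ k - c w) (G (z + h))) ->
  cder G z (- RtoC (INR k) * lsum A (k + 1) z).
Proof.
  intros HA Hs Hk HG. destruct (inv_pow_increment k) as [K [HK HI]].
  pose proof (proj1 Hs) as Hd.
  set (M := (kappa z d ^ 3 * (/ d) ^ (k - 1))%R).
  assert (HM : 0 <= M).
  { pose proof (kappa_pos z d Hd).
    apply Rmult_le_pos; apply pow_le; [lra|]. left; now apply Rinv_0_lt_compat. }
  apply (cder_quadratic _ _ _ (K * M * weight_mass) (d / 2)); [lra|].
  intros h Hh.
  assert (H0 : is_sum_over A (fun w => (/ (z - w)) ^ k - c w) (G z)).
  { specialize (HG 0). rewrite Cplus_0_r in HG. apply HG. rewrite Cmod_0; lra. }
  specialize (HG h ltac:(lra)).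
  pose proof (lsum_correct A z d (k + 1) HA Hs ltac:(lia)) as HS.
  apply (is_sum_over_scal A (RtoC (INR k) * h)) in HS.
  apply (is_sum_over_scal A (- (1))) in H0.
  pose proof (is_sum_over_plus A _ _ _ _ (is_sum_over_plus A _ _ _ _ HG H0) HS) as HE.
  replace (G (z + h) - G z - h * (- RtoC (INR k) * lsum A (k + 1) z))
    with (G (z + h) + - (1) * G z + RtoC (INR k) * h * lsum A (k + 1) z) by ring.
  replace (K * M * weight_mass * (Cmod h * Cmod h))%R
    with (K * M * (Cmod h * Cmod h) * weight_mass)%R by ring.
  pose proof (Cmod_ge_0 h) as Hh0.
  refine (is_sum_over_weight_bound A _ _ (K * M * (Cmod h * Cmod h))%R HA _ _ HE);
    [apply Rmult_le_pos; apply Rmult_le_pos; assumption|].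
  intros w Hw.
  replace ((/ (z + h - w)) ^ k - c w + - (1) * ((/ (z - w)) ^ k - c w)
           + RtoC (INR k) * h * (/ (z - w)) ^ (k + 1))
    with ((/ (z - w + h)) ^ k - (/ (z - w)) ^ k + RtoC (INR k) * h * (/ (z - w)) ^ (k + 1)).
  2:{ replace (z + h - w) with (z - w + h) by ring. ring. }
  eapply Rle_trans.
  - apply HI; [now apply (separated_neq A z w d)|].
    destruct Hs as [_ Hs]; specialize (Hs w Hw); lra.
  - replace (k + 2)%nat with (k - 1 + 3)%nat by lia.
    replace (K * M * (Cmod h * Cmod h) * weight w)%R
      with (K * (Cmod h * Cmod h * (M * weight w)))%R by ring.
    apply Rmult_le_compat_l; [assumption|]. apply Rmult_le_compat_l; [nra|].
    now apply (inv_pow_weight A).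
Qed.

Lemma cder_lsum (A : C -> Prop) (z : C) (d : R) (k : nat) :
  (forall w, A w -> hexT w) -> separated A z d -> (3 <= k)%nat ->
  cder (lsum A k) z (- RtoC (INR k) * lsum A (k + 1) z).
Proof.
  intros HA Hs Hk. apply (cder_lattice_series A z d k (fun _ => 0)); try assumption; [lia|].
  intros h Hh. apply (is_sum_over_ext A (fun w => (/ (z + h - w)) ^ k)); [intros; ring|].
  apply (lsum_correct A _ (d / 2)); [assumption| |assumption]. now apply separated_shift.
Qed.

(** The part of wp that is regular at 0; it is holomorphic in the disc |z| < varpi. *)
Definition wpreg (z : C) : C := sum_over hexT' (fun w => 1 / (z - w) ^ 2 - 1 / w ^ 2).

Lemma wp_wpreg (z : C) : wp z = 1 / z ^ 2 + wpreg z.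
Proof. reflexivity. Qed.

Lemma hexT'_hexT (w : C) : hexT' w -> hexT w.
Proof. now intros []. Qed.

Lemma hexT'_inv_le (w : C) : hexT' w -> Cmod (/ w) <= (1 + / varpi) * / (1 + Cmod w).
Proof.
  intros [Hw H0]. pose proof varpi_pos. pose proof (hexT_separated w Hw H0).
  rewrite Cmod_inv by assumption.
  assert (0 < / varpi) by now apply Rinv_0_lt_compat.
  apply Rmult_le_reg_r with (Cmod w * (1 + Cmod w))%R; [nra|].
  assert (1 <= / varpi * Cmod w).
  { apply Rmult_le_reg_l with varpi; [assumption|]. rewrite <- Rmult_assoc, Rinv_r by lra. lra. }
  replace (/ Cmod w * (Cmod w * (1 + Cmod w)))%R with (1 + Cmod w)%R by (field; lra).
  replace ((1 + / varpi) * / (1 + Cmod w) * (Cmod w * (1 + Cmod w)))%R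
    with (Cmod w + / varpi * Cmod w)%R by (field; lra).
  lra.
Qed.

(** The term equals z (2 w - z) / (w^2 (z - w)^2), which decays like |w|^(-3). *)
Lemma wpreg_term_le (z : C) (d : R) : separated hexT' z d ->
  exists K, 0 <= K /\
    forall w, hexT' w -> Cmod (1 / (z - w) ^ 2 - 1 / w ^ 2) <= K * weight w.
Proof.
  intros Hs. pose proof (proj1 Hs) as Hd. pose proof varpi_pos as Hv.
  set (a := (1 + / varpi)%R). set (b := kappa z d).
  assert (Ha : 0 < a) by (unfold a; assert (0 < / varpi) by (now apply Rinv_0_lt_compat); lra).
  assert (Hb : 1 <= b) by now apply kappa_pos.
  pose proof (Cmod_ge_0 z) as Hz.
  exists (Cmod z * (2 * (1 + Cmod z)) * (a ^ 2 * b ^ 2))%R.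
  split; [repeat apply Rmult_le_pos; try apply pow_le; lra|].
  intros w Hw. pose proof (separated_neq _ z w d Hs Hw) as Hzw.
  pose proof (separated_ratio _ z w d Hs Hw) as Hr. fold b in Hr.
  pose proof (hexT'_inv_le w Hw) as Hi. fold a in Hi.
  assert (Hi2 : Cmod (/ (z - w)) <= b * / (1 + Cmod w)).
  { rewrite Cmod_inv by assumption. pose proof (proj1 (Cmod_gt_0 _) Hzw). pose proof (Cmod_ge_0 w).
    apply Rmult_le_reg_r with (Cmod (z - w)%C * (1 + Cmod w))%R; [nra|]. field_simplify; lra. }
  replace (1 / (z - w) ^ 2 - 1 / w ^ 2)
    with (z * (2 * w - z) * ((/ w) ^ 2 * (/ (z - w)) ^ 2)).
  2:{ simpl. field. split; [apply Hw|assumption]. }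
  rewrite !Cmod_mult, !Cmod_pow.
  pose proof (Cmod_ge_0 w) as Hw0.
  set (q := (1 + Cmod w)%R) in *.
  assert (Hq : 1 <= q) by (unfold q; lra).
  assert (T : Cmod (2 * w - z)%C <= 2 * (1 + Cmod z) * q).
  { unfold Cminus. eapply Rle_trans; [apply Cmod_triangle|].
    rewrite Cmod_mult, Cmod_opp, Cmod_R, Rabs_pos_eq by lra. unfold q; nra. }
  unfold weight. fold q.
  replace (Cmod z * (2 * (1 + Cmod z)) * (a ^ 2 * b ^ 2) * / q ^ 3)%R
    with (Cmod z * (2 * (1 + Cmod z) * q) * ((a * / q) ^ 2 * (b * / q) ^ 2))%R by (field; lra).
  apply Rmult_le_compat.
  - apply Rmult_le_pos; apply Cmod_ge_0.
  - apply Rmult_le_pos; apply pow_le, Cmod_ge_0.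
  - now apply Rmult_le_compat_l.
  - apply Rmult_le_compat; try (apply pow_le, Cmod_ge_0); apply pow_incr; split;
      try apply Cmod_ge_0; assumption.
Qed.

Lemma wpreg_correct (z : C) (d : R) : separated hexT' z d ->
  is_sum_over hexT' (fun w => 1 / (z - w) ^ 2 - 1 / w ^ 2) (wpreg z).
Proof.
  intros Hs. destruct (wpreg_term_le z d Hs) as [K [HK H]].
  apply (sum_over_correct_weight hexT' _ K); [apply hexT'_hexT|assumption|assumption].
Qed.

Lemma cder_wpreg (z : C) (d : R) : separated hexT' z d ->
  cder wpreg z (- (2) * lsum hexT' 3 z).
Proof.
  intros Hs. change (RtoC (IZR (2))) with (RtoC (INR 2)).
  apply (cder_lattice_series hexT' z d 2 (fun w => 1 / w ^ 2)); try assumption.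
  - apply hexT'_hexT.
  - lia.
  - intros h Hh. pose proof (separated_shift _ z h d Hs Hh) as Hs'.
    apply (is_sum_over_ext hexT' (fun w => 1 / (z + h - w) ^ 2 - 1 / w ^ 2)).
    + intros w Hw. rewrite Cpow_inv by now apply (separated_neq hexT' _ w (d / 2)).
      unfold Cdiv; ring.
    + now apply (wpreg_correct _ (d / 2)).
Qed.

Lemma separated_hexT' (z : C) (d : R) : separated hexT z d -> separated hexT' z d.
Proof. intros [Hd H]; split; [assumption|]. intros w [Hw _]; now apply H. Qed.

Lemma hexT_complement (z : C) (d : R) : separated hexT z d ->
  forall h, Cmod h < d -> ~ hexT (z + h).
Proof.
  intros [Hd H] h Hh Hw. specialize (H _ Hw).
  replace (z - (z + h)) with (- h) in H by ring. rewrite Cmod_opp in H. lra.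
Qed.

Lemma nhexT_neq_0 (z : C) : ~ hexT z -> z <> 0.
Proof. intros H E; apply H; rewrite E; apply hexT_0. Qed.

Lemma lsum_insert (k : nat) (z : C) : ~ hexT z -> (3 <= k)%nat ->
  lsum hexT k z = (/ z) ^ k + lsum hexT' k z.
Proof.
  intros Hz Hk. destruct (hexT_dist z Hz) as [d Hs].
  apply sum_over_eq.
  pose proof (is_sum_over_insert hexT 0 (fun w => (/ (z - w)) ^ k) (lsum hexT' k z) hexT_0) as H.
  simpl in H. replace (z - 0) with z in H by ring.
  apply H. apply (lsum_correct hexT' z d); [apply hexT'_hexT|now apply separated_hexT'|assumption].
Qed.

(* Off the lattice these are the first three derivatives of wp. *)
Definition wpD1 (z : C) : C := - (2) * lsum hexT 3 z.
Definition wpD2 (z : C) : C := 6 * lsum hexT 4 z.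
Definition wpD3 (z : C) : C := - (24) * lsum hexT 5 z.

Lemma cder_inv_sq (z : C) : z <> 0 -> cder (fun z => 1 / z ^ 2) z (- (2) * (/ z) ^ 3).
Proof.
  intros Hz. destruct (inv_pow_increment 2) as [K [HK HI]].
  pose proof (proj1 (Cmod_gt_0 z) Hz) as Hp.
  apply (cder_quadratic _ _ _ (K * Cmod (/ z) ^ 4) (Cmod z / 2)); [lra|].
  intros h Hh. specialize (HI z h Hz ltac:(lra)).
  assert (Hzh : z + h <> 0).
  { intros E. assert (h = - z) by (rewrite <- (Cplus_0_l (- z)), <- E; ring). subst h.
    rewrite Cmod_opp in Hh; lra. }
  rewrite !Cpow_inv in HI by assumption.
  replace (1 / (z + h) ^ 2 - 1 / z ^ 2 - h * (- (2) * (/ z) ^ 3))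
    with (/ (z + h) ^ 2 - / z ^ 2 + RtoC (INR 2) * h * / z ^ (2 + 1)).
  - eapply Rle_trans; [exact HI|]. right; simpl; ring.
  - simpl (INR 2). rewrite Cpow_inv by assumption. unfold Cdiv.
    replace (RtoC (1 + 1)) with (RtoC 2) by (f_equal; ring). simpl (2 + 1)%nat. ring.
Qed.

Lemma cder_wp (z : C) : ~ hexT z -> cder wp z (wpD1 z).
Proof.
  intros Hz. destruct (hexT_dist z Hz) as [d Hs].
  unfold wpD1. rewrite lsum_insert by (assumption || lia).
  replace (- (2) * ((/ z) ^ 3 + lsum hexT' 3 z))
    with (- (2) * (/ z) ^ 3 + - (2) * lsum hexT' 3 z) by ring.
  apply (cder_plus (fun z => 1 / z ^ 2) wpreg).
  - now apply cder_inv_sq, nhexT_neq_0.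
  - now apply (cder_wpreg z d), separated_hexT'.
Qed.

Lemma wp'_wpD1 (z : C) : ~ hexT z -> wp' z = wpD1 z.
Proof. intros Hz. now apply cder_C_derive, cder_wp. Qed.

Lemma cder_wpD1 (z : C) : ~ hexT z -> cder wpD1 z (wpD2 z).
Proof.
  intros Hz. destruct (hexT_dist z Hz) as [d Hs]. unfold wpD2.
  replace (6 * lsum hexT 4 z) with (- (2) * (- RtoC (INR 3) * lsum hexT (3 + 1) z)).
  - apply cder_scal, (cder_lsum hexT z d); auto.
  - simpl (INR 3). replace (RtoC (1 + 1 + 1)) with (RtoC 3) by (f_equal; ring).
    simpl (3 + 1)%nat. ring.
Qed.

Lemma cder_wpD2 (z : C) : ~ hexT z -> cder wpD2 z (wpD3 z).
Proof.
  intros Hz. destruct (hexT_dist z Hz) as [d Hs]. unfold wpD3.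
  replace (- (24) * lsum hexT 5 z) with (6 * (- RtoC (INR 4) * lsum hexT (4 + 1) z)).
  - apply cder_scal, (cder_lsum hexT z d); auto.
  - simpl (INR 4). replace (RtoC (1 + 1 + 1 + 1)) with (RtoC 4) by (f_equal; ring).
    simpl (4 + 1)%nat. ring.
Qed.

Lemma ccont_wpD3 (z : C) : ~ hexT z -> ccont wpD3 z.
Proof.
  intros Hz. destruct (hexT_dist z Hz) as [d Hs].
  eapply cder_ccont. apply cder_scal, (cder_lsum hexT z d); auto.
Qed.

Lemma cder_wp' (z : C) : ~ hexT z -> cder wp' z (wpD2 z).
Proof.
  intros Hz. destruct (hexT_dist z Hz) as [d Hs].
  apply (cder_ext_loc wpD1 _ _ _ d); [apply Hs| |now apply cder_wpD1].
  intros h Hh. symmetry. now apply wp'_wpD1, (hexT_complement z d).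
Qed.

Lemma locally_nhexT (z : C) (P : C -> Prop) :
  ~ hexT z -> (forall y, ~ hexT y -> P y) -> locally (T := C_UniformSpace) z P.
Proof.
  intros Hz H. destruct (hexT_dist z Hz) as [d Hs].
  apply locally_C. exists (mkposreal d (proj1 Hs)). intros y Hy. apply H.
  replace y with (z + (y - z)) by ring. apply (hexT_complement z d Hs). exact Hy.
Qed.

Lemma holomorphic_wp (z : C) : ~ hexT z -> holomorphic_at wp z.
Proof.
  intros Hz. apply locally_nhexT; [assumption|]. intros y Hy.
  exists (wpD1 y). now apply cder_is_derive, cder_wp.
Qed.

(** * Symmetries and periods *)

Lemma nhexT_plus (z w : C) : hexT w -> ~ hexT z -> ~ hexT (z + w).
Proof.
  intros Hw Hz H; apply Hz. replace z with (z + w - w) by ring. now apply hexT_minus.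
Qed.

Lemma nhexT_rho (z : C) : ~ hexT z -> ~ hexT (rho * z).
Proof.
  intros Hz H; apply Hz. replace z with (rho * z / rho); [now apply hexT_rho_div|].
  field; apply rho_neq_0.
Qed.

Lemma nhexT_opp (z : C) : ~ hexT z -> ~ hexT (- z).
Proof. intros Hz H; apply Hz. replace z with (- - z) by ring. now apply hexT_opp. Qed.

Lemma hexT'_rho (w : C) : hexT' w -> hexT' (rho * w).
Proof.
  intros [Hw H0]; split; [now apply hexT_rho|]. apply Cmult_neq_0; [apply rho_neq_0|assumption].
Qed.

Lemma hexT'_rho_div (w : C) : hexT' w -> hexT' (w / rho).
Proof.
  intros [Hw H0]; split; [now apply hexT_rho_div|].
  intros E; apply H0. replace w with (w / rho * rho) by (field; apply rho_neq_0).
  rewrite E; ring.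
Qed.

Lemma lsum_rho (A : C -> Prop) (z : C) (d : R) (k : nat) :
  (forall w, A w -> hexT w) -> (forall w, A w -> A (w / rho)) -> (forall w, A w -> A (rho * w)) ->
  separated A z d -> (3 <= k)%nat -> lsum A k (rho * z) = (/ rho) ^ k * lsum A k z.
Proof.
  intros HA H1 H2 Hs Hk. pose proof rho_neq_0 as Hr. apply sum_over_eq.
  pose proof (lsum_correct A z d k HA Hs Hk) as H.
  apply (is_sum_over_reindex A (fun w => w / rho) (fun w => rho * w)) in H; try assumption;
    try (intros w; field; assumption).
  apply (is_sum_over_scal A ((/ rho) ^ k)) in H.
  eapply is_sum_over_ext; [|exact H]. intros w Hw; cbv beta.
  rewrite <- Cpow_mult_l. f_equal.
  pose proof (separated_neq A z _ d Hs (H1 w Hw)) as H0.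
  replace (rho * z - w) with (rho * (z - w / rho)) by (field; assumption).
  assert (H3 : z * rho - w <> 0); [|field; split; assumption].
  intros E. apply H0. replace (z - w / rho) with ((z * rho - w) / rho) by (field; assumption).
  rewrite E. unfold Cdiv; ring.
Qed.

(** The rotation by rho fixes 0 and permutes the lattice, so homogeneity reads S = rho^(-k) S for
    this Eisenstein sum S. *)
Lemma lsum_hexT'_0 (k : nat) : (3 <= k)%nat -> (/ rho) ^ k <> 1 -> lsum hexT' k 0 = 0.
Proof.
  intros Hk Hne.
  assert (Hs : separated hexT' 0 varpi).
  { pose proof (hexT'_dist 0) as H. rewrite Cmod_0, Rminus_0_r in H. apply H, varpi_pos. }
  pose proof (lsum_rho hexT' 0 varpi k hexT'_hexT hexT'_rho_div hexT'_rho Hs Hk) as E.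
  rewrite Cmult_0_r in E.
  destruct (Ceq_dec (lsum hexT' k 0) 0) as [|H]; [assumption|].
  elim Hne. rewrite <- (Cmult_1_r (_ ^ k)), <- (Cinv_r _ H), Cmult_assoc, <- E. reflexivity.
Qed.

Lemma inv_rho : / rho = 1 - rho.
Proof.
  pose proof rho_neq_0. replace (1 - rho) with (/ rho * (rho - rho * rho)) by (field; assumption).
  rewrite rho_sq. field; assumption.
Qed.

Lemma inv_rho_pow2 : (/ rho) ^ 2 = - rho.
Proof.
  rewrite inv_rho; simpl.
  replace ((1 - rho) * ((1 - rho) * 1)) with (1 - rho - rho + rho * rho) by ring.
  rewrite rho_sq; ring.
Qed.

Lemma inv_rho_pow3 : (/ rho) ^ 3 = - (1).
Proof.
  change 3%nat with (2 + 1)%nat. rewrite Cpow_add_r, inv_rho_pow2. simpl.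
  field; apply rho_neq_0.
Qed.

Lemma inv_rho_pow4 : (/ rho) ^ 4 = rho - 1.
Proof.
  change 4%nat with (2 + 2)%nat. rewrite Cpow_add_r, inv_rho_pow2.
  replace (- rho * - rho) with (rho * rho) by ring. apply rho_sq.
Qed.

Lemma lsum_hexT'_3_0 : lsum hexT' 3 0 = 0.
Proof.
  apply lsum_hexT'_0; [lia|]. rewrite inv_rho_pow3. intros E. injection E; intros; lra.
Qed.

Lemma lsum_hexT'_4_0 : lsum hexT' 4 0 = 0.
Proof.
  apply lsum_hexT'_0; [lia|]. rewrite inv_rho_pow4, rho_eq. intros E. injection E; intros; lra.
Qed.

Lemma wpD1_rho (z : C) : ~ hexT z -> wpD1 (rho * z) = - wpD1 z.
Proof.
  intros Hz; destruct (hexT_dist z Hz) as [d Hs]. unfold wpD1.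
  rewrite (lsum_rho hexT z d), inv_rho_pow3; auto using hexT_rho_div, hexT_rho. ring.
Qed.

Lemma wpreg_rho (z : C) (d : R) : separated hexT' z d -> wpreg (rho * z) = (/ rho) ^ 2 * wpreg z.
Proof.
  intros Hs. pose proof rho_neq_0 as Hr. apply sum_over_eq.
  pose proof (wpreg_correct z d Hs) as H.
  apply (is_sum_over_reindex hexT' (fun w => w / rho) (fun w => rho * w)) in H;
    try apply hexT'_rho_div; try apply hexT'_rho; try (intros w; field; assumption).
  apply (is_sum_over_scal _ ((/ rho) ^ 2)) in H.
  eapply is_sum_over_ext; [|exact H]. intros w Hw; cbv beta.
  pose proof (separated_neq _ z _ d Hs (hexT'_rho_div w Hw)) as H0.
  destruct Hw as [_ Hw].
  assert (H1 : rho * z - w <> 0).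
  { intros E. apply H0. replace (z - w / rho) with ((rho * z - w) / rho) by (field; assumption).
    rewrite E. unfold Cdiv; ring. }
  simpl. field. repeat split; assumption.
Qed.

Lemma wp_rho (z : C) : ~ hexT z -> wp (rho * z) = (/ rho) ^ 2 * wp z.
Proof.
  intros Hz; destruct (hexT_dist z Hz) as [d Hs]. rewrite !wp_wpreg.
  rewrite (wpreg_rho z d) by now apply separated_hexT'.
  pose proof rho_neq_0; pose proof (nhexT_neq_0 z Hz). simpl; field; auto.
Qed.

Lemma opp_rho (z : C) : - z = rho * (rho * (rho * z)).
Proof. pose proof rho_pow3 as E. transitivity (rho ^ 3 * z); [rewrite E|simpl]; ring. Qed.

Lemma wpD1_opp (z : C) : ~ hexT z -> wpD1 (- z) = - wpD1 z.
Proof.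
  intros Hz. rewrite opp_rho, !wpD1_rho; [ring|..]; auto using nhexT_rho.
Qed.

Lemma wp_opp (z : C) : ~ hexT z -> wp (- z) = wp z.
Proof.
  intros Hz. rewrite opp_rho, !wp_rho by auto using nhexT_rho.
  transitivity ((/ rho) ^ 3 * (/ rho) ^ 3 * wp z); [simpl; ring|]. rewrite inv_rho_pow3; ring.
Qed.

Lemma hexT'_conj (w : C) : hexT' w -> hexT' (Cconj w).
Proof.
  intros [Hw H0]; split; [now apply hexT_conj|]. intros E; apply H0.
  rewrite <- (Cconj_conj w), E. apply RtoC_conj.
Qed.

Lemma lsum_conj (z : C) (k : nat) : ~ hexT z -> (3 <= k)%nat ->
  lsum hexT k (Cconj z) = Cconj (lsum hexT k z).
Proof.
  intros Hz Hk. destruct (hexT_dist z Hz) as [d Hs]. apply sum_over_eq.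
  pose proof (lsum_correct hexT z d k (fun _ h => h) Hs Hk) as H.
  apply (is_sum_over_reindex hexT Cconj Cconj) in H;
    try apply hexT_conj; try apply Cconj_conj.
  apply is_sum_over_conj in H. eapply is_sum_over_ext; [|exact H]. intros w Hw; cbv beta.
  rewrite Cpow_conj, Cinv_conj, Cminus_conj, Cconj_conj; [reflexivity|].
  apply (separated_neq hexT z _ d Hs). now apply hexT_conj.
Qed.

Lemma wpD1_conj (z : C) : ~ hexT z -> wpD1 (Cconj z) = Cconj (wpD1 z).
Proof.
  intros Hz. unfold wpD1. rewrite lsum_conj by (auto; lia).
  now rewrite Cmult_conj, Copp_conj, RtoC_conj.
Qed.

Lemma wp_conj (z : C) : ~ hexT z -> wp (Cconj z) = Cconj (wp z).
Proof.
  intros Hz. destruct (hexT_dist z Hz) as [d Hs]. rewrite !wp_wpreg, Cplus_conj.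
  pose proof (nhexT_neq_0 z Hz) as H0. f_equal.
  - now rewrite Cdiv_conj, Cpow_conj, RtoC_conj by now apply Cpow_nz.
  - apply sum_over_eq.
    pose proof (wpreg_correct z d (separated_hexT' z d Hs)) as H.
    apply (is_sum_over_reindex hexT' Cconj Cconj) in H;
      try apply hexT'_conj; try apply Cconj_conj.
    apply is_sum_over_conj in H. eapply is_sum_over_ext; [|exact H]. intros w Hw; cbv beta.
    pose proof (hexT'_conj w Hw) as Hw'.
    rewrite Cminus_conj, !Cdiv_conj, !Cpow_conj, Cminus_conj, !Cconj_conj, !RtoC_conj; [reflexivity| |].
    + apply Cpow_nz, Hw'.
    + apply Cpow_nz, (separated_neq hexT' z _ d); [now apply separated_hexT'|assumption].
Qed.

Lemma lsum_periodic (z v : C) (k : nat) : ~ hexT z -> hexT v -> (3 <= k)%nat ->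
  lsum hexT k (z + v) = lsum hexT k z.
Proof.
  intros Hz Hv Hk. destruct (hexT_dist z Hz) as [d Hs]. apply sum_over_eq.
  pose proof (lsum_correct hexT z d k (fun _ h => h) Hs Hk) as H.
  apply (is_sum_over_reindex hexT (fun w => w - v) (fun w => w + v)) in H;
    try (intros w; ring); try (intros w Hw; auto using hexT_minus, hexT_plus).
  eapply is_sum_over_ext; [|exact H]. intros w Hw; cbv beta. do 2 f_equal. ring.
Qed.

Lemma wpD1_periodic (z v : C) : ~ hexT z -> hexT v -> wpD1 (z + v) = wpD1 z.
Proof. intros; unfold wpD1; now rewrite lsum_periodic by (auto; lia). Qed.

Lemma wpD2_periodic (z v : C) : ~ hexT z -> hexT v -> wpD2 (z + v) = wpD2 z.
Proof. intros; unfold wpD2; now rewrite lsum_periodic by (auto; lia). Qed.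

(** * Periodicity of wp by telescoping over boxes *)

Definition zsym (N : nat) : list Z := map (fun k => (Z.of_nat k - Z.of_nat N)%Z) (seq 0 (2 * N + 1)).

(** The pairs are read as (n, m), so that the inner list of the product runs in the direction of
    varpi, along which the sum telescopes. *)
Definition boxlist (N : nat) : list C :=
  map (fun q => lat (snd q) (fst q)) (list_prod (zsym N) (zsym N)).

Lemma in_zsym (N : nat) (m : Z) : (Z.abs m <= Z.of_nat N)%Z -> In m (zsym N).
Proof.
  intros H. replace m with (Z.of_nat (Z.to_nat (m + Z.of_nat N)) - Z.of_nat N)%Z
    by (rewrite Z2Nat.id; lia).
  apply (in_map (fun k => (Z.of_nat k - Z.of_nat N)%Z)), in_seq. lia.
Qed.

Lemma lat_inj (m n p q : Z) : lat m n = lat p q -> m = p /\ n = q.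
Proof.
  intros E. pose proof varpi_pos.
  assert (H0 : lat (m - p) (n - q) = 0).
  { replace (lat (m - p) (n - q)) with (lat m n - lat p q); [rewrite E; ring|].
    unfold lat; rewrite !minus_IZR, !RtoC_minus; ring. }
  assert (H1 : (varpi * varpi * hexform (IZR (m - p)) (IZR (n - q)) = 0)%R).
  { rewrite <- Cmod_hexform. fold (lat (m - p) (n - q)). rewrite H0, Cmod_0; ring. }
  destruct (Z.eq_dec m p) as [|Hm]; [destruct (Z.eq_dec n q) as [|Hn]; [auto|]|];
    exfalso;
    assert (1 <= hexform (IZR (m - p)) (IZR (n - q))) by (apply hexform_int_ge_1; lia); nra.
Qed.

Lemma NoDup_list_prod {S T : Type} (l1 : list S) (l2 : list T) :
  NoDup l1 -> NoDup l2 -> NoDup (list_prod l1 l2).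
Proof.
  intros H1 H2. induction H1 as [|x l1 Hx _ IH]; simpl; [constructor|].
  apply NoDup_app; [|assumption|].
  - apply Injective_map_NoDup; [|assumption]. intros a b E; now injection E.
  - intros [a b] Ha Hb. apply in_map_iff in Ha as [y [E _]]. injection E as <- <-.
    apply in_prod_iff in Hb as [Hb _]. contradiction.
Qed.

Lemma NoDup_boxlist (N : nat) : NoDup (boxlist N).
Proof.
  assert (Hz : NoDup (zsym N)).
  { apply Injective_map_NoDup; [|apply seq_NoDup]. intros a b; lia. }
  apply Injective_map_NoDup.
  - intros [a b] [c d]; simpl; intros E. apply lat_inj in E as [-> ->]. reflexivity.
  - now apply NoDup_list_prod.
Qed.

Lemma csum_list_prod (F : C -> C) (l1 l2 : list Z) :
  csum F (map (fun q => lat (snd q) (fst q)) (list_prod l1 l2)) =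
  fold_right Cplus 0 (map (fun n => csum F (map (fun m => lat m n) l2)) l1).
Proof.
  induction l1 as [|n l1 IH]; [reflexivity|]. simpl.
  rewrite map_app, csum_app, IH, map_map. reflexivity.
Qed.

Lemma csum_telescope (g : C -> C) (n a : Z) (M : nat) :
  csum (fun w => g (w - varpi) - g w)
    (map (fun m => lat m n) (map (fun k => (Z.of_nat k + a)%Z) (seq 0 M))) =
  g (lat (a - 1) n) - g (lat (Z.of_nat M + a - 1) n).
Proof.
  assert (E : forall m, lat m n - varpi = lat (m - 1) n).
  { intros m; unfold lat. rewrite minus_IZR, RtoC_minus. ring. }
  induction M as [|M IH].
  - simpl. unfold csum; simpl. ring.
  - replace (Z.of_nat (S M) + a - 1)%Z with (Z.of_nat M + a)%Z by lia.
    rewrite seq_S, !map_app, csum_app, IH. unfold csum; simpl. rewrite E. ring.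
Qed.

Lemma Cmod_lat_ge (m n : Z) : varpi / 2 * Rabs (IZR m) <= Cmod (lat m n).
Proof.
  pose proof varpi_pos as Hv. pose proof (Rabs_pos (IZR m)).
  apply Rsq_le_le; [apply Cmod_ge_0|]. unfold lat at 1 2; rewrite Cmod_hexform.
  replace (varpi / 2 * Rabs (IZR m) * (varpi / 2 * Rabs (IZR m)))%R
    with (varpi * varpi * (/ 4 * (Rabs (IZR m) * Rabs (IZR m))))%R by field.
  apply Rmult_le_compat_l; [nra|].
  rewrite <- Rabs_mult, Rabs_pos_eq by nra. unfold hexform.
  pose proof (Rle_0_sqr (IZR n + IZR m / 2)). unfold Rsqr in *. nra.
Qed.

Lemma Cmod_fold_le (l : list Z) (F : Z -> C) (e : R) :
  (forall n, Cmod (F n) <= e) ->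
  Cmod (fold_right Cplus 0 (map F l)) <= INR (length l) * e.
Proof.
  intros H. induction l as [|x l IH].
  - simpl. rewrite Cmod_0; lra.
  - change (length (x :: l)) with (S (length l)). rewrite S_INR. simpl.
    eapply Rle_trans; [apply Cmod_triangle|]. specialize (H x); lra.
Qed.

(** Each of the 2N + 1 rows collapses to its two end terms, with m = -N-1 and m = N, and each of
    these is at most (C0 / N)^2. The constant 6 is twice the 3 in 2N + 1 <= 3N. *)
Lemma box_sum_le (z : C) : ~ hexT z -> exists K, 0 <= K /\ forall N, (1 <= N)%nat ->
    Cmod (csum (fun w => (/ (z - (w - varpi))) ^ 2 - (/ (z - w)) ^ 2)%C (boxlist N))
     <= K / INR N.
Proof.
  intros Hz. destruct (hexT_dist z Hz) as [d Hs].
  pose proof varpi_pos as Hv. pose proof (kappa_pos z d (proj1 Hs)) as Hk.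
  set (k := kappa z d) in *. set (C0 := (k * (2 / varpi))%R).
  assert (HC : 0 < C0) by (apply Rmult_lt_0_compat; [lra|apply Rdiv_lt_0_compat; lra]).
  exists (6 * (C0 * C0))%R; split; [nra|]. intros N HN.
  assert (HN' : 1 <= INR N) by (apply (le_INR 1); exact HN).
  set (g := fun w => (/ (z - w)) ^ 2).
  assert (Hg : forall m n, INR N <= Rabs (IZR m) ->
                 Cmod (g (lat m n)) <= (C0 / INR N) * (C0 / INR N)).
  { intros m n Hm. unfold g. rewrite Cmod_pow.
    pose proof (separated_ratio hexT z _ d Hs (hexT_lat m n)) as Hr. fold k in Hr.
    pose proof (separated_neq hexT z _ d Hs (hexT_lat m n)) as H0.
    pose proof (proj1 (Cmod_gt_0 _) H0) as Hp.
    pose proof (Cmod_lat_ge m n) as Hl.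
    rewrite Cmod_inv by assumption.
    set (r := Cmod (z - lat m n)) in *.
    assert (Hb : varpi / 2 * INR N <= k * r).
    { apply Rle_trans with (varpi / 2 * Rabs (IZR m))%R; [|lra].
      apply Rmult_le_compat_l; lra. }
    assert (Hi : / r <= C0 / INR N).
    { apply Rmult_le_reg_r with (r * (varpi / 2 * INR N))%R.
      - apply Rmult_lt_0_compat; [assumption|]. apply Rmult_lt_0_compat; lra.
      - replace (/ r * (r * (varpi / 2 * INR N)))%R with (varpi / 2 * INR N)%R by (field; lra).
        replace (C0 / INR N * (r * (varpi / 2 * INR N)))%R with (k * r)%R; [assumption|].
        unfold C0; field; lra. }
    assert (Hi0 : 0 < / r) by now apply Rinv_0_lt_compat.
    simpl. rewrite Rmult_1_r. apply Rmult_le_compat; lra. }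
  unfold boxlist. rewrite csum_list_prod.
  eapply Rle_trans.
  - apply (Cmod_fold_le _ _ (2 * ((C0 / INR N) * (C0 / INR N)))%R). intros n.
    unfold zsym.
    rewrite (map_ext (fun k => (Z.of_nat k - Z.of_nat N)%Z) (fun k => (Z.of_nat k + - Z.of_nat N)%Z))
      by (intros; lia).
    rewrite (csum_telescope g). unfold Cminus.
    eapply Rle_trans; [apply Cmod_triangle|]. rewrite Cmod_opp.
    assert (H1 : INR N <= Rabs (IZR (- Z.of_nat N - 1))).
    { rewrite INR_IZR_INZ, <- abs_IZR. apply IZR_le. lia. }
    assert (H2 : INR N <= Rabs (IZR (Z.of_nat (2 * N + 1) + - Z.of_nat N - 1))).
    { rewrite INR_IZR_INZ, <- abs_IZR. apply IZR_le. lia. }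
    pose proof (Hg _ n H1). pose proof (Hg _ n H2). lra.
  - unfold zsym. rewrite length_map, length_seq, plus_INR, mult_INR.
    simpl (INR 2); simpl (INR 1).
    apply Rmult_le_reg_r with (INR N * INR N)%R; [nra|].
    replace (((1 + 1) * INR N + 1) * (2 * (C0 / INR N * (C0 / INR N))) * (INR N * INR N))%R
      with (((1 + 1) * INR N + 1) * (2 * (C0 * C0)))%R by (field; lra).
    replace (6 * (C0 * C0) / INR N * (INR N * INR N))%R with (3 * INR N * (2 * (C0 * C0)))%R
      by (field; lra).
    apply Rmult_le_compat_r; nra.
Qed.

Lemma hexT_varpi : hexT varpi.
Proof. exists 1%Z, 0%Z. change (IZR 0) with 0%R; change (IZR 1) with 1%R. ring. Qed.

(* Reindexing does not apply to the series of wp, which without the terms 1/w^2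
   would diverge: the difference is a sum that telescopes along the rows of
   the boxes [-N,N]^2, leaving boundary terms of total size O(1/N). *)
Lemma wp_periodic_varpi (z : C) : ~ hexT z -> wp (z + varpi) = wp z.
Proof.
  intros Hz. pose proof (nhexT_plus z varpi hexT_varpi Hz) as Hz'.
  destruct (hexT_dist z Hz) as [d Hs]. destruct (hexT_dist _ Hz') as [d' Hs'].
  assert (HS : is_sum_over hexT (fun w => (/ (z - (w - varpi))) ^ 2 - (/ (z - w)) ^ 2)
                 (wp (z + varpi) - wp z)).
  { pose proof (wpreg_correct z d (separated_hexT' _ _ Hs)) as H1.
    pose proof (wpreg_correct _ d' (separated_hexT' _ _ Hs')) as H2.
    apply (is_sum_over_scal hexT' (- (1))) in H1.
    pose proof (is_sum_over_plus _ _ _ _ _ H2 H1) as H.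
    apply (is_sum_over_ext hexT' _ (fun w => (/ (z - (w - varpi))) ^ 2 - (/ (z - w)) ^ 2)) in H.
    - apply (is_sum_over_insert hexT 0 _ _ hexT_0) in H.
      replace (wp (z + varpi) - wp z) with
        ((/ (z - (0 - varpi))) ^ 2 - (/ (z - 0)) ^ 2 + (wpreg (z + varpi) + - (1) * wpreg z));
        [exact H|].
      rewrite !wp_wpreg. replace (z - 0) with z by ring.
      replace (z - (0 - varpi)) with (z + varpi) by ring.
      rewrite !Cpow_inv by now apply nhexT_neq_0. unfold Cdiv; ring.
    - intros w Hw. pose proof (hexT'_hexT w Hw) as Hw'.
      replace (z - (w - varpi)) with (z + varpi - w) by ring.
      rewrite !Cpow_inv; [unfold Cdiv; ring|..].
      + now apply (separated_neq hexT _ w d).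
      + now apply (separated_neq hexT _ w d'). }
  destruct (box_sum_le z Hz) as [K [HK Hbox]].
  apply Ceq_minus, Cmod_le_eps_0. intros eps.
  destruct (HS (pos_div_2 eps)) as [l0 [H0 H1]].
  destruct (hexT_list l0 H0) as [p ->].
  destruct (int_pairs_bounded p) as [M HM].
  destruct (archimed (2 * K / eps)) as [Ha _].
  (* The box has to contain the list [l0] given by convergence, hence the bound [M] on its indices,
     and N > 2 K / eps keeps the boundary terms below eps / 2. *)
  set (N := (Z.to_nat M + Z.to_nat (up (2 * K / eps)) + 1)%nat).
  assert (HN : 2 * K / eps < INR N).
  { eapply Rlt_le_trans; [exact Ha|]. rewrite INR_IZR_INZ. apply IZR_le. lia. }
  specialize (Hbox N ltac:(lia)).
  specialize (H1 (boxlist N) (NoDup_boxlist N)).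
  assert (HN0 : 0 < INR N) by (apply lt_0_INR; lia).
  assert (HK2 : K / INR N < eps / 2).
  { apply Rmult_lt_reg_r with (INR N * 2 / eps)%R.
    - apply Rdiv_lt_0_compat; [lra|apply cond_pos].
    - pose proof (cond_pos eps).
      replace (K / INR N * (INR N * 2 / eps))%R with (2 * K / eps)%R by (field; lra).
      replace (eps / 2 * (INR N * 2 / eps))%R with (INR N) by (field; lra). assumption. }
  assert (HA : List.Forall hexT (boxlist N)).
  { apply List.Forall_map, List.Forall_forall. intros q _; apply hexT_lat. }
  assert (Hi : incl (map (fun q => lat (fst q) (snd q)) p) (boxlist N)).
  { intros x Hx. apply in_map_iff in Hx as [[m n] [<- Hq]]. specialize (HM _ Hq). simpl in HM |- *.
    apply (in_map (fun q => lat (snd q) (fst q)) _ (n, m)).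
    apply in_prod; apply in_zsym; lia. }
  specialize (H1 HA Hi). simpl in H1.
  set (D := csum _ (boxlist N)) in Hbox.
  change (Cmod (D - (wp (z + varpi) - wp z))%C < eps / 2) in H1.
  replace (wp (z + varpi) - wp z) with (D + - (D - (wp (z + varpi) - wp z))) by ring.
  eapply Rle_lt_trans; [apply Cmod_triangle|]. rewrite Cmod_opp. lra.
Qed.

(** The translation by varpi conjugated with the rotation by rho. *)
Lemma wp_periodic_rho_varpi (z : C) : ~ hexT z -> wp (z + rho * varpi) = wp z.
Proof.
  intros Hz. pose proof rho_neq_0 as Hr.
  assert (Hz' : ~ hexT (z / rho)).
  { intros H; apply Hz. replace z with (rho * (z / rho)) by (field; assumption).
    now apply hexT_rho. }
  replace (z + rho * varpi) with (rho * (z / rho + varpi)) by (field; assumption).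
  rewrite wp_rho, wp_periodic_varpi, <- wp_rho; auto.
  - f_equal. field; assumption.
  - apply nhexT_plus; [apply hexT_varpi|assumption].
Qed.

Lemma wp_period_multiple (v : C) (f : Z -> C) :
  (forall n, hexT (f n)) -> f 0%Z = 0 -> (forall n, f (Z.succ n) = f n + v) ->
  (forall z, ~ hexT z -> wp (z + v) = wp z) ->
  forall n z, ~ hexT z -> wp (z + f n) = wp z.
Proof.
  intros Hf H0 Hs Hp n. induction n as [|n IH|n IH] using Z.peano_ind; intros z Hz.
  - now rewrite H0, Cplus_0_r.
  - rewrite Hs, Cplus_assoc, Hp by now apply nhexT_plus. now apply IH.
  - rewrite <- (IH z Hz), <- (Hp (z + f (Z.pred n))) by now apply nhexT_plus.
    rewrite <- Cplus_assoc, <- Hs, Z.succ_pred. reflexivity.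
Qed.

Lemma wp_periodic (z v : C) : ~ hexT z -> hexT v -> wp (z + v) = wp z.
Proof.
  intros Hz Hv. destruct (hexT_inv v Hv) as [m [n ->]].
  assert (E0 : lat 0 0 = 0) by (unfold lat; change (IZR 0) with 0%R; ring).
  replace (lat m n) with (lat m 0 + lat 0 n) by (rewrite lat_plus; f_equal; lia).
  rewrite Cplus_assoc, (wp_period_multiple (rho * varpi) (lat 0)).
  - apply (wp_period_multiple varpi (fun m => lat m 0)); auto using hexT_lat, wp_periodic_varpi.
    intros k; unfold lat; rewrite succ_IZR, RtoC_plus; ring.
  - apply hexT_lat.
  - exact E0.
  - intros k; unfold lat; rewrite succ_IZR, RtoC_plus; ring.
  - apply wp_periodic_rho_varpi.
  - apply nhexT_plus; [apply hexT_lat|assumption].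
Qed.

(* The Taylor terms 2 z / w^3 and 3 z^2 / w^4 sum to 0 over the lattice. *)
Lemma wpreg_cubic : exists K, 0 <= K /\ forall z, Cmod z <= varpi / 2 -> Cmod (wpreg z) <= K * Cmod z ^ 3.
Proof.
  pose proof varpi_pos as Hv. set (a := (1 + / varpi)%R).
  assert (Ha : 0 < a) by (unfold a; assert (0 < / varpi) by (now apply Rinv_0_lt_compat); lra).
  assert (Hm : 0 <= weight_mass).
  { pose proof (weight_mass_spec hexT (fun _ h => h) nil (NoDup_nil _) (Forall_nil _)) as H.
    exact H. }
  exists (24 * a ^ 5 * weight_mass)%R. split.
  { apply Rmult_le_pos; [|assumption]. apply Rmult_le_pos; [lra|apply pow_le; lra]. }
  intros z Hz.
  assert (Hs : separated hexT' z (varpi - Cmod z)) by (apply hexT'_dist; lra).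
  assert (Hs0 : separated hexT' 0 varpi).
  { pose proof (hexT'_dist 0) as H. rewrite Cmod_0, Rminus_0_r in H. now apply H. }
  pose proof (wpreg_correct z _ Hs) as H2.
  pose proof (lsum_correct hexT' 0 _ 3 hexT'_hexT Hs0 ltac:(lia)) as H3.
  pose proof (lsum_correct hexT' 0 _ 4 hexT'_hexT Hs0 ltac:(lia)) as H4.
  rewrite lsum_hexT'_3_0 in H3. rewrite lsum_hexT'_4_0 in H4.
  apply (is_sum_over_scal _ (2 * z)) in H3. apply (is_sum_over_scal _ (- (3) * z ^ 2)) in H4.
  pose proof (is_sum_over_plus _ _ _ _ _ (is_sum_over_plus _ _ _ _ _ H2 H3) H4) as H.
  replace (wpreg z + 2 * z * 0 + - (3) * z ^ 2 * 0) with (wpreg z) in H by ring.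
  replace (24 * a ^ 5 * weight_mass * Cmod z ^ 3)%R
    with (24 * a ^ 5 * Cmod z ^ 3 * weight_mass)%R by ring.
  pose proof (Cmod_ge_0 z) as Hz0.
  refine (is_sum_over_weight_bound hexT' _ _ (24 * a ^ 5 * Cmod z ^ 3)%R hexT'_hexT _ _ H).
  { apply Rmult_le_pos; [|now apply pow_le]. apply Rmult_le_pos; [lra|apply pow_le; lra]. }
  intros w Hw. pose proof (separated_neq _ z w _ Hs Hw) as Hzw.
  pose proof (hexT'_inv_le w Hw) as Hi. fold a in Hi.
  destruct Hw as [Hw Hw0]. pose proof (hexT_separated w Hw Hw0) as Hwv.
  (* The Taylor remainder in closed form. In the final constant, 24 is the product of 6, from |4 w -
     3 z| <= 6 |w|, and 4, from |z - w| >= |w| / 2. *)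
  replace (1 / (z - w) ^ 2 - 1 / w ^ 2 + 2 * z * (/ (0 - w)) ^ 3 + - (3) * z ^ 2 * (/ (0 - w)) ^ 4)
    with (z ^ 3 * (4 * w - 3 * z) * ((/ w) ^ 4 * (/ (z - w)) ^ 2)).
  2:{ simpl. field. split; assumption. }
  rewrite !Cmod_mult, !Cmod_pow.
  set (s := Cmod (/ w)) in *.
  assert (Hs1 : 0 < s) by (unfold s; rewrite Cmod_inv by assumption; apply Rinv_0_lt_compat; lra).
  assert (Hsw : (Cmod w * s = 1)%R) by (unfold s; rewrite Cmod_inv by assumption; field; lra).
  assert (T1 : Cmod (4 * w - 3 * z)%C <= 6 * Cmod w).
  { unfold Cminus. eapply Rle_trans; [apply Cmod_triangle|].
    rewrite Cmod_opp, !Cmod_mult, !Cmod_R, !Rabs_pos_eq by lra. lra. }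
  assert (T2 : Cmod (/ (z - w)) <= 2 * s).
  { unfold s. rewrite !Cmod_inv by assumption.
    replace (2 * / Cmod w)%R with (/ (Cmod w / 2))%R by (field; lra).
    apply Rinv_le_contravar; [lra|].
    pose proof (Cmod_triangle_sub w z). rewrite Cmod_minus_sym. lra. }
  assert (T3 : s <= a).
  { eapply Rle_trans; [exact Hi|]. rewrite <- (Rmult_1_r a) at 2.
    apply Rmult_le_compat_l; [lra|]. rewrite <- Rinv_1.
    apply Rinv_le_contravar; [lra|]. pose proof (Cmod_ge_0 w); lra. }
  assert (T4 : s ^ 3 <= a ^ 3 * weight w).
  { unfold weight. rewrite <- pow_inv, <- Rpow_mult_distr. apply pow_incr. split; lra. }
  apply Rle_trans with (Cmod z ^ 3 * (6 * Cmod w) * (s ^ 4 * (2 * s) ^ 2))%R.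
  - apply Rmult_le_compat.
    + apply Rmult_le_pos; [now apply pow_le|apply Cmod_ge_0].
    + apply Rmult_le_pos; apply pow_le; [lra|apply Cmod_ge_0].
    + apply Rmult_le_compat_l; [now apply pow_le|assumption].
    + apply Rmult_le_compat_l; [apply pow_le; lra|].
      apply pow_incr; split; [apply Cmod_ge_0|assumption].
  - replace (Cmod z ^ 3 * (6 * Cmod w) * (s ^ 4 * (2 * s) ^ 2))%R
      with (24 * Cmod z ^ 3 * (Cmod w * s) * (s ^ 2 * s ^ 3))%R by ring.
    rewrite Hsw.
    replace (24 * a ^ 5 * Cmod z ^ 3 * weight w)%R
      with (24 * Cmod z ^ 3 * 1 * (a ^ 2 * (a ^ 3 * weight w)))%R by ring.
    apply Rmult_le_compat_l.
    + rewrite Rmult_1_r. apply Rmult_le_pos; [lra|now apply pow_le].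
    + apply Rmult_le_compat; try (apply pow_le; lra); [|assumption].
      apply pow_incr; lra.
Qed.

(** * Liouville's theorem for the lattice *)

Definition rder (g : R -> C) (t : R) (v : C) : Prop :=
  forall eps : posreal, exists del : posreal, forall s : R, Rabs s < del ->
    Cmod (g (t + s)%R - g t - RtoC s * v)%C <= eps * Rabs s.

Lemma is_derive_of_increment (f : R -> R) (t l : R) :
  (forall eps : posreal, exists del : posreal, forall s : R, (Rabs s < del)%R ->
     (Rabs (f (t + s) - f t - s * l) <= eps * Rabs s)%R) -> is_derive f t l.
Proof.
  intros H. split; [apply is_linear_scal_l|].
  intros x Hx. apply (is_filter_lim_locally_unique (K := R_AbsRing) (V := R_NormedModule)) in Hx.
  subst x. intros eps. destruct (H eps) as [del Hd].
  exists del. intros y Hy. specialize (Hd (y - t)%R Hy).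
  rewrite Rplus_minus in Hd. exact Hd.
Qed.

Lemma increment_of_is_derive (f : R -> R) (t l : R) : is_derive f t l ->
  forall eps : posreal, exists del : posreal, forall s : R, (Rabs s < del)%R ->
     (Rabs (f (t + s) - f t - s * l) <= eps * Rabs s)%R.
Proof.
  intros [_ H] eps. destruct (H t (fun P h => h) eps) as [del Hd].
  exists del. intros s Hs. specialize (Hd (t + s)%R).
  change ((Rabs (t + s - t) < del)%R ->
          (Rabs (f (t + s) - f t - (t + s - t) * l) <= eps * Rabs (t + s - t))%R) in Hd.
  replace (t + s - t)%R with s in Hd by ring. now apply Hd.
Qed.

Lemma rder_fst (g : R -> C) (t : R) (v : C) :
  rder g t v -> is_derive (fun t => fst (g t)) t (fst v).
Proof.
  intros H; apply is_derive_of_increment; intros eps; destruct (H eps) as [del Hd].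
  exists del; intros s Hs. eapply Rle_trans; [|apply (Hd s Hs)].
  eapply Rle_trans; [|apply fst_le_Cmod]. right; f_equal. simpl; ring.
Qed.

Lemma rder_snd (g : R -> C) (t : R) (v : C) :
  rder g t v -> is_derive (fun t => snd (g t)) t (snd v).
Proof.
  intros H; apply is_derive_of_increment; intros eps; destruct (H eps) as [del Hd].
  exists del; intros s Hs. eapply Rle_trans; [|apply (Hd s Hs)].
  eapply Rle_trans; [|apply snd_le_Cmod]. right; f_equal. simpl; ring.
Qed.

Lemma rder_components (g : R -> C) (t : R) (v : C) :
  is_derive (fun t => fst (g t)) t (fst v) -> is_derive (fun t => snd (g t)) t (snd v) ->
  rder g t v.
Proof.
  intros H1 H2 eps.
  destruct (increment_of_is_derive _ _ _ H1 (pos_div_2 eps)) as [d1 D1].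
  destruct (increment_of_is_derive _ _ _ H2 (pos_div_2 eps)) as [d2 D2].
  assert (Hm : 0 < Rmin d1 d2) by (apply Rmin_pos; apply cond_pos).
  exists (mkposreal _ Hm); simpl; intros s Hs.
  specialize (D1 s (Rlt_le_trans _ _ _ Hs (Rmin_l _ _))).
  specialize (D2 s (Rlt_le_trans _ _ _ Hs (Rmin_r _ _))).
  eapply Rle_trans; [apply Cmod_le_sum|]. simpl in D1, D2 |- *.
  replace (fst (g (t + s)%R) + - fst (g t) + - (s * fst v - 0 * snd v))%R
    with (fst (g (t + s)%R) - fst (g t) - s * fst v)%R by ring.
  replace (snd (g (t + s)%R) + - snd (g t) + - (s * snd v + 0 * fst v))%R
    with (snd (g (t + s)%R) - snd (g t) - s * snd v)%R by ring.
  lra.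
Qed.

Lemma rder_line (p d : C) (t : R) : rder (fun t => p + RtoC t * d) t d.
Proof.
  intros eps; exists (mkposreal 1 Rlt_0_1); intros s _.
  replace (p + RtoC (t + s) * d - (p + RtoC t * d) - RtoC s * d) with (RtoC 0)
    by (rewrite RtoC_plus; ring).
  rewrite Cmod_0. apply Rmult_le_pos; [left; apply cond_pos | apply Rabs_pos].
Qed.

Lemma rder_comp (F : C -> C) (g : R -> C) (t : R) (v l : C) :
  cder F (g t) l -> rder g t v -> rder (fun t => F (g t)) t (l * v).
Proof.
  intros HF Hg eps.
  pose proof (Cmod_ge_0 v) as Hv. pose proof (Cmod_ge_0 l) as Hl.
  assert (He1 : 0 < eps / (2 * (1 + Cmod v))) by (apply Rdiv_lt_0_compat; [apply cond_pos|lra]).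
  assert (He2 : 0 < eps / (2 * (1 + Cmod l))) by (apply Rdiv_lt_0_compat; [apply cond_pos|lra]).
  destruct (HF (mkposreal _ He1)) as [d1 H1].
  destruct (Hg (mkposreal _ He2)) as [d2 H2].
  destruct (Hg (mkposreal _ Rlt_0_1)) as [d3 H3]. simpl in *.
  assert (Hm : 0 < Rmin (Rmin d2 d3) (d1 / (1 + Cmod v))).
  { repeat apply Rmin_pos; try apply cond_pos. apply Rdiv_lt_0_compat; [apply cond_pos|lra]. }
  exists (mkposreal _ Hm); simpl; intros s Hs.
  destruct (Rmin_Rgt_l _ _ _ Hs) as [Hs' Hs1].
  specialize (H2 s (Rlt_le_trans _ _ _ Hs' (Rmin_l _ _))).
  specialize (H3 s (Rlt_le_trans _ _ _ Hs' (Rmin_r _ _))).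
  set (h := g (t + s)%R - g t) in *.
  pose proof (Rabs_pos s) as Hs0.
  assert (Hh : Cmod h <= (1 + Cmod v) * Rabs s).
  { replace h with (h - RtoC s * v + RtoC s * v) by ring.
    eapply Rle_trans; [apply Cmod_triangle|]. rewrite Cmod_mult, Cmod_R. lra. }
  assert (Hh1 : Cmod h < d1).
  { eapply Rle_lt_trans; [exact Hh|].
    apply (Rmult_lt_compat_l (1 + Cmod v)) in Hs1; [|lra].
    replace ((1 + Cmod v) * (d1 / (1 + Cmod v)))%R with (pos d1) in Hs1 by (field; lra). exact Hs1. }
  specialize (H1 h Hh1). replace (g t + h) with (g (t + s)%R) in H1 by (unfold h; ring).
  replace (F (g (t + s)%R) - F (g t) - RtoC s * (l * v))
    with ((F (g (t + s)%R) - F (g t) - h * l) + l * (h - RtoC s * v)) by ring.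
  eapply Rle_trans; [apply Cmod_triangle|]. rewrite Cmod_mult.
  assert (T1 : eps / (2 * (1 + Cmod v)) * Cmod h <= eps / 2 * Rabs s).
  { apply Rle_trans with (eps / (2 * (1 + Cmod v)) * ((1 + Cmod v) * Rabs s))%R.
    - apply Rmult_le_compat_l; lra.
    - right; field; lra. }
  assert (T2 : Cmod l * Cmod (h - RtoC s * v)%C <= eps / 2 * Rabs s).
  { apply Rle_trans with ((1 + Cmod l) * (eps / (2 * (1 + Cmod l)) * Rabs s))%R.
    - pose proof (Cmod_ge_0 (h - RtoC s * v)). apply Rmult_le_compat; lra.
    - right; field; lra. }
  lra.
Qed.

(** Passes from continuity on C to continuity in two real parameters, the form that differentiation
    under the integral sign asks for. *)
Lemma ccont_2d (F : C -> C) (u v : R -> R -> R) (x y : R) :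
  continuity_2d_pt u x y -> continuity_2d_pt v x y -> ccont F (u x y, v x y) ->
  continuity_2d_pt (fun x y => fst (F (u x y, v x y))) x y /\
  continuity_2d_pt (fun x y => snd (F (u x y, v x y))) x y.
Proof.
  intros Hu Hv HF.
  assert (H : forall eps : posreal, locally_2d
            (fun x' y' => Cmod (F (u x' y', v x' y') - F (u x y, v x y))%C < eps)%R x y).
  { intros eps. destruct (HF eps) as [del Hd].
    specialize (Hu (pos_div_2 del)). specialize (Hv (pos_div_2 del)).
    apply (locally_2d_impl _ _ _ _) with (2 := locally_2d_and _ _ _ _ Hu Hv).
    apply locally_2d_forall. intros x' y' [H1 H2].
    specialize (Hd ((u x' y', v x' y') - (u x y, v x y))).
    assert (E : forall p q : C, p + (q - p) = q) by (intros; ring). rewrite E in Hd.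
    apply Hd. eapply Rle_lt_trans; [apply Cmod_le_sum|]. simpl in *.
    unfold Rminus in *. lra. }
  split; intros eps; apply (locally_2d_impl _ _ _ _) with (2 := H eps);
    apply locally_2d_forall; intros x' y' Hxy; eapply Rle_lt_trans; try exact Hxy.
  - apply (fst_le_Cmod (F (u x' y', v x' y') - F (u x y, v x y))).
  - apply (snd_le_Cmod (F (u x' y', v x' y') - F (u x y, v x y))).
Qed.

(* If the supremum M were not attained, compactness would give d > 0 with f <= M - d;
   f is first replaced by the bounded function 1 - 1/(1+f). *)
Lemma rectangle_max (f : R -> R -> R) (a b : R) : a <= b ->
  (forall x y, continuity_2d_pt f x y) -> (forall x y, 0 <= f x y) ->
  exists x0 y0, (a <= x0 <= b) /\ (a <= y0 <= b) /\
    forall x y, a <= x <= b -> a <= y <= b -> f x y <= f x0 y0.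
Proof.
  intros Hab Hc Hp.
  set (g := fun x y => (1 - / (1 + f x y))%R).
  assert (Hg1 : forall x y, g x y <= 1).
  { intros x y; unfold g. assert (0 < / (1 + f x y)); [|lra].
    apply Rinv_0_lt_compat; specialize (Hp x y); lra. }
  assert (Hgc : forall x y, continuity_2d_pt g x y).
  { intros x y; unfold g. apply continuity_2d_pt_minus; [apply continuity_2d_pt_const|].
    apply continuity_2d_pt_inv; [|specialize (Hp x y); lra].
    apply continuity_2d_pt_plus; [apply continuity_2d_pt_const|apply Hc]. }
  destruct (completeness (fun r => exists x y, (a <= x <= b) /\ (a <= y <= b) /\ r = g x y))
    as [M [HM1 HM2]].
  { exists 1%R; intros r [x [y [_ [_ ->]]]]; apply Hg1. }
  { exists (g a a), a, a; repeat split; lra. }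
  destruct (classic (exists x0 y0, (a <= x0 <= b) /\ (a <= y0 <= b) /\ g x0 y0 = M))
    as [[x0 [y0 [Hx [Hy E]]]]|Hno].
  - exists x0, y0; repeat split; try tauto. intros x y Hx' Hy'.
    assert (H : g x y <= g x0 y0) by (rewrite E; apply HM1; exists x, y; auto).
    unfold g in H. pose proof (Hp x y); pose proof (Hp x0 y0).
    apply Rnot_lt_le; intros Hlt.
    assert (/ (1 + f x y) < / (1 + f x0 y0)); [|lra].
    apply Rinv_lt_contravar; [nra|lra].
  - exfalso.
    assert (Hlt : forall u v, a <= u <= b -> a <= v <= b -> g u v < M).
    { intros u v Hu Hv. assert (H : g u v <= M) by (apply HM1; exists u, v; auto).
      destruct H as [|H]; [assumption|]. elim Hno; exists u, v; auto. }
    assert (Hdel : forall u v, exists d : posreal,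
              a <= u <= b -> a <= v <= b ->
              forall x y, Rabs (x - u) < d -> Rabs (y - v) < d -> g x y <= M - d).
    { intros u v.
      destruct (classic ((a <= u <= b) /\ (a <= v <= b))) as [[Hu Hv]|Hn].
      2:{ exists (mkposreal 1 Rlt_0_1); tauto. }
      specialize (Hlt u v Hu Hv).
      assert (He : 0 < (M - g u v) / 2) by lra.
      destruct (Hgc u v (mkposreal _ He)) as [d Hd]. simpl in Hd.
      assert (Hm : 0 < Rmin d ((M - g u v) / 2)) by (apply Rmin_pos; [apply cond_pos|lra]).
      exists (mkposreal _ Hm); simpl; intros _ _ x y Hx Hy.
      specialize (Hd x y (Rlt_le_trans _ _ _ Hx (Rmin_l _ _)) (Rlt_le_trans _ _ _ Hy (Rmin_l _ _))).
      apply Rabs_def2 in Hd. pose proof (Rmin_r d ((M - g u v) / 2)). lra. }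
    set (delta := fun u v => proj1_sig (constructive_indefinite_description _ (Hdel u v))).
    assert (Hdelta : forall u v, a <= u <= b -> a <= v <= b ->
              forall x y, Rabs (x - u) < delta u v -> Rabs (y - v) < delta u v ->
              g x y <= M - delta u v).
    { intros u v; unfold delta.
      destruct (constructive_indefinite_description _ (Hdel u v)) as [d Hd]; simpl; assumption. }
    destruct (compactness_value_2d a b a b delta) as [d Hd].
    assert (Hub : M <= M - d).
    { apply HM2. intros r [x [y [Hx [Hy ->]]]].
      apply Rnot_lt_le; intros Hbad. apply (Hd x y Hx Hy).
      intros [u [v [Hu [Hv [H1 [H2 H3]]]]]].
      specialize (Hdelta u v Hu Hv x y H1 H2). lra. }
    pose proof (cond_pos d); lra.
Qed.

Lemma continuity_2d_continuous (f : R -> R -> R) (x y : R) :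
  continuity_2d_pt f x y -> continuous (f x) y.
Proof.
  intros H. apply continuity_pt_filterlim. intros eps Heps.
  destruct (H (mkposreal eps Heps)) as [d Hd].
  exists d; split; [apply cond_pos|]. intros y' [_ Hy]. apply Hd; [|exact Hy].
  rewrite Rminus_diag, Rabs_R0. apply cond_pos.
Qed.

Lemma Cmod_expi (t : R) : Cmod (expi t) = 1%R.
Proof.
  pose proof (Cmod_sq (expi t)) as H. simpl in H. pose proof (sin2_cos2 t) as E.
  unfold Rsqr in E. pose proof (Cmod_ge_0 (expi t)). nra.
Qed.

Lemma expi_0 : expi 0 = 1.
Proof. unfold expi. now rewrite cos_0, sin_0. Qed.

Lemma ccont_scal (c : C) (f : C -> C) (z : C) : ccont f z -> ccont (fun z => c * f z) z.
Proof.
  intros H eps. pose proof (Cmod_ge_0 c).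
  assert (He : 0 < eps / (1 + Cmod c)) by (apply Rdiv_lt_0_compat; [apply cond_pos|lra]).
  destruct (H (mkposreal _ He)) as [d Hd]. exists d. intros h Hh. specialize (Hd h Hh).
  simpl in Hd. replace (c * f (z + h) - c * f z) with (c * (f (z + h) - f z)) by ring.
  rewrite Cmod_mult. pose proof (Cmod_ge_0 (f (z + h) - f z)).
  apply Rle_lt_trans with ((1 + Cmod c) * Cmod (f (z + h) - f z)%C)%R; [nra|].
  apply (Rmult_lt_compat_l (1 + Cmod c)) in Hd; [|lra].
  replace ((1 + Cmod c) * (eps / (1 + Cmod c)))%R with (pos eps) in Hd by (field; lra). exact Hd.
Qed.

(** * The mean value property and the maximum principle *)

Lemma Cmod_radius (h : C) (s t : R) : Cmod (RtoC s * h * expi t) = (Rabs s * Cmod h)%R.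
Proof. now rewrite !Cmod_mult, Cmod_R, Cmod_expi, Rmult_1_r. Qed.

Lemma circle_radial_rder (F G : C -> C) (q h : C) (s t : R) :
  cder F (q + RtoC s * h * expi t) (G (q + RtoC s * h * expi t)) ->
  rder (fun s => F (q + RtoC s * h * expi t)) s
    (G (q + RtoC s * h * expi t) * (h * expi t)).
Proof.
  intros HF. apply (rder_comp F (fun s => q + RtoC s * h * expi t)); [exact HF|].
  intros eps; exists (mkposreal 1 Rlt_0_1); intros y _.
  replace (q + RtoC (s + y) * h * expi t - (q + RtoC s * h * expi t) - RtoC y * (h * expi t))
    with (RtoC 0) by (rewrite RtoC_plus; ring).
  rewrite Cmod_0. apply Rmult_le_pos; [left; apply cond_pos | apply Rabs_pos].
Qed.

Lemma circle_angular_rder (F G : C -> C) (q h : C) (t : R) :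
  cder F (q + h * expi t) (G (q + h * expi t)) ->
  rder (fun t => F (q + h * expi t)) t (G (q + h * expi t) * (h * (Ci * expi t))).
Proof.
  intros HF. apply (rder_comp F (fun t => q + h * expi t)); [exact HF|].
  apply rder_components; simpl; auto_derive; auto; ring.
Qed.

(* The mean over the circle of radius s|h| has zero derivative in s: its integrand
   is the angular derivative of Im F / s. *)
Lemma circle_mean_value (F G : C -> C) (q h : C) (d : R) :
  Cmod h < d ->
  (forall k, Cmod k < d -> cder F (q + k) (G (q + k))) ->
  (forall k, Cmod k < d -> ccont G (q + k)) ->
  RInt (fun t => fst (F (q + h * expi t))) 0 (2 * PI) = (2 * PI * fst (F q))%R.
Proof.
  intros Hh HF HG. pose proof PI_RGT_0 as Hpi.
  pose proof (Cmod_ge_0 h) as Hh0.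
  set (u := fun s t => fst (F (q + RtoC s * h * expi t))).
  set (du := fun s t => fst (G (q + RtoC s * h * expi t) * (h * expi t))).
  (* All circles with |s| < 1 + e stay in the disc of radius d; the margin beyond s = 1 is needed to
     differentiate there. *)
  set (e := ((d - Cmod h) / (1 + Cmod h))%R).
  assert (He : 0 < e) by (apply Rdiv_lt_0_compat; lra).
  assert (Heh : e * Cmod h < d - Cmod h).
  { apply Rlt_le_trans with (e * (1 + Cmod h))%R; [nra|]. right; unfold e; field; lra. }
  assert (Hin : forall s t, Rabs s < 1 + e -> Cmod (RtoC s * h * expi t) < d).
  { intros s t Hs. rewrite Cmod_radius. nra. }
  assert (Hc : forall s t, Rabs s < 1 + e -> continuity_2d_pt du s t).
  { intros s t Hs.
    set (a := fun s t => (fst q + s * (fst h * cos t - snd h * sin t))%R).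
    set (b := fun s t => (snd q + s * (fst h * sin t + snd h * cos t))%R).
    assert (Ccos : forall x y, continuity_2d_pt (fun _ t => cos t) x y).
    { intros x y. apply (continuity_1d_2d_pt_comp cos (fun _ t => t)); [|apply continuity_2d_pt_id2].
      apply continuity_cos. }
    assert (Csin : forall x y, continuity_2d_pt (fun _ t => sin t) x y).
    { intros x y. apply (continuity_1d_2d_pt_comp sin (fun _ t => t)); [|apply continuity_2d_pt_id2].
      apply continuity_sin. }
    assert (Ca : continuity_2d_pt a s t) by (unfold a; repeat (apply Ccos || apply Csin || cont2d)).
    assert (Cb : continuity_2d_pt b s t) by (unfold b; repeat (apply Ccos || apply Csin || cont2d)).
    assert (Eab : forall s t, q + RtoC s * h * expi t = (a s t, b s t)).
    { intros x y. unfold a, b, expi. apply injective_projections; simpl; ring. }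
    destruct (ccont_2d G a b s t Ca Cb) as [C1 C2].
    { rewrite <- Eab. apply HG, Hin, Hs. }
    apply continuity_2d_pt_ext with
      (fun s t => (fst (G (a s t, b s t)) * (fst h * cos t - snd h * sin t)
                  - snd (G (a s t, b s t)) * (fst h * sin t + snd h * cos t))%R).
    { intros x y. unfold du. rewrite Eab. unfold expi. simpl. ring. }
    repeat (assumption || apply Ccos || apply Csin || cont2d). }
  assert (Hder : forall s, 0 <= s <= 1 -> is_derive (fun s => RInt (u s) 0 (2 * PI)) s 0%R).
  { intros s Hs. evar_last.
    - apply (is_derive_RInt_parameter u du (-1) (2 * PI + 1) 0 (2 * PI) s e); try lra.
      + intros x y Hx _. unfold u, du.
        apply (rder_fst (fun s => F (q + RtoC s * h * expi y))), circle_radial_rder.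
        apply HF, Hin. apply Rabs_def2 in Hx; apply Rabs_def1; lra.
      + intros y _. apply Hc. apply Rabs_def1; lra.
      + intros x y Hx _. apply ex_derive_cont.
        eexists. apply (rder_fst (fun t => F (q + RtoC x * h * expi t))).
        apply (circle_angular_rder F G q (RtoC x * h)), HF, Hin.
        apply Rabs_def2 in Hx; apply Rabs_def1; lra.
    - assert (Hsin : Rabs s < 1 + e) by (apply Rabs_def1; lra).
      assert (Hcont : forall t, continuous (du s) t)
        by (intros t; apply (continuity_2d_continuous du s t), Hc, Hsin).
      assert (Hper : expi (2 * PI) = expi 0)
        by (unfold expi; now rewrite cos_2PI, sin_2PI, cos_0, sin_0).
      apply is_RInt_unique.
      (* At s = 0 no division by s is possible; the primitive becomes Im (G(q) h e^(it)), the limit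
         of Im (F - F(q)) / s. *)
      destruct (Req_dec s 0) as [->|Hs0].
      + evar_last.
        * apply (is_RInt_derive (V := R_CompleteNormedModule)
                   (fun t => snd ((fun w => G q * w) (0 + h * expi t)))); [|intros t _; apply Hcont].
          intros t _. evar_last.
          -- apply (rder_snd (fun t => (fun w => G q * w) (0 + h * expi t))).
             apply (circle_angular_rder (fun w => G q * w) (fun _ => G q * 1)).
             apply (cder_scal (G q) (fun w => w)). intros eps; exists (mkposreal 1 Rlt_0_1); intros k _.
             replace (0 + h * expi t + k - (0 + h * expi t) - k * 1) with (RtoC 0) by ring.
             rewrite Cmod_0. apply Rmult_le_pos; [left; apply cond_pos | apply Cmod_ge_0].
          -- unfold du. replace (q + 0 * h * expi t) with q by ring. simpl. ring.
        * rewrite Hper. unfold minus, plus, opp; simpl; ring.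
      + evar_last.
        * apply (is_RInt_derive (V := R_CompleteNormedModule)
                   (fun t => / s * snd (F (q + RtoC s * h * expi t)%C))%R); [|intros t _; apply Hcont].
          intros t _. evar_last.
          -- apply is_derive_scal. apply (rder_snd (fun t => F (q + RtoC s * h * expi t))).
             apply (circle_angular_rder F G q (RtoC s * h)), HF, Hin, Hsin.
          -- unfold du. simpl. field. assumption.
        * rewrite Hper. unfold minus, plus, opp; simpl; ring. }
  assert (E : RInt (u 0%R) 0 (2 * PI) = RInt (u 1%R) 0 (2 * PI)).
  { apply (eq_is_derive (V := R_NormedModule) (fun s => RInt (u s) 0 (2 * PI)) 0 1); [|lra].
    exact Hder. }
  transitivity (RInt (u 1%R) 0 (2 * PI)).
  - apply RInt_ext. intros t _. unfold u. now rewrite Cmult_1_l.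
  - rewrite <- E. transitivity (RInt (fun _ => fst (F q)) 0 (2 * PI)).
    + apply RInt_ext. intros t _. unfold u. now rewrite !Cmult_0_l, Cplus_0_r.
    + rewrite RInt_const. unfold scal; simpl; unfold mult; simpl. ring.
Qed.

(** By continuity f exceeds f(0) / 2 on some initial segment [0, a]. *)
Lemma RInt_pos_of_nonneg (f : R -> R) (b : R) : 0 < b ->
  (forall t, continuous f t) -> (forall t, 0 <= f t) -> 0 < f 0 -> 0 < RInt f 0 b.
Proof.
  intros Hb Hc Hf H0.
  destruct (proj2 (continuity_pt_filterlim f 0) (Hc 0%R) (f 0 / 2)%R ltac:(lra)) as [d [Hd Hcd]].
  set (a := Rmin (d / 2) b).
  assert (Ha : 0 < a) by (apply Rmin_pos; lra).
  assert (Hab : a <= b) by apply Rmin_r.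
  assert (Had : (a <= d / 2)%R) by apply Rmin_l.
  assert (Hex : forall x y, ex_RInt f x y)
    by (intros x y; apply ex_RInt_cont; auto).
  rewrite <- (RInt_Chasles (V := R_CompleteNormedModule) f 0 a b) by auto.
  assert (H1 : (RInt (fun _ => f 0 / 2) 0 a <= RInt f 0 a)%R).
  { apply RInt_le; [lra|apply ex_RInt_const|auto|]. intros x Hx.
    specialize (Hcd x). simpl in Hcd. unfold R_dist in Hcd.
    assert (T : (Rabs (f x - f 0) < f 0 / 2)%R).
    { apply Hcd. split; [split; [exact I|lra]|]. rewrite Rminus_0_r. apply Rabs_def1; lra. }
    apply Rabs_def2 in T; lra. }
  rewrite RInt_const in H1. unfold scal in H1; simpl in H1; unfold mult in H1; simpl in H1.
  assert (H2 : 0 <= RInt f a b) by (apply RInt_ge_0; auto).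
  unfold plus; simpl. nra.
Qed.

(** Multiplication by c, the conjugate of F(q), turns the modulus into a real part: Re (c F) is at
    most M^2 everywhere and has mean M^2 on the circle, so the continuous nonnegative function M^2 -
    Re (c F) vanishes at t = 0. Then M^2 = Re (c F(q+h)) <= M |F(q+h)|. *)
Lemma max_modulus_circle (F G : C -> C) (q h : C) (d : R) :
  Cmod h < d ->
  (forall k, Cmod k < d -> cder F (q + k) (G (q + k))) ->
  (forall k, Cmod k < d -> ccont G (q + k)) ->
  0 < Cmod (F q) -> (forall z, Cmod (F z) <= Cmod (F q)) ->
  Cmod (F (q + h)) = Cmod (F q).
Proof.
  intros Hh HF HG Hpos Hmax. pose proof PI_RGT_0 as Hpi.
  set (M := Cmod (F q)) in *. set (c := Cconj (F q)).
  assert (Hc : Cmod c = M) by apply Cmod_conj.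
  assert (HcF : forall z, fst (c * F z)%C <= M * M).
  { intros z. eapply Rle_trans; [apply Rle_abs|]. eapply Rle_trans; [apply fst_le_Cmod|].
    rewrite Cmod_mult, Hc. apply Rmult_le_compat_l; [lra|apply Hmax]. }
  assert (Hq : fst (c * F q) = (M * M)%R).
  { unfold M. rewrite Cmod_sq. unfold c; simpl; ring. }
  pose proof (circle_mean_value (fun z => c * F z) (fun z => c * G z) q h d Hh
                (fun k hk => cder_scal c F _ _ (HF k hk)) (fun k hk => ccont_scal c G _ (HG k hk)))
    as Hmean. cbv beta in Hmean. rewrite Hq in Hmean.
  assert (Hcont : forall t, continuous (fun t => fst (c * F (q + h * expi t))) t).
  { intros t. apply ex_derive_cont. eexists.
    apply (rder_fst (fun t => c * F (q + h * expi t))).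
    apply (circle_angular_rder (fun z => c * F z) (fun z => c * G z)), cder_scal, HF.
    now rewrite Cmod_mult, Cmod_expi, Rmult_1_r. }
  assert (E : (fst (c * F (q + h))%C = M * M)%R).
  { destruct (HcF (q + h)) as [Hlt|]; [|assumption]. exfalso.
    assert (H : (0 < RInt (fun t => M * M - fst (c * F (q + h * expi t))%C) 0 (2 * PI))%R).
    { apply RInt_pos_of_nonneg; [lra| | |].
      - intros t. apply (continuous_minus (V := R_NormedModule) (fun _ => (M * M)%R)); [|apply Hcont].
        apply continuous_const.
      - intros t. specialize (HcF (q + h * expi t)); lra.
      - rewrite expi_0, Cmult_1_r. lra. }
    rewrite (RInt_minus (V := R_CompleteNormedModule)) in H.
    - rewrite Hmean, RInt_const in H.
      unfold minus, plus, opp, scal in H; simpl in H; unfold mult in H; simpl in H. lra.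
    - apply ex_RInt_const.
    - apply ex_RInt_cont; intros t _; apply Hcont. }
  apply Rle_antisym; [apply Hmax|].
  assert (H : M * M <= M * Cmod (F (q + h)%C)).
  { rewrite <- E, <- Hc, <- Cmod_mult. eapply Rle_trans; [apply Rle_abs|]. apply fst_le_Cmod. }
  nra.
Qed.

(* A point of the ray from a maximum of |F| to 0 where |F| is still maximal cannot be
   closest to 0, by the mean value property; yet F 0 = 0. *)
Lemma elliptic_liouville (F G : C -> C) :
  (forall z, ccont F z) -> (forall z w, hexT w -> F (z + w) = F z) ->
  (forall w, hexT w -> F w = 0) ->
  (forall z, ~ hexT z -> cder F z (G z)) -> (forall z, ~ hexT z -> ccont G z) ->
  forall z, F z = 0.
Proof.
  intros Hc Hper H0 HF HG. pose proof varpi_pos as Hv.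
  (* Every point is closer than varpi to the lattice, so this square contains a representative of
     each class, and a maximum over it is a maximum over the plane. *)
  destruct (rectangle_max (fun x y => Cmod (F (x, y))) (- varpi) varpi) as [x0 [y0 [Hx [Hy Hmax]]]].
  { lra. }
  { intros x y eps. destruct (Hc (x, y) eps) as [d Hd].
    exists (pos_div_2 d); intros u v Hu Hv'.
    specialize (Hd ((u, v) - (x, y))).
    assert (E : forall p q : C, p + (q - p) = q) by (intros; ring). rewrite E in Hd.
    eapply Rle_lt_trans; [|apply Hd].
    - apply Rabs_le. pose proof (Cmod_triangle_sub (F (u, v)) (F (x, y))).
      pose proof (Cmod_triangle_sub (F (x, y)) (F (u, v))) as T. rewrite Cmod_minus_sym in T. lra.
    - eapply Rle_lt_trans; [apply Cmod_le_sum|]. simpl in *. unfold Rminus in *. lra. }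
  { intros; apply Cmod_ge_0. }
  set (p := (x0, y0) : C) in *.
  assert (Hglob : forall z, Cmod (F z) <= Cmod (F p)).
  { intros z. destruct (hexT_near z) as [w [Hw Hn]].
    replace (F z) with (F (z - w)).
    2:{ rewrite <- (Hper (z - w) w Hw). f_equal; ring. }
    pose proof (fst_le_Cmod (z - w)) as T1. pose proof (snd_le_Cmod (z - w)) as T2.
    rewrite (surjective_pairing (z - w)).
    apply Hmax; apply Rabs_le_between; lra. }
  destruct (Rle_lt_or_eq_dec 0 (Cmod (F p)) (Cmod_ge_0 _)) as [Hpos|Hz].
  2:{ intros z. apply Cmod_eq_0, Rle_antisym; [|apply Cmod_ge_0]. rewrite Hz. apply Hglob. }
  exfalso.
  destruct (completeness (fun s => (0 <= s <= 1) /\ Cmod (F (RtoC (1 - s) * p)) = Cmod (F p)))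
    as [s0 [Hs1 Hs2]].
  { exists 1%R; intros s [Hs _]; lra. }
  { exists 0%R; split; [lra|]. f_equal. f_equal. replace (1 - 0)%R with 1%R by ring. ring. }
  assert (Hs01 : 0 <= s0 <= 1).
  { split; [|apply Hs2; intros s [Hs _]; lra].
    apply Hs1. split; [lra|]. f_equal. f_equal. replace (1 - 0)%R with 1%R by ring. ring. }
  set (q := RtoC (1 - s0) * p).
  assert (Hq : Cmod (F q) = Cmod (F p)).
  { apply Rle_antisym; [apply Hglob|]. apply le_epsilon; intros eps He.
    destruct (Hc q (mkposreal eps He)) as [d Hd]. simpl in Hd.
    pose proof (Cmod_ge_0 p) as Hp0.
    destruct (classic (exists s, ((0 <= s <= 1) /\ Cmod (F (RtoC (1 - s) * p)) = Cmod (F p)) /\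
                                 (s0 - d / (1 + Cmod p) < s))) as [[s [Hs Hlt]]|Hno].
    - pose proof (Hs1 s Hs) as Hle. destruct Hs as [Hs E].
      specialize (Hd (RtoC (s0 - s) * p)).
      replace (q + RtoC (s0 - s) * p) with (RtoC (1 - s) * p) in Hd
        by (unfold q; rewrite !RtoC_minus; ring).
      assert (Hlt' : Cmod (F (RtoC (1 - s) * p) - F q)%C < eps).
      { apply Hd. rewrite Cmod_mult, Cmod_R, Rabs_pos_eq by lra.
        apply Rle_lt_trans with ((s0 - s) * (1 + Cmod p))%R; [nra|].
        apply Rlt_le_trans with (d / (1 + Cmod p) * (1 + Cmod p))%R.
        - apply Rmult_lt_compat_r; lra.
        - right; field; lra. }
      pose proof (Cmod_triangle_sub (F (RtoC (1 - s) * p)) (F q)). lra.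
    - exfalso.
      assert (s0 <= s0 - d / (1 + Cmod p)).
      { apply Hs2. intros s Hs. apply Rnot_lt_le; intros Hlt. apply Hno; exists s; auto. }
      assert (0 < d / (1 + Cmod p)) by (apply Rdiv_lt_0_compat; [apply cond_pos|lra]). lra. }
  assert (Hqn : ~ hexT q).
  { intros Hw. rewrite (H0 q Hw), Cmod_0 in Hq. lra. }
  destruct (hexT_dist q Hqn) as [d Hsep]. pose proof (proj1 Hsep) as Hd.
  assert (Hs0 : s0 < 1).
  { destruct Hs01 as [_ [|E]]; [assumption|]. elim (nhexT_neq_0 q Hqn). unfold q. rewrite E.
    replace (1 - 1)%R with 0%R by ring. ring. }
  pose proof (Cmod_ge_0 p) as Hp0.
  set (r := Rmin (1 - s0) (d / (2 * (1 + Cmod p)))).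
  assert (Hr : 0 < r) by (apply Rmin_pos; [lra|apply Rdiv_lt_0_compat; lra]).
  assert (Hr1 : r <= 1 - s0) by apply Rmin_l.
  assert (Hrp : r * Cmod p < d).
  { apply Rle_lt_trans with (d / (2 * (1 + Cmod p)) * (1 + Cmod p))%R.
    - apply Rmult_le_compat; try lra. apply Rmin_r.
    - replace (d / (2 * (1 + Cmod p)) * (1 + Cmod p))%R with (d / 2)%R by (field; lra). lra. }
  assert (E : Cmod (F (q + - RtoC r * p)) = Cmod (F q)).
  { apply (max_modulus_circle F G q (- RtoC r * p) d).
    - rewrite Cmod_mult, Cmod_opp, Cmod_R, Rabs_pos_eq by lra. assumption.
    - intros k Hk. now apply HF, (hexT_complement q d).
    - intros k Hk. now apply HG, (hexT_complement q d).
    - rewrite Hq; assumption.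
    - rewrite Hq; assumption. }
  assert (Hle : s0 + r <= s0); [|lra].
  apply Hs1. split; [lra|]. rewrite <- Hq, <- E. f_equal. f_equal.
  unfold q. rewrite !RtoC_minus, RtoC_plus. ring.
Qed.

(** * The differential equation *)

Lemma punctured_disc (z : C) : z <> 0 -> Cmod z < varpi -> ~ hexT z.
Proof. intros H0 Hz Hw. pose proof (hexT_separated z Hw H0). lra. Qed.

(* Extended by its limit 0 at the poles. *)
Definition ode_defect (z : C) : C :=
  if excluded_middle_informative (hexT z) then 0 else wpD2 z - 6 * (wp z * wp z).

Lemma ode_defect_off (z : C) : ~ hexT z -> ode_defect z = wpD2 z - 6 * (wp z * wp z).
Proof.
  intros Hz; unfold ode_defect. destruct (excluded_middle_informative (hexT z)); tauto.
Qed.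

Lemma ode_defect_on (z : C) : hexT z -> ode_defect z = 0.
Proof.
  intros Hz; unfold ode_defect. destruct (excluded_middle_informative (hexT z)); tauto.
Qed.

Lemma ode_defect_periodic (z w : C) : hexT w -> ode_defect (z + w) = ode_defect z.
Proof.
  intros Hw. destruct (classic (hexT z)) as [Hz|Hz].
  - rewrite !ode_defect_on; auto using hexT_plus.
  - rewrite !ode_defect_off; auto using nhexT_plus.
    now rewrite wpD2_periodic, wp_periodic.
Qed.

(** The polar parts 6 / z^4 of wp'' and 6 wp^2 cancel. The only remaining quotient is
    [wpreg z / z^2], which is O(z) by [wpreg_cubic]. *)
Lemma ode_defect_near_0 (z : C) : z <> 0 -> Cmod z < varpi ->
  ode_defect z = 6 * lsum hexT' 4 z - 12 * (wpreg z / z ^ 2) - 6 * (wpreg z * wpreg z).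
Proof.
  intros H0 Hz. pose proof (punctured_disc z H0 Hz) as Hn.
  rewrite ode_defect_off, wp_wpreg by assumption. unfold wpD2.
  rewrite lsum_insert by (assumption || lia). simpl. field. assumption.
Qed.

Lemma ode_defect_ccont_0 : ccont ode_defect 0.
Proof.
  intros eps. pose proof varpi_pos as Hv. pose proof (cond_pos eps) as He0.
  destruct wpreg_cubic as [K [HK Hreg]].
  assert (Hs0 : separated hexT' 0 varpi).
  { pose proof (hexT'_dist 0) as H. rewrite Cmod_0, Rminus_0_r in H. now apply H. }
  pose proof (cder_ccont _ _ _ (cder_lsum hexT' 0 varpi 4 hexT'_hexT Hs0 ltac:(lia))) as Hc.
  assert (He : 0 < eps / 24) by lra.
  destruct (Hc (mkposreal _ He)) as [d1 Hd1]. simpl in Hd1.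
  (* The factor (1 + K)^2 covers K r and (K r)^2 at once, for r <= 1. The three terms of the defect
     are then at most eps/4, eps/4 and eps/8. *)
  set (d2 := (eps / (48 * (1 + K) * (1 + K)))%R).
  assert (Hd2 : 0 < d2) by (apply Rdiv_lt_0_compat; [lra|nra]).
  assert (Hm : 0 < Rmin (Rmin d1 d2) (Rmin 1 (varpi / 2)))
    by (repeat apply Rmin_pos; try apply cond_pos; lra).
  exists (mkposreal _ Hm); simpl; intros h Hh.
  destruct (Rmin_Rgt_l _ _ _ Hh) as [Hh12 Hh34].
  destruct (Rmin_Rgt_l _ _ _ Hh12) as [Hh1 Hh2].
  destruct (Rmin_Rgt_l _ _ _ Hh34) as [Hh3 Hh4].
  rewrite (ode_defect_on 0 hexT_0).
  replace (ode_defect (0 + h) - 0) with (ode_defect h) by (replace (0 + h) with h by ring; ring).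
  destruct (Ceq_dec h 0) as [->|Hne].
  { rewrite (ode_defect_on 0 hexT_0), Cmod_0. exact He0. }
  rewrite ode_defect_near_0 by (assumption || lra).
  specialize (Hd1 h Hh1). rewrite lsum_hexT'_4_0 in Hd1.
  replace (lsum hexT' 4 (0 + h) - 0) with (lsum hexT' 4 h) in Hd1
    by (replace (0 + h) with h by ring; ring).
  pose proof (Hreg h ltac:(lra)) as HR.
  set (r := Cmod h) in *.
  assert (Hr : 0 < r) by now apply Cmod_gt_0.
  assert (T2 : Cmod (wpreg h / h ^ 2) <= K * r).
  { rewrite Cmod_div, Cmod_pow by now apply Cpow_nz. fold r.
    apply Rmult_le_reg_r with (r ^ 2)%R; [apply pow_lt, Hr|].
    unfold Rdiv. rewrite Rmult_assoc, Rinv_l by (apply Rgt_not_eq, pow_lt, Hr).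
    rewrite Rmult_1_r. eapply Rle_trans; [exact HR|]. right; ring. }
  assert (T3 : Cmod (wpreg h) <= K * r).
  { eapply Rle_trans; [exact HR|]. apply Rmult_le_compat_l; [assumption|]. simpl.
    rewrite Rmult_1_r. assert (r * r <= 1) by nra. nra. }
  assert (T4 : K * r <= eps / 48).
  { assert (E : (d2 * ((1 + K) * (1 + K)) = eps / 48)%R) by (unfold d2; field; lra).
    assert (K <= (1 + K) * (1 + K)) by nra. nra. }
  assert (T5 : K * r * (K * r) <= eps / 48).
  { assert (E : (d2 * ((1 + K) * (1 + K)) = eps / 48)%R) by (unfold d2; field; lra).
    rewrite <- E. replace (K * r * (K * r))%R with (r * (K * K * r))%R by ring.
    apply Rmult_le_compat; try lra; [nra|]. assert (K * K * r <= K * K) by nra. nra. }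
  unfold Cminus. eapply Rle_lt_trans; [apply Cmod_triangle|].
  eapply Rle_lt_trans; [apply Rplus_le_compat_r, Cmod_triangle|].
  rewrite !Cmod_opp, !Cmod_mult, !Cmod_R, !Rabs_pos_eq by lra.
  pose proof (Cmod_ge_0 (wpreg h)).
  assert (Cmod (wpreg h) * Cmod (wpreg h) <= K * r * (K * r)) by (apply Rmult_le_compat; lra).
  lra.
Qed.

Lemma cder_wp_sq (z : C) : ~ hexT z -> cder (fun z => wp z * wp z) z (wpD1 z * wp z + wp z * wpD1 z).
Proof. intros Hz. apply cder_mult; now apply cder_wp. Qed.

Lemma ccont_plus (f g : C -> C) (z : C) : ccont f z -> ccont g z -> ccont (fun z => f z + g z) z.
Proof.
  intros Hf Hg eps.
  destruct (Hf (pos_div_2 eps)) as [d1 H1]; destruct (Hg (pos_div_2 eps)) as [d2 H2].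
  assert (Hm : 0 < Rmin d1 d2) by (apply Rmin_pos; apply cond_pos).
  exists (mkposreal _ Hm); simpl; intros h Hh.
  specialize (H1 h (Rlt_le_trans _ _ _ Hh (Rmin_l _ _))).
  specialize (H2 h (Rlt_le_trans _ _ _ Hh (Rmin_r _ _))). simpl in H1, H2.
  replace (f (z + h) + g (z + h) - (f z + g z))
    with ((f (z + h) - f z) + (g (z + h) - g z)) by ring.
  eapply Rle_lt_trans; [apply Cmod_triangle|]. lra.
Qed.

(** The Liouville argument needs a continuous derivative of the defect, and this is where [wpD3]
    enters. Continuity of the defect at the lattice points is carried over from 0 by periodicity. *)
Lemma wp_ode (z : C) : ~ hexT z -> wpD2 z = 6 * (wp z * wp z).
Proof.
  intros Hz. apply Ceq_minus. rewrite <- ode_defect_off by assumption. revert z Hz.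
  assert (Hd : forall z, ~ hexT z ->
            cder ode_defect z (wpD3 z + - (6) * (wpD1 z * wp z + wp z * wpD1 z))).
  { intros z Hz. destruct (hexT_dist z Hz) as [d Hs].
    apply (cder_ext_loc (fun z => wpD2 z + - (6) * (wp z * wp z)) _ _ _ d); [apply Hs| |].
    - intros h Hh. rewrite ode_defect_off by now apply (hexT_complement z d). ring.
    - apply cder_plus; [now apply cder_wpD2|]. apply cder_scal. now apply cder_wp_sq. }
  intros z _.
  apply (elliptic_liouville ode_defect (fun z => wpD3 z + - (6) * (wpD1 z * wp z + wp z * wpD1 z))).
  - intros y. destruct (classic (hexT y)) as [Hy|Hy].
    + intros eps. destruct (ode_defect_ccont_0 eps) as [d H]. exists d; intros h Hh.
      specialize (H h Hh). replace (ode_defect (y + h)) with (ode_defect (0 + h)).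
      * replace (ode_defect y) with (ode_defect 0); [exact H|]. now rewrite !ode_defect_on by auto using hexT_0.
      * rewrite <- (ode_defect_periodic (0 + h) y Hy). f_equal; ring.
    + eapply cder_ccont; now apply Hd.
  - intros y w; apply ode_defect_periodic.
  - apply ode_defect_on.
  - exact Hd.
  - intros y Hy. apply ccont_plus; [now apply ccont_wpD3|]. apply ccont_scal.
    eapply cder_ccont, cder_plus; apply cder_mult; (now apply cder_wpD1) || (now apply cder_wp).
Qed.

Lemma cder_wpD1_wp (z : C) : ~ hexT z -> cder wpD1 z (6 * (wp z * wp z)).
Proof. intros Hz. rewrite <- wp_ode by assumption. now apply cder_wpD1. Qed.

(** The first integral y^2 - 4 x^3 of the system x' = y, y' = 6 x^2. *)
Definition wp_energy (z : C) : C := wpD1 z * wpD1 z + - (4) * (wp z * (wp z * wp z)).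

Lemma cder_wp_energy (z : C) : ~ hexT z -> cder wp_energy z 0.
Proof.
  intros Hz.
  replace (RtoC 0) with
    (6 * (wp z * wp z) * wpD1 z + wpD1 z * (6 * (wp z * wp z))
     + - (4) * (wpD1 z * (wp z * wp z) + wp z * (wpD1 z * wp z + wp z * wpD1 z))) by ring.
  apply (cder_plus (fun z => wpD1 z * wpD1 z)).
  - apply cder_mult; now apply cder_wpD1_wp.
  - apply cder_scal, (cder_mult wp (fun z => wp z * wp z)); [now apply cder_wp|now apply cder_wp_sq].
Qed.

Lemma wp_energy_segment (p d : C) :
  (forall t, 0 <= t <= 1 -> ~ hexT (p + RtoC t * d)) -> wp_energy (p + d) = wp_energy p.
Proof.
  intros H.
  assert (Hd : forall t, 0 <= t <= 1 -> rder (fun t => wp_energy (p + RtoC t * d)) t (0 * d)).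
  { intros t Ht. apply (rder_comp wp_energy (fun t => p + RtoC t * d)); [|apply rder_line].
    now apply cder_wp_energy, H. }
  rewrite Cmult_0_l in Hd.
  replace (wp_energy p) with (wp_energy (p + RtoC 0 * d)) by (f_equal; ring).
  replace (wp_energy (p + d)) with (wp_energy (p + RtoC 1 * d)) by (f_equal; ring).
  symmetry. apply injective_projections.
  - apply (eq_is_derive (V := R_NormedModule) (fun t => fst (wp_energy (p + RtoC t * d))) 0 1); [|lra].
    intros t Ht. exact (rder_fst _ _ _ (Hd t Ht)).
  - apply (eq_is_derive (V := R_NormedModule) (fun t => snd (wp_energy (p + RtoC t * d))) 0 1); [|lra].
    intros t Ht. exact (rder_snd _ _ _ (Hd t Ht)).
Qed.

Lemma Cmod_convex (p q : C) (t r : R) : 0 <= t <= 1 -> Cmod p < r -> Cmod q < r ->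
  Cmod (p + RtoC t * (q - p)) < r.
Proof.
  intros Ht Hp Hq. replace (p + RtoC t * (q - p)) with (RtoC (1 - t) * p + RtoC t * q)
    by (rewrite RtoC_minus; ring).
  eapply Rle_lt_trans; [apply Cmod_triangle|].
  rewrite !Cmod_mult, !Cmod_R, !Rabs_pos_eq by lra.
  destruct (Req_dec t 1) as [->|]; [lra|]. nra.
Qed.

(** The disc of radius varpi meets the lattice only in 0, and the segment from varpi/3 to z misses 0
    unless z lies on the nonpositive real axis. *)
Lemma wp_energy_disc (z : C) : Cmod z < varpi -> ((0 < fst z) \/ snd z <> 0%R) ->
  wp_energy z = wp_energy (RtoC (varpi / 3)).
Proof.
  intros Hz Hc. pose proof varpi_pos as Hv.
  replace z with (RtoC (varpi / 3) + (z - RtoC (varpi / 3))) by ring.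
  apply wp_energy_segment. intros t Ht. apply punctured_disc.
  - intros E. pose proof (f_equal fst E) as E1. pose proof (f_equal snd E) as E2.
    simpl in E1, E2. destruct Hc as [Hc|Hc].
    + nra.
    + assert (E3 : (t * snd z = 0)%R) by (rewrite <- E2; ring).
      apply Rmult_integral in E3 as [E3|E3]; [|contradiction]. subst t. lra.
  - apply Cmod_convex; [assumption| |assumption].
    rewrite Cmod_R, Rabs_pos_eq; lra.
Qed.

(** A lattice translation brings z into the disc. On the negative real axis, left out by
    [wp_energy_disc], the evenness of the energy allows passing to -z. *)
Lemma wp_energy_const (z : C) : ~ hexT z -> wp_energy z = wp_energy (RtoC (varpi / 3)).
Proof.
  intros Hz. destruct (hexT_near z) as [w [Hw Hn]].
  assert (Hz' : ~ hexT (z - w)) by (apply nhexT_plus; [now apply hexT_opp|assumption]).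
  assert (E : wp_energy z = wp_energy (z - w)).
  { unfold wp_energy. replace z with (z - w + w) at 1 2 3 4 5 by ring.
    now rewrite wpD1_periodic, wp_periodic. }
  rewrite E. set (y := z - w) in *.
  destruct (classic ((0 < fst y) \/ snd y <> 0%R)) as [H|H]; [now apply wp_energy_disc|].
  transitivity (wp_energy (- y)).
  - unfold wp_energy. rewrite wpD1_opp, wp_opp by assumption. ring.
  - apply wp_energy_disc; [now rewrite Cmod_opp|]. left.
    change (0 < - fst y).
    destruct (Rlt_le_dec 0 (fst y)) as [H1|H1]; [elim H; now left|].
    assert (H2 : snd y = 0%R) by (apply NNPP; intros H2; apply H; now right).
    destruct H1 as [H1|H1]; [apply Ropp_0_gt_lt_contravar, H1|].
    elim (nhexT_neq_0 y Hz'). apply injective_projections; simpl; assumption.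
Qed.

(** * Uniqueness for wp'' = 6 wp^2 and its solutions near poles *)

(** E(t) exp(-K t) does not increase, starts at 0 and is nonnegative. *)
Lemma gronwall_zero (E E' : R -> R) (K T : R) : 0 <= T ->
  (forall t, 0 <= t <= T -> is_derive E t (E' t)) ->
  (forall t, 0 <= t <= T -> E' t <= K * E t) ->
  (forall t, 0 <= E t) -> E 0%R = 0%R -> E T = 0%R.
Proof.
  intros [HT| <-] HE HK Hpos H0; [|assumption].
  set (f := fun t => (E t * exp (- K * t))%R).
  assert (Hf : forall t, 0 <= t <= T ->
            is_derive f t (E' t * exp (- K * t) + E t * (- K * exp (- K * t)))%R).
  { intros t Ht. apply (is_derive_mult (K := R_AbsRing) E (fun t => exp (- K * t))).
    - now apply HE.
    - auto_derive; [auto|ring].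
    - intros; apply Rmult_comm. }
  destruct (MVT_gen f 0 T (fun t => (E' t * exp (- K * t) + E t * (- K * exp (- K * t)))%R))
    as [c [Hc E1]]; rewrite ?Rmin_left, ?Rmax_right in * by lra.
  - intros t Ht; apply Hf; lra.
  - intros t Ht. eapply is_derive_continuity_pt, Hf; lra.
  - unfold f in E1. rewrite H0 in E1.
    pose proof (exp_pos (- K * c)). pose proof (exp_pos (- K * T)).
    specialize (HK c Hc). specialize (Hpos T).
    assert ((E' c * exp (- K * c) + E c * (- K * exp (- K * c))) * (T - 0) <= 0).
    { replace ((E' c * exp (- K * c) + E c * (- K * exp (- K * c))) * (T - 0))%R
        with ((E' c - K * E c) * (exp (- K * c) * T))%R by ring.
      assert (0 < exp (- K * c) * T) by nra. nra. }
    nra.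
Qed.

Lemma rder_plus (f g : R -> C) (t : R) (a b : C) :
  rder f t a -> rder g t b -> rder (fun t => f t + g t) t (a + b).
Proof.
  intros Hf Hg. apply rder_components.
  - apply (is_derive_plus (V := R_NormedModule) (fun t => fst (f t)) (fun t => fst (g t)));
      now apply rder_fst.
  - apply (is_derive_plus (V := R_NormedModule) (fun t => snd (f t)) (fun t => snd (g t)));
      now apply rder_snd.
Qed.

Lemma rder_opp (f : R -> C) (t : R) (a : C) : rder f t a -> rder (fun t => - f t) t (- a).
Proof.
  intros Hf. apply rder_components.
  - apply (is_derive_opp (V := R_NormedModule) (fun t => fst (f t))). now apply rder_fst.
  - apply (is_derive_opp (V := R_NormedModule) (fun t => snd (f t))). now apply rder_snd.
Qed.

Lemma rder_Cmod_sq (f : R -> C) (t : R) (a : C) : rder f t a ->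
  is_derive (fun t => Cmod (f t) * Cmod (f t))%R t (2 * (fst (f t) * fst a + snd (f t) * snd a))%R.
Proof.
  intros Hf. apply is_derive_ext with (fun t => fst (f t) * fst (f t) + snd (f t) * snd (f t))%R.
  - intros s. now rewrite Cmod_sq.
  - pose proof (rder_fst _ _ _ Hf) as H1. pose proof (rder_snd _ _ _ Hf) as H2.
    evar_last.
    + apply (is_derive_plus (V := R_NormedModule)
               (fun t => fst (f t) * fst (f t))%R (fun t => snd (f t) * snd (f t))%R).
      * apply (is_derive_mult (K := R_AbsRing) (fun t => fst (f t)) (fun t => fst (f t)) t _ _ H1 H1).
        intros; apply Rmult_comm.
      * apply (is_derive_mult (K := R_AbsRing) (fun t => snd (f t)) (fun t => snd (f t)) t _ _ H2 H2).
        intros; apply Rmult_comm.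
    + unfold plus, mult; simpl. ring.
Qed.

Lemma dot_le (a b : C) : fst a * fst b + snd a * snd b <= Cmod a * Cmod b.
Proof.
  replace (fst a * fst b + snd a * snd b)%R with (fst (Cconj a * b)) by (simpl; ring).
  rewrite <- (Cmod_conj a), <- Cmod_mult.
  eapply Rle_trans; [apply Rle_abs|apply fst_le_Cmod].
Qed.

(** With D, V the differences of the X and the Y, and S = X1 + X2, the system becomes linear in (D,
    V): D' = V d and V' = 6 S D d. As S is bounded by B on [0, T], the function |D|^2 + |V|^2
    satisfies the Gronwall inequality with constant |d| (1 + 6 B). *)
Lemma wp_ode_unique (X1 Y1 X2 Y2 : R -> C) (d : C) (T : R) : 0 <= T ->
  (forall t, 0 <= t <= T -> rder X1 t (Y1 t * d) /\ rder Y1 t (6 * (X1 t * X1 t) * d)) ->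
  (forall t, 0 <= t <= T -> rder X2 t (Y2 t * d) /\ rder Y2 t (6 * (X2 t * X2 t) * d)) ->
  X1 0%R = X2 0%R -> Y1 0%R = Y2 0%R -> X1 T = X2 T.
Proof.
  intros HT H1 H2 E1 E2.
  set (D := fun t => X1 t + - X2 t). set (V := fun t => Y1 t + - Y2 t).
  set (S := fun t => X1 t + X2 t).
  assert (HD : forall t, 0 <= t <= T -> rder D t (V t * d)).
  { intros t Ht. replace (V t * d) with (Y1 t * d + - (Y2 t * d)) by (unfold V; ring).
    apply rder_plus; [apply H1, Ht|]. apply rder_opp, H2, Ht. }
  assert (HV : forall t, 0 <= t <= T -> rder V t (6 * (S t * D t) * d)).
  { intros t Ht. replace (6 * (S t * D t) * d)
      with (6 * (X1 t * X1 t) * d + - (6 * (X2 t * X2 t) * d)) by (unfold S, D; ring).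
    apply rder_plus; [apply H1, Ht|]. apply rder_opp, H2, Ht. }
  assert (HS : forall t, 0 <= t <= T -> rder S t (Y1 t * d + Y2 t * d)).
  { intros t Ht. apply rder_plus; [apply H1, Ht|apply H2, Ht]. }
  destruct (continuity_ab_maj (fun t => Cmod (S t) * Cmod (S t))%R 0 T HT) as [m [Hm _]].
  { intros t Ht. eapply is_derive_continuity_pt, rder_Cmod_sq, HS, Ht. }
  set (B := (1 + Cmod (S m) * Cmod (S m))%R).
  assert (HB : forall t, 0 <= t <= T -> Cmod (S t) <= B).
  { intros t Ht. specialize (Hm t Ht). unfold B.
    pose proof (Cmod_ge_0 (S t)). nra. }
  assert (HB0 : 0 <= B) by (unfold B; pose proof (Cmod_ge_0 (S m)); nra).
  pose proof (Cmod_ge_0 d) as Hd.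
  set (E := fun t => (Cmod (D t) * Cmod (D t) + Cmod (V t) * Cmod (V t))%R).
  assert (HE : E T = 0%R).
  { apply (gronwall_zero E
      (fun t => (2 * (fst (D t) * fst (V t * d)%C + snd (D t) * snd (V t * d)%C)
                 + 2 * (fst (V t) * fst (6 * (S t * D t) * d)%C
                        + snd (V t) * snd (6 * (S t * D t) * d)%C))%R)
      (Cmod d * (1 + 6 * B)) T HT).
    - intros t Ht.
      apply (is_derive_plus (V := R_NormedModule)
               (fun t => Cmod (D t) * Cmod (D t))%R (fun t => Cmod (V t) * Cmod (V t))%R).
      + now apply rder_Cmod_sq, HD.
      + now apply rder_Cmod_sq, HV.
    - intros t Ht. pose proof (dot_le (D t) (V t * d)) as T1.
      pose proof (dot_le (V t) (6 * (S t * D t) * d)) as T2.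
      rewrite Cmod_mult in T1. rewrite !Cmod_mult, Cmod_R, (Rabs_pos_eq 6) in T2 by lra.
      specialize (HB t Ht). unfold E.
      pose proof (Cmod_ge_0 (D t)) as HD0. pose proof (Cmod_ge_0 (V t)) as HV0.
      set (a := Cmod (D t)) in *. set (b := Cmod (V t)) in *. set (s := Cmod (S t)) in *.
      assert (T3 : b * (6 * (s * a) * Cmod d) <= 6 * B * (a * b * Cmod d)).
      { replace (b * (6 * (s * a) * Cmod d))%R with (6 * s * (a * b * Cmod d))%R by ring.
        apply Rmult_le_compat_r; [|lra]. repeat apply Rmult_le_pos; assumption. }
      assert (T4 : 2 * (a * b) <= a * a + b * b)
        by (pose proof (Rle_0_sqr (a - b)) as Hsq; unfold Rsqr in Hsq; lra).
      assert (T5 : 2 * (a * b * Cmod d) <= Cmod d * (a * a + b * b)).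
      { replace (2 * (a * b * Cmod d))%R with (Cmod d * (2 * (a * b)))%R by ring.
        now apply Rmult_le_compat_l. }
      apply Rle_trans with ((1 + 6 * B) * (2 * (a * b * Cmod d)))%R.
      + replace (a * (b * Cmod d))%R with (a * b * Cmod d)%R in T1 by ring.
        replace ((1 + 6 * B) * (2 * (a * b * Cmod d)))%R
          with (2 * (a * b * Cmod d) + 2 * (6 * B * (a * b * Cmod d)))%R by ring. lra.
      + replace (Cmod d * (1 + 6 * B) * (a * a + b * b))%R
          with ((1 + 6 * B) * (Cmod d * (a * a + b * b)))%R by ring.
        apply Rmult_le_compat_l; lra.
    - intros t. unfold E. nra.
    - unfold E, D, V. rewrite E1, E2.
      replace (X2 0%R + - X2 0%R) with (RtoC 0) by ring.
      replace (Y2 0%R + - Y2 0%R) with (RtoC 0) by ring. rewrite Cmod_0. ring. }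
  unfold E in HE. assert (H0 : Cmod (D T) = 0%R) by nra.
  apply Cmod_eq_0 in H0. apply Ceq_minus. exact H0.
Qed.

Lemma wp_line_ode (p d : C) (t : R) : ~ hexT (p + RtoC t * d) ->
  rder (fun t => wp (p + RtoC t * d)) t (wpD1 (p + RtoC t * d) * d) /\
  rder (fun t => wpD1 (p + RtoC t * d)) t
    (6 * (wp (p + RtoC t * d) * wp (p + RtoC t * d)) * d).
Proof.
  intros H. split.
  - apply (rder_comp wp (fun t => p + RtoC t * d)); [now apply cder_wp|apply rder_line].
  - apply (rder_comp wpD1 (fun t => p + RtoC t * d)); [now apply cder_wpD1_wp|apply rder_line].
Qed.

(** The pole term has modulus 1 / |z|^2, and the regular part is at most K |z|^3. *)
Lemma wp_blowup (B : R) : exists r, (0 < r) /\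
  forall z : C, z <> 0 -> Cmod z < r -> B < Cmod (wp z).
Proof.
  pose proof varpi_pos as Hv. destruct wpreg_cubic as [K [HK Hreg]].
  set (M := (1 + Rabs B + K)%R). pose proof (Rabs_pos B) as HB. pose proof (Rle_abs B) as HB'.
  assert (HM : 1 <= M) by (unfold M; lra).
  exists (Rmin (/ M) (varpi / 2)). split; [apply Rmin_pos; [apply Rinv_0_lt_compat|]; lra|].
  intros z H0 Hz.
  destruct (Rmin_Rgt_l _ _ _ Hz) as [Hz1 Hz2].
  specialize (Hreg z ltac:(lra)).
  pose proof (proj1 (Cmod_gt_0 z) H0) as Hp.
  rewrite wp_wpreg. pose proof (Cmod_triangle_sub (1 / z ^ 2) (- wpreg z)) as T.
  replace (1 / z ^ 2 - - wpreg z) with (1 / z ^ 2 + wpreg z) in T by ring.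
  rewrite Cmod_opp, Cmod_div, Cmod_1, Cmod_pow in T by now apply Cpow_nz.
  set (r := Cmod z) in *.
  assert (Hr1 : r * M < 1).
  { apply Rmult_lt_reg_r with (/ M)%R; [apply Rinv_0_lt_compat; lra|].
    rewrite Rmult_assoc, Rinv_r by lra. lra. }
  assert (Hrle : r < 1) by nra.
  assert (H3 : r ^ 3 <= 1) by (simpl; assert (r * r <= 1) by nra; nra).
  assert (H4 : M <= 1 / r ^ 2).
  { apply Rmult_le_reg_r with (r ^ 2)%R; [apply pow_lt, Hp|].
    unfold Rdiv. rewrite Rmult_assoc, Rinv_l by (apply Rgt_not_eq, pow_lt, Hp). simpl.
    rewrite !Rmult_1_r. assert (M * (r * r) <= 1 * 1); [|lra].
    replace (M * (r * r))%R with ((r * M) * r)%R by ring. apply Rmult_le_compat; nra. }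
  assert (K * r ^ 3 <= K) by nra.
  unfold M in H4. lra.
Qed.

Lemma wp_unbounded_before_pole (p d : C) (T e B : R) : 0 < T -> 0 < e ->
  hexT (p + RtoC T * d) -> (forall t, 0 <= t < T -> ~ hexT (p + RtoC t * d)) ->
  ~ (forall t, 0 <= t < T -> T - e < t -> Cmod (wp (p + RtoC t * d)%C) <= B).
Proof.
  intros HT He H1 Hn HB. destruct (wp_blowup B) as [r [Hr Hb]].
  pose proof (Cmod_ge_0 d) as Hd.
  set (s := Rmin (Rmin (T / 2) (e / 2)) (r / (2 * (1 + Cmod d)))).
  assert (Hs : 0 < s) by (repeat apply Rmin_pos; try lra; apply Rdiv_lt_0_compat; lra).
  assert (HsT : s <= T / 2) by (eapply Rle_trans; apply Rmin_l).
  assert (Hse : s <= e / 2) by (eapply Rle_trans; [apply Rmin_l|apply Rmin_r]).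
  assert (Hsd : s * Cmod d < r).
  { apply Rle_lt_trans with (r / (2 * (1 + Cmod d)) * (1 + Cmod d))%R.
    - apply Rmult_le_compat; try lra. apply Rmin_r.
    - replace (r / (2 * (1 + Cmod d)) * (1 + Cmod d))%R with (r / 2)%R by (field; lra). lra. }
  specialize (HB (T - s)%R ltac:(lra) ltac:(lra)). specialize (Hn (T - s)%R ltac:(lra)).
  replace (p + RtoC (T - s) * d) with (- RtoC s * d + (p + RtoC T * d)) in HB, Hn
    by (rewrite RtoC_minus; ring).
  assert (Hns : ~ hexT (- RtoC s * d)) by (intros H; apply Hn; now apply hexT_plus).
  rewrite wp_periodic in HB by assumption.
  apply Rle_not_lt in HB. apply HB, Hb; [now apply nhexT_neq_0|].
  rewrite Cmod_mult, Cmod_opp, Cmod_R, Rabs_pos_eq; lra.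
Qed.

(** The second path ends at a regular point, near which wp is bounded by continuity; along the first
    one it is unbounded. *)
Lemma wp_coincidence_pole (p1 p2 d : C) (T : R) : 0 < T ->
  hexT (p1 + RtoC T * d) -> ~ hexT (p2 + RtoC T * d) ->
  (forall t, 0 <= t < T -> ~ hexT (p1 + RtoC t * d)) ->
  ~ (forall t, 0 <= t < T -> wp (p1 + RtoC t * d) = wp (p2 + RtoC t * d)).
Proof.
  intros HT H1 H2 Hn Heq.
  destruct (cder_ccont _ _ _ (cder_wp _ H2) (mkposreal 1 Rlt_0_1)) as [e He]. simpl in He.
  pose proof (Cmod_ge_0 d) as Hd.
  apply (wp_unbounded_before_pole p1 d T (e / (1 + Cmod d)) (Cmod (wp (p2 + RtoC T * d)) + 1));
    try assumption; [apply Rdiv_lt_0_compat; [apply cond_pos|lra]|].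
  intros t Ht Het. rewrite (Heq t Ht). specialize (He (- RtoC (T - t) * d)).
  replace (p2 + RtoC T * d + - RtoC (T - t) * d) with (p2 + RtoC t * d) in He
    by (rewrite RtoC_minus; ring).
  assert (Hlt : (T - t) * (1 + Cmod d) < e).
  { replace (pos e) with (e / (1 + Cmod d) * (1 + Cmod d))%R by (field; lra).
    apply Rmult_lt_compat_r; lra. }
  rewrite Cmod_mult, Cmod_opp, Cmod_R, Rabs_pos_eq in He by lra. specialize (He ltac:(nra)).
  pose proof (Cmod_triangle_sub (wp (p2 + RtoC t * d)) (wp (p2 + RtoC T * d))). lra.
Qed.

(** Two lattice points on the segment would differ by less than varpi. The disjunct d = 0 is the
    degenerate segment. *)
Lemma hexT_segment_unique (p d : C) (s t : R) : Cmod d < varpi ->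
  0 <= s <= 1 -> 0 <= t <= 1 -> s <> t ->
  hexT (p + RtoC s * d) -> ~ hexT (p + RtoC t * d) \/ d = 0.
Proof.
  intros Hd Hs Ht Hne H1. destruct (Ceq_dec d 0) as [|H0]; [now right|left]. intros H2.
  assert (H : hexT (RtoC (s - t) * d)).
  { replace (RtoC (s - t) * d) with ((p + RtoC s * d) - (p + RtoC t * d))
      by (rewrite RtoC_minus; ring). now apply hexT_minus. }
  apply hexT_separated in H.
  - rewrite Cmod_mult, Cmod_R in H. pose proof (proj1 (Cmod_gt_0 d) H0).
    assert (Rabs (s - t) <= 1) by (apply Rabs_le; lra). nra.
  - apply Cmult_neq_0; [|assumption]. intros E. apply RtoC_inj in E. lra.
Qed.

(** Along t -> p + t d the two solutions agree until one meets a pole. The second cannot meet one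
    before t = 1, where the first is still finite; nor can it be regular at t = 1, where the first
    blows up. *)
Lemma wp_initial_values (p1 p2 d : C) : ~ hexT p1 -> ~ hexT p2 ->
  wp p1 = wp p2 -> wpD1 p1 = wpD1 p2 -> Cmod d < varpi -> hexT (p1 + d) -> hexT (p2 + d).
Proof.
  intros Hp1 Hp2 Ew ES Hd H1. apply NNPP; intros H2.
  assert (Hd0 : d <> 0).
  { intros E. apply Hp1. replace p1 with (p1 + d) by (rewrite E; ring). assumption. }
  replace (p1 + d) with (p1 + RtoC 1 * d) in H1 by ring.
  replace (p2 + d) with (p2 + RtoC 1 * d) in H2 by ring.
  assert (Hn1 : forall t, 0 <= t < 1 -> ~ hexT (p1 + RtoC t * d)).
  { intros t Ht. destruct (hexT_segment_unique p1 d 1 t Hd) as [|]; (assumption || lra || contradiction). }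
  assert (Huniq : forall T, 0 <= T -> (forall t, 0 <= t <= T -> ~ hexT (p1 + RtoC t * d)) ->
            (forall t, 0 <= t <= T -> ~ hexT (p2 + RtoC t * d)) ->
            wp (p1 + RtoC T * d) = wp (p2 + RtoC T * d)).
  { intros T HT Ha Hb.
    apply (wp_ode_unique (fun t => wp (p1 + RtoC t * d)) (fun t => wpD1 (p1 + RtoC t * d))
             (fun t => wp (p2 + RtoC t * d)) (fun t => wpD1 (p2 + RtoC t * d)) d T HT).
    - intros t Ht; now apply wp_line_ode, Ha.
    - intros t Ht; now apply wp_line_ode, Hb.
    - now rewrite !Cmult_0_l, !Cplus_0_r.
    - now rewrite !Cmult_0_l, !Cplus_0_r. }
  destruct (classic (exists T, (0 <= T < 1) /\ hexT (p2 + RtoC T * d))) as [[T [HT HhT]]|Hno].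
  - assert (HT0 : 0 < T).
    { destruct (Req_dec T 0) as [->|]; [|lra]. elim Hp2.
      now rewrite Cmult_0_l, Cplus_0_r in HhT. }
    assert (Hn2 : forall t, 0 <= t < T -> ~ hexT (p2 + RtoC t * d)).
    { intros t Ht. destruct (hexT_segment_unique p2 d T t Hd) as [|]; (assumption || lra || contradiction). }
    apply (wp_coincidence_pole p2 p1 d T HT0 HhT); [apply Hn1; lra|assumption|].
    intros t Ht. symmetry. apply Huniq; [lra|..]; intros s Hs; [apply Hn1|apply Hn2]; lra.
  - assert (Hn2 : forall t, 0 <= t < 1 -> ~ hexT (p2 + RtoC t * d)).
    { intros t Ht Hh; apply Hno; exists t; auto. }
    apply (wp_coincidence_pole p1 p2 d 1); try assumption; [lra|].
    intros t Ht. apply Huniq; [lra|..]; intros s Hs; [apply Hn1|apply Hn2]; lra.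
Qed.

(** By uniqueness wp would agree with the zero solution on the way to a nearby pole, where it is
    unbounded. *)
Lemma wp_not_both_zero (p : C) : ~ hexT p -> wp p = 0 -> wpD1 p = 0 -> False.
Proof.
  intros Hp Ew ES. destruct (hexT_near p) as [w [Hw Hn]].
  set (d := w - p).
  assert (Hd : Cmod d < varpi) by (unfold d; now rewrite Cmod_minus_sym).
  assert (H1 : hexT (p + RtoC 1 * d)) by (unfold d; replace (p + 1 * (w - p)) with w by ring; assumption).
  assert (Hn1 : forall t, 0 <= t < 1 -> ~ hexT (p + RtoC t * d)).
  { intros t Ht. destruct (hexT_segment_unique p d 1 t Hd) as [|E]; (assumption || lra || idtac).
    rewrite E. now rewrite Cmult_0_r, Cplus_0_r. }
  assert (Hz : forall t, 0 <= t < 1 -> wp (p + RtoC t * d) = 0).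
  { intros t Ht.
    apply (wp_ode_unique (fun t => wp (p + RtoC t * d)) (fun t => wpD1 (p + RtoC t * d))
             (fun _ => 0) (fun _ => 0) d t); try lra.
    - intros s Hs; apply wp_line_ode, Hn1; lra.
    - intros s Hs. assert (H0 : rder (fun _ => 0) s 0).
      { intros eps; exists (mkposreal 1 Rlt_0_1); intros y _.
        replace (0 - 0 - RtoC y * 0) with (RtoC 0) by ring.
        rewrite Cmod_0. apply Rmult_le_pos; [left; apply cond_pos|apply Rabs_pos]. }
      split; [replace (0 * d) with (RtoC 0) by ring|replace (6 * (0 * 0) * d) with (RtoC 0) by ring];
        exact H0.
    - now rewrite Cmult_0_l, Cplus_0_r.
    - now rewrite Cmult_0_l, Cplus_0_r. }
  apply (wp_unbounded_before_pole p d 1 1 0); [lra|lra|assumption|assumption|].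
  intros t Ht _. rewrite (Hz t Ht), Cmod_0. lra.
Qed.

(** * The invariant g3 *)

(** The real part is taken to have a real number from the start. It loses nothing, since wp and wp'
    are real at varpi/3 by conjugation symmetry. *)
Definition g3 : R := (- fst (wp_energy (RtoC (varpi / 3))))%R.

Lemma real_nhexT (t : R) : 0 < t < varpi -> ~ hexT (RtoC t).
Proof.
  intros Ht. apply punctured_disc.
  - intros E; apply RtoC_inj in E; lra.
  - rewrite Cmod_R, Rabs_pos_eq; lra.
Qed.

Lemma conj_eq_real (z : C) : Cconj z = z -> snd z = 0%R.
Proof. intros E. apply (f_equal snd) in E. simpl in E. lra. Qed.

Lemma wp_real (t : R) : 0 < t < varpi -> snd (wp (RtoC t)) = 0%R.
Proof.
  intros Ht. apply conj_eq_real. rewrite <- wp_conj by now apply real_nhexT.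
  now rewrite RtoC_conj.
Qed.

Lemma wpD1_real (t : R) : 0 < t < varpi -> snd (wpD1 (RtoC t)) = 0%R.
Proof.
  intros Ht. apply conj_eq_real. rewrite <- wpD1_conj by now apply real_nhexT.
  now rewrite RtoC_conj.
Qed.

Lemma wp_cubic (z : C) : ~ hexT z -> wpD1 z * wpD1 z = 4 * (wp z * (wp z * wp z)) - RtoC g3.
Proof.
  intros Hz. pose proof (wp_energy_const z Hz) as E.
  assert (H : wp_energy (RtoC (varpi / 3)) = - RtoC g3).
  { pose proof varpi_pos as Hv. unfold g3.
    pose proof (wp_real (varpi / 3) ltac:(lra)) as H1. pose proof (wpD1_real (varpi / 3) ltac:(lra)) as H2.
    unfold wp_energy. revert H1 H2.
    generalize (wp (RtoC (varpi / 3))) (wpD1 (RtoC (varpi / 3))). intros X Y H1 H2.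
    apply injective_projections; simpl; rewrite ?H1, ?H2; ring. }
  rewrite H in E. unfold wp_energy in E. replace (RtoC g3) with (- - RtoC g3) by ring. rewrite <- E. ring.
Qed.

(* At c = i varpi / sqrt 3 rotation by rho^2 is a translation, so wp c = 0, and wp' c is
   purely imaginary; it is nonzero since otherwise wp would vanish identically. *)
Lemma g3_pos : 0 < g3.
Proof.
  pose proof varpi_pos as Hv. pose proof sqrt3_pos as Hs. pose proof sqrt3_sq as Hs2.
  set (c := (0%R, (varpi / sqrt 3)%R) : C).
  assert (Hcm : (Cmod c * Cmod c = varpi * varpi / 3)%R).
  { rewrite Cmod_sq. simpl. rewrite <- Hs2 at 3. field. lra. }
  assert (Hc : ~ hexT c).
  { apply punctured_disc.
    - intros E. apply (f_equal snd) in E. simpl in E.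
      assert (0 < varpi / sqrt 3) by now apply Rdiv_lt_0_compat. lra.
    - pose proof (Cmod_ge_0 c). nra. }
  assert (Hrot : rho * (rho * c) = c + - (rho * varpi)).
  { unfold c. rewrite rho_eq. apply injective_projections; simpl; field_simplify_eq; try lra.
    replace (sqrt 3 ^ 2)%R with 3%R by (simpl; lra). ring. }
  assert (Hw : wp c = 0).
  { assert (E : wp (rho * (rho * c)) = wp c).
    { rewrite Hrot. apply wp_periodic; [assumption|]. apply hexT_opp, hexT_rho, hexT_varpi. }
    rewrite !wp_rho in E by auto using nhexT_rho.
    rewrite inv_rho_pow2 in E.
    replace (- rho * (- rho * wp c)) with (rho * rho * wp c) in E by ring.
    rewrite rho_sq in E.
    assert (E2 : (rho - 2) * wp c = 0).
    { replace ((rho - 2) * wp c) with ((rho - 1) * wp c - wp c) by ring. rewrite E. ring. }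
    destruct (Ceq_dec (wp c) 0) as [|Hne]; [assumption|]. exfalso.
    apply (Cmult_neq_0 (rho - 2) (wp c)); [|assumption|assumption].
    rewrite rho_eq. intros E3. apply (f_equal fst) in E3. simpl in E3. lra. }
  pose proof (wp_cubic c Hc) as E. rewrite Hw in E.
  assert (Hconj : Cconj (wpD1 c) = - wpD1 c).
  { rewrite <- wpD1_conj, <- wpD1_opp by assumption. f_equal.
    unfold c. apply injective_projections; simpl; ring. }
  remember (wpD1 c) as y eqn:Hy.
  assert (Hre : fst y = 0%R) by (apply (f_equal fst) in Hconj; simpl in Hconj; lra).
  pose proof (f_equal fst E) as E1. simpl in E1. rewrite Hre in E1.
  destruct (Req_dec (snd y) 0) as [H0|H0].
  - exfalso. apply (wp_not_both_zero c Hc Hw). rewrite <- Hy.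
    apply injective_projections; assumption.
  - assert (0 < snd y * snd y) by nra. lra.
Qed.

(** * The real period *)

Open Scope R_scope.

Lemma constant_of_is_derive_0 (f : R -> R) (a b s t : R) :
  (forall t, a < t < b -> is_derive f t 0) -> a < s < b -> a < t < b -> f s = f t.
Proof.
  intros H Hs Ht. destruct (Rtotal_order s t) as [Hst|[->|Hst]]; [| reflexivity |symmetry];
    (apply (eq_is_derive (V := R_NormedModule) f); [|assumption]); intros r Hr; apply H; lra.
Qed.

(** The time that the flow u' = v^2 on v^3 = 1 + u^3 takes from 0 to u. *)
Definition fermatPhi (u : R) : R := RInt (fun s => Rpower (1 + s ^ 3) (- 2 / 3)) 0 u.

Lemma continuous_fermat (u : R) : -1 < u -> continuous (fun s => Rpower (1 + s ^ 3) (- 2 / 3)) u.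
Proof.
  intros Hu. apply ex_derive_cont. now apply ex_derive_Rpower_cube.
Qed.

Lemma ex_RInt_fermat (a b : R) : -1 < a -> -1 < b ->
  ex_RInt (fun s => Rpower (1 + s ^ 3) (- 2 / 3)) a b.
Proof.
  intros Ha Hb. apply ex_RInt_cont.
  intros s Hs. apply continuous_fermat. eapply Rlt_le_trans; [|apply Hs]. now apply Rmin_glb_lt.
Qed.

Lemma is_derive_fermatPhi (u : R) : -1 < u -> is_derive fermatPhi u (/ cbrt1 u ^ 2).
Proof.
  intros Hu. rewrite <- Rpower_cbrt1 by assumption.
  apply (is_derive_RInt (V := R_NormedModule) (fun s => Rpower (1 + s ^ 3) (- 2 / 3)) fermatPhi 0);
    [|now apply continuous_fermat].
  assert (He : 0 < u + 1) by lra.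
  exists (mkposreal _ He). intros b Hb.
  apply (RInt_correct (V := R_CompleteNormedModule)), ex_RInt_fermat; [lra|].
  apply Rabs_def2 in Hb. unfold minus, plus, opp in Hb; simpl in Hb. lra.
Qed.

Lemma fermatPhi_bounds (u : R) : 0 <= u -> 0 <= fermatPhi u <= u.
Proof.
  intros Hu. unfold fermatPhi.
  assert (Hb : forall s, 0 < s -> 0 <= Rpower (1 + s ^ 3) (- 2 / 3) <= 1).
  { intros s Hs. split; [left; apply exp_pos|].
    rewrite Rpower_cbrt1, <- Rinv_1 by lra. apply Rinv_le_contravar; [lra|].
    pose proof (cbrt1_cube s ltac:(lra)). pose proof (cbrt1_pos s).
    assert (0 < s ^ 3) by (apply pow_lt; lra).
    assert (1 <= cbrt1 s); [|nra].
    apply Rnot_lt_le; intros Hlt. assert (cbrt1 s * cbrt1 s < 1) by nra. simpl in H. nra. }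
  split.
  - apply RInt_ge_0; [assumption|apply ex_RInt_fermat; lra|]. intros s Hs; apply Hb; lra.
  - replace u with (RInt (fun _ => 1) 0 u) at 2
      by (rewrite RInt_const; unfold scal; simpl; unfold mult; simpl; ring).
    apply RInt_le; [assumption|apply ex_RInt_fermat; lra|apply ex_RInt_const|].
    intros s Hs; apply Hb; lra.
Qed.

Lemma pow3_inj (a b : R) : a ^ 3 = b ^ 3 -> a = b.
Proof.
  intros H. assert (E : (a - b) * (a * a + a * b + b * b) = 0) by (simpl in H; nra).
  apply Rmult_integral in E as [E|E]; [lra|].
  assert (a + b / 2 = 0 /\ b = 0) as [H1 H2]; [|lra].
  assert (E' : (a + b / 2) * (a + b / 2) + 3 / 4 * (b * b) = 0) by lra.
  pose proof (Rle_0_sqr (a + b / 2)) as S1. pose proof (Rle_0_sqr b) as S2.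
  unfold Rsqr in S1, S2. split; [|nra]. nra.
Qed.

Lemma cbrt1_unique (u v : R) : -1 < u -> v ^ 3 = 1 + u ^ 3 -> v = cbrt1 u.
Proof. intros Hu H. apply pow3_inj. now rewrite cbrt1_cube. Qed.

(** The substitution s -> 1/s maps (1 + s^3)^(-2/3) ds to its negative, so the sum is constant, and
    u = 1 gives its value. It plays the part of the improper integral: the total time from 0 to
    infinity is 2 I. *)
Lemma fermatPhi_inv (u : R) : 0 < u -> fermatPhi u + fermatPhi (/ u) = 2 * fermatI.
Proof.
  intros Hu.
  assert (H1 : fermatPhi 1 + fermatPhi (/ 1) = 2 * fermatI).
  { rewrite Rinv_1. unfold fermatPhi, fermatI. ring. }
  assert (Hd : forall s, 0 < s -> is_derive (fun u => fermatPhi u + fermatPhi (/ u)) s 0).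
  { intros s Hs. assert (Hi : 0 < / s) by now apply Rinv_0_lt_compat. evar_last.
    - apply (is_derive_plus (V := R_NormedModule) fermatPhi (fun u => fermatPhi (/ u))).
      + apply is_derive_fermatPhi; lra.
      + apply (is_derive_comp (V := R_NormedModule) fermatPhi (fun u => / u)).
        * apply is_derive_fermatPhi; lra.
        * auto_derive; [lra|reflexivity].
    - rewrite <- (cbrt1_unique (/ s) (cbrt1 s / s)).
      + unfold plus, scal; simpl; unfold mult; simpl. pose proof (cbrt1_pos s). field. lra.
      + lra.
      + unfold Rdiv. rewrite Rpow_mult_distr, cbrt1_cube by lra. rewrite pow_inv. field. lra. }
  rewrite <- H1.
  apply (constant_of_is_derive_0 (fun u => fermatPhi u + fermatPhi (/ u)) 0 (u + 2)); try lra.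
  intros t Ht; apply Hd; lra.
Qed.

(** [fermatPhi (U t) - c t] is constant on (a, b), while [U] runs from 0 to infinity. The ends enter
    only through limits, because U has a pole at b. *)
Lemma fermat_transit_time (U V : R -> R) (c a b : R) : 0 < c -> a < b ->
  (forall t, a < t < b -> is_derive U t (c * V t ^ 2) /\ 0 < U t /\ V t ^ 3 = 1 + U t ^ 3) ->
  (forall e, 0 < e -> exists d, 0 < d /\ forall t, a < t < b -> t < a + d -> U t < e) ->
  (forall M, exists d, 0 < d /\ forall t, a < t < b -> b - d < t -> M < U t) ->
  c * (b - a) = 2 * fermatI.
Proof.
  intros Hc Hab H Ha Hb.
  assert (Hd : forall t, a < t < b -> is_derive (fun t => fermatPhi (U t) - c * t) t 0).
  { intros t Ht. destruct (H t Ht) as [H1 [H2 H3]].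
    pose proof (cbrt1_unique (U t) (V t) ltac:(lra) H3) as HV. evar_last.
    - apply (is_derive_minus (V := R_NormedModule) (fun t => fermatPhi (U t)) (fun t => c * t)).
      + apply (is_derive_comp (V := R_NormedModule) fermatPhi U); [|exact H1].
        apply is_derive_fermatPhi; lra.
      + auto_derive; [auto|reflexivity].
    - rewrite <- HV. unfold minus, plus, opp, scal; simpl; unfold mult; simpl.
      pose proof (cbrt1_pos (U t)). field. lra. }
  assert (Hconst : forall s t, a < s < b -> a < t < b ->
            fermatPhi (U s) - c * s = fermatPhi (U t) - c * t).
  { intros s t Hs Ht.
    exact (constant_of_is_derive_0 (fun t => fermatPhi (U t) - c * t) a b s t Hd Hs Ht). }
  apply cond_eq. intros e He.
  destruct (Ha (e / 4) ltac:(lra)) as [d1 [Hd1 H1]].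
  destruct (Hb (4 / e)) as [d2 [Hd2 H2]].
  (* The ends are approached to within w/2. Each of the three errors is at most e/4: [fermatPhi (U)]
     near a, [fermatPhi (1/U)] near b, and the missing time c w. *)
  set (w := Rmin (Rmin d1 d2) (Rmin (b - a) (e / (4 * c)))).
  assert (Hw : 0 < w).
  { repeat apply Rmin_pos; try lra. apply Rdiv_lt_0_compat; lra. }
  assert (Hw1 : w <= d1) by (eapply Rle_trans; apply Rmin_l).
  assert (Hw2 : w <= d2) by (eapply Rle_trans; [apply Rmin_l|apply Rmin_r]).
  assert (Hw3 : w <= b - a) by (eapply Rle_trans; [apply Rmin_r|apply Rmin_l]).
  assert (Hw4 : c * w <= e / 4).
  { replace (e / 4) with (c * (e / (4 * c))) by (field; lra).
    apply Rmult_le_compat_l; [lra|]. eapply Rle_trans; apply Rmin_r. }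
  assert (Hs : a < a + w / 2 < b) by lra. assert (Ht : a < b - w / 2 < b) by lra.
  specialize (H1 _ Hs ltac:(lra)). specialize (H2 _ Ht ltac:(lra)).
  pose proof (Hconst _ _ Hs Ht) as E.
  destruct (H _ Hs) as [_ [Us _]]. destruct (H _ Ht) as [_ [Ut _]].
  pose proof (fermatPhi_bounds (U (a + w / 2)) ltac:(lra)) as B1.
  pose proof (fermatPhi_inv (U (b - w / 2)) Ut) as B2.
  assert (Hui : 0 < / U (b - w / 2)) by now apply Rinv_0_lt_compat.
  pose proof (fermatPhi_bounds (/ U (b - w / 2)) ltac:(lra)) as B3.
  assert (B4 : / U (b - w / 2) < e / 4).
  { replace (e / 4) with (/ (4 / e)) by (field; lra). apply Rinv_lt_contravar; [|assumption].
    apply Rmult_lt_0_compat; [apply Rdiv_lt_0_compat|]; lra. }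
  assert (B5 : c * (b - a) = c * (b - w / 2) - c * (a + w / 2) + c * w) by field.
  assert (0 < c * w) by now apply Rmult_lt_0_compat.
  rewrite B5. apply Rabs_def1; lra.
Qed.

Definition wpR (t : R) : R := fst (wp (RtoC t)).
Definition dwpR (t : R) : R := fst (wpD1 (RtoC t)).

Lemma rder_RtoC (t : R) : rder RtoC t 1.
Proof.
  intros eps; exists (mkposreal 1 Rlt_0_1); intros s _.
  replace (RtoC (t + s) - RtoC t - RtoC s * 1)%C with (RtoC 0) by (rewrite RtoC_plus; ring).
  rewrite Cmod_0. apply Rmult_le_pos; [left; apply cond_pos|apply Rabs_pos].
Qed.

Lemma wp_wpR (t : R) : 0 < t < varpi -> wp (RtoC t) = RtoC (wpR t).
Proof. intros Ht. apply injective_projections; [reflexivity|now apply wp_real]. Qed.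

Lemma wpD1_dwpR (t : R) : 0 < t < varpi -> wpD1 (RtoC t) = RtoC (dwpR t).
Proof. intros Ht. apply injective_projections; [reflexivity|now apply wpD1_real]. Qed.

Lemma is_derive_wpR (t : R) : 0 < t < varpi -> is_derive wpR t (dwpR t).
Proof.
  intros Ht. evar_last.
  - apply (rder_fst (fun t => wp (RtoC t))), (rder_comp wp RtoC); [|apply rder_RtoC].
    now apply cder_wp, real_nhexT.
  - rewrite wpD1_dwpR by assumption. simpl; ring.
Qed.

Lemma is_derive_dwpR (t : R) : 0 < t < varpi -> is_derive dwpR t (6 * wpR t ^ 2).
Proof.
  intros Ht. evar_last.
  - apply (rder_fst (fun t => wpD1 (RtoC t))), (rder_comp wpD1 RtoC); [|apply rder_RtoC].
    now apply cder_wpD1_wp, real_nhexT.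
  - rewrite wp_wpR by assumption. simpl; ring.
Qed.

Lemma wpR_dwpR_cubic (t : R) : 0 < t < varpi -> dwpR t ^ 2 = 4 * wpR t ^ 3 - g3.
Proof.
  intros Ht. pose proof (wp_cubic (RtoC t) (real_nhexT t Ht)) as E.
  rewrite wp_wpR, wpD1_dwpR in E by assumption. apply (f_equal fst) in E. simpl in E. simpl. lra.
Qed.

Lemma wpR_pos (t : R) : 0 < t < varpi -> 0 < wpR t.
Proof.
  intros Ht. pose proof (wpR_dwpR_cubic t Ht) as E. pose proof g3_pos. apply Rnot_le_lt; intros H0.
  assert (wpR t ^ 3 <= 0); [|nra]. simpl. assert (0 <= wpR t * wpR t) by nra. nra.
Qed.

Lemma dwpR_symm (t : R) : 0 < t < varpi -> dwpR (varpi - t) = - dwpR t.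
Proof.
  intros Ht. pose proof (real_nhexT t Ht) as Hn. unfold dwpR.
  replace (RtoC (varpi - t)) with (- RtoC t + varpi)%C by (rewrite RtoC_minus; ring).
  rewrite wpD1_periodic, wpD1_opp; auto using hexT_varpi, nhexT_opp.
Qed.

Lemma dwpR_increasing (s t : R) : 0 < s -> s < t -> t < varpi -> dwpR s < dwpR t.
Proof.
  intros Hs Hst Ht.
  destruct (MVT_gen dwpR s t (fun t => 6 * wpR t ^ 2)) as [c [Hc E]];
    rewrite ?Rmin_left, ?Rmax_right in * by lra.
  - intros r Hr; apply is_derive_dwpR; lra.
  - intros r Hr. eapply is_derive_continuity_pt, is_derive_dwpR; lra.
  - pose proof (wpR_pos c ltac:(lra)). assert (0 < 6 * wpR c ^ 2) by nra. nra.
Qed.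

Lemma dwpR_half : dwpR (varpi / 2) = 0.
Proof.
  pose proof varpi_pos. pose proof (dwpR_symm (varpi / 2) ltac:(lra)) as E.
  replace (varpi - varpi / 2) with (varpi / 2) in E by field. lra.
Qed.

Lemma wpR_blowup (M : R) : exists d, 0 < d /\ forall t, 0 < t < varpi -> varpi - d < t -> M < wpR t.
Proof.
  destruct (wp_blowup M) as [r [Hr Hb]]. exists r; split; [assumption|]. intros t Ht Hd.
  assert (E : wp (RtoC t) = wp (RtoC (varpi - t))).
  { replace (RtoC (varpi - t)) with (- RtoC t + varpi)%C by (rewrite RtoC_minus; ring).
    pose proof (real_nhexT t Ht).
    rewrite wp_periodic, wp_opp; auto using hexT_varpi, nhexT_opp. }
  assert (H : M < Cmod (wp (RtoC (varpi - t)))).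
  { apply Hb.
    - intros H. apply RtoC_inj in H. lra.
    - rewrite Cmod_R, Rabs_pos_eq; lra. }
  rewrite <- E, wp_wpR, Cmod_R, Rabs_pos_eq in H by (assumption || (left; now apply wpR_pos)). exact H.
Qed.

(** * Fermat coordinates and the thirds of the period *)

(** The scale factor k: if P is the function with invariants 0 and 1, then k^2 P(k z) has g3 =
    k^6. *)
Definition g3root : R := Rpower g3 (1 / 6).

Lemma g3root_pos : 0 < g3root.
Proof. apply exp_pos. Qed.

Lemma g3root_pow6 : g3root ^ 6 = g3.
Proof.
  rewrite <- (Rpower_pow 6 g3root g3root_pos). unfold g3root. rewrite Rpower_mult.
  simpl (INR 6). replace (1 / 6 * (1 + 1 + 1 + 1 + 1 + 1)) with 1 by field.
  apply Rpower_1, g3_pos.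
Qed.

Definition fermatU (t : R) : R := (dwpR t - sqrt 3 * g3root ^ 3) / (2 * sqrt 3 * g3root * wpR t).
Definition fermatV (t : R) : R := (dwpR t + sqrt 3 * g3root ^ 3) / (2 * sqrt 3 * g3root * wpR t).

Lemma sqrt3_pow : sqrt 3 ^ 2 = 3.
Proof. simpl. pose proof sqrt3_sq; lra. Qed.

(* The curve y^2 = 4 x^3 - k^6 is the Fermat cubic in these coordinates,
   because (y + s)^3 - (y - s)^3 = 2 s (3 y^2 + s^2) for s = sqrt 3 k^3. *)
Lemma fermatUV_cubic (t : R) : 0 < t < varpi -> fermatV t ^ 3 = 1 + fermatU t ^ 3.
Proof.
  intros Ht. pose proof (wpR_pos t Ht) as Hx. pose proof (wpR_dwpR_cubic t Ht) as E.
  pose proof sqrt3_pos as Hs. pose proof g3root_pos as Hk. pose proof sqrt3_pow as H3.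
  rewrite <- g3root_pow6 in E. unfold fermatU, fermatV.
  set (s := sqrt 3) in *. set (k := g3root) in *. set (x := wpR t) in *. set (y := dwpR t) in *.
  assert (H : (y + s * k ^ 3) ^ 3 = (2 * s * k * x) ^ 3 + (y - s * k ^ 3) ^ 3).
  { replace ((2 * s * k * x) ^ 3) with (2 * (s * s ^ 2) * k ^ 3 * (4 * x ^ 3)) by ring.
    replace (4 * x ^ 3) with (y ^ 2 + k ^ 6) by lra.
    replace ((y + s * k ^ 3) ^ 3)
      with ((y - s * k ^ 3) ^ 3 + 2 * s * k ^ 3 * (3 * y ^ 2 + s ^ 2 * k ^ 6)) by ring.
    rewrite H3. ring. }
  unfold Rdiv. rewrite !Rpow_mult_distr, H, <- Rpow_mult_distr. rewrite !pow_inv. field.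
  repeat split; lra.
Qed.

(** Only s^2 is prescribed, so one computation serves both coordinates: s = sqrt 3 k^3 gives the
    derivative of u, and its negative that of v. It rests on the identity 2 (6 x^3 - (y - s) y) = (y
    + s)^2, valid on the curve. *)
Lemma is_derive_fermat_coordinate (s t : R) : 0 < t < varpi -> s ^ 2 = 3 * g3 ->
  is_derive (fun t => (dwpR t - s) / (2 * sqrt 3 * g3root * wpR t)) t
    (sqrt 3 * g3root * ((dwpR t + s) / (2 * sqrt 3 * g3root * wpR t)) ^ 2).
Proof.
  intros Ht H3. pose proof (wpR_pos t Ht) as Hx. pose proof (wpR_dwpR_cubic t Ht) as E.
  pose proof sqrt3_pos as Hs. pose proof g3root_pos as Hk. evar_last.
  - apply is_derive_div.
    + apply (is_derive_minus (V := R_NormedModule) dwpR (fun _ => s));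
        [now apply is_derive_dwpR | apply (is_derive_const (V := R_NormedModule))].
    + apply is_derive_scal. now apply is_derive_wpR.
    + apply Rgt_not_eq. repeat apply Rmult_lt_0_compat; lra.
  - unfold minus, plus, opp, zero; simpl.
    set (q := sqrt 3) in *. set (x := wpR t) in *. set (y := dwpR t) in *.
    assert (H : 2 * (6 * x ^ 2 * x - (y - s) * y) = (y + s) ^ 2).
    { replace (2 * (6 * x ^ 2 * x - (y - s) * y))
        with (3 * (4 * x ^ 3) - 2 * y ^ 2 + 2 * s * y) by ring.
      replace (4 * x ^ 3) with (y ^ 2 + g3) by lra.
      replace ((y + s) ^ 2) with (y ^ 2 + 2 * s * y + s ^ 2) by ring. rewrite H3. ring. }
    transitivity ((y + s) ^ 2 / (4 * q * g3root * x ^ 2)).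
    + rewrite <- H. field. repeat split; lra.
    + field. repeat split; lra.
Qed.

Lemma sqrt3_kk3_sq : (sqrt 3 * g3root ^ 3) ^ 2 = 3 * g3.
Proof. rewrite <- g3root_pow6, Rpow_mult_distr, sqrt3_pow. ring. Qed.

Lemma is_derive_fermatU (t : R) : 0 < t < varpi -> is_derive fermatU t (sqrt 3 * g3root * fermatV t ^ 2).
Proof. intros Ht. apply is_derive_fermat_coordinate; [assumption|apply sqrt3_kk3_sq]. Qed.

Lemma is_derive_fermatV (t : R) : 0 < t < varpi -> is_derive fermatV t (sqrt 3 * g3root * fermatU t ^ 2).
Proof.
  intros Ht. unfold fermatV, fermatU, Rminus.
  apply is_derive_ext with (fun t => (dwpR t - - (sqrt 3 * g3root ^ 3)) / (2 * sqrt 3 * g3root * wpR t)).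
  - intros s. unfold Rminus. now rewrite Ropp_involutive.
  - apply is_derive_fermat_coordinate; [assumption|]. rewrite <- sqrt3_kk3_sq. ring.
Qed.

(* The automorphism (u, v) -> (-v/u, -1/u) of the Fermat cubic preserves the flow. *)
Lemma is_derive_fermatVU (t : R) : 0 < t < varpi -> fermatU t <> 0 ->
  is_derive (fun t => - fermatV t / fermatU t) t (sqrt 3 * g3root * (- / fermatU t) ^ 2).
Proof.
  intros Ht Hu. pose proof (fermatUV_cubic t Ht) as E. evar_last.
  - apply is_derive_div; [|now apply is_derive_fermatU|assumption].
    apply (is_derive_opp (V := R_NormedModule)). now apply is_derive_fermatV.
  - unfold opp; simpl.
    transitivity (sqrt 3 * g3root * (fermatV t ^ 3 - fermatU t ^ 3) / fermatU t ^ 2); [simpl; field; assumption|].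
    rewrite E. field. assumption.
Qed.

(** On the right half of the period y starts from 0 and grows beyond all bounds, since y^2 = 4 x^3 -
    g3 and x blows up. *)
Lemma dwpR_takes_value (c : R) : 0 < c -> exists t, varpi / 2 < t < varpi /\ dwpR t = c.
Proof.
  intros Hc. pose proof varpi_pos as Hv. pose proof g3_pos as Hg.
  destruct (wpR_blowup (1 + g3 + c ^ 2)) as [d [Hd H]].
  set (b := varpi - Rmin d (varpi / 2) / 2).
  assert (H1 : 0 < Rmin d (varpi / 2)) by (apply Rmin_pos; lra).
  assert (H2 : Rmin d (varpi / 2) <= d) by apply Rmin_l.
  assert (H3 : Rmin d (varpi / 2) <= varpi / 2) by apply Rmin_r.
  assert (Hb : varpi / 2 < b < varpi) by (unfold b; lra).
  specialize (H b ltac:(lra) ltac:(unfold b; lra)).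
  pose proof (wpR_dwpR_cubic b ltac:(lra)) as E.
  assert (Hyb : c < dwpR b).
  { pose proof (dwpR_increasing (varpi / 2) b ltac:(lra) ltac:(lra) ltac:(lra)) as Hi.
    rewrite dwpR_half in Hi.
    assert (0 <= c ^ 2) by (apply pow2_ge_0).
    assert (wpR b <= wpR b ^ 3) by (simpl; assert (1 <= wpR b * wpR b) by nra; nra).
    assert (c ^ 2 < dwpR b ^ 2) by lra. simpl in *. nra. }
  destruct (IVT_interv (fun t => dwpR t - c) (varpi / 2) b) as [z [Hz Ez]].
  - intros a Ha. eapply is_derive_continuity_pt.
    apply (is_derive_minus (V := R_NormedModule) dwpR (fun _ => c)).
    + apply is_derive_dwpR; lra.
    + apply (is_derive_const (V := R_NormedModule)).
  - lra.
  - rewrite dwpR_half; lra.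
  - lra.
  - exists z. destruct (Req_dec z (varpi / 2)) as [->|Hne].
    + rewrite dwpR_half in Ez; lra.
    + split; lra.
Qed.

Lemma is_derive_small (f : R -> R) (a l : R) : is_derive f a l -> f a = 0 ->
  forall e, 0 < e -> exists d, 0 < d /\ forall t, Rabs (t - a) < d -> Rabs (f t) < e.
Proof.
  intros H H0 e He.
  destruct (proj2 (continuity_pt_filterlim f a)
              (ex_derive_cont f a (ex_intro _ l H)) e He) as [d [Hd Hcd]].
  exists d; split; [assumption|]. intros t Ht. destruct (Req_dec t a) as [->|Hne].
  - rewrite H0, Rabs_R0; assumption.
  - specialize (Hcd t). simpl in Hcd. unfold R_dist in Hcd. rewrite H0, Rminus_0_r in Hcd.
    apply Hcd. split; [split; [exact I|auto]|assumption].
Qed.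

(** Here u vanishes at t1 and v at t0 = varpi - t1. Two transits suffice: (u, v) crosses (t1,
    varpi), and (-v/u, -1/u) crosses (t0, t1), both in time 2 I / c. The remaining piece (0, t0) has
    the length of (t1, varpi) by the symmetry t -> varpi - t, so all three are equal. *)
Lemma period_thirds : dwpR (2 * varpi / 3) = sqrt 3 * g3root ^ 3 /\ sqrt 3 * g3root * (varpi / 3) = 2 * fermatI.
Proof.
  pose proof varpi_pos as Hv. pose proof sqrt3_pos as Hs. pose proof g3root_pos as Hk.
  set (s := sqrt 3 * g3root ^ 3). set (c := sqrt 3 * g3root).
  assert (Hk3 : 0 < g3root ^ 3) by (apply pow_lt, Hk).
  assert (Hs0 : 0 < s) by (apply Rmult_lt_0_compat; assumption).
  assert (Hc : 0 < c) by (apply Rmult_lt_0_compat; assumption).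
  destruct (dwpR_takes_value s Hs0) as [t1 [Ht1 Ey1]].
  assert (Hden : forall t, 0 < t < varpi -> 0 < 2 * sqrt 3 * g3root * wpR t).
  { intros t Ht. pose proof (wpR_pos t Ht). repeat apply Rmult_lt_0_compat; lra. }
  set (t0 := varpi - t1). assert (Ht0 : 0 < t0 < varpi) by (unfold t0; lra).
  assert (Ey0 : dwpR t0 = - s) by (unfold t0; rewrite dwpR_symm, Ey1 by lra; reflexivity).
  assert (Hu1 : fermatU t1 = 0) by (unfold fermatU; rewrite Ey1; fold s; unfold Rdiv; rewrite Rminus_diag; ring).
  assert (Hv0 : fermatV t0 = 0).
  { unfold fermatV; rewrite Ey0; fold s. replace (- s + s) with 0 by ring. unfold Rdiv; ring. }
  assert (Hv1 : fermatV t1 = 1).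
  { apply pow3_inj. rewrite fermatUV_cubic, Hu1 by lra. ring. }
  assert (Hu0 : fermatU t0 = -1).
  { apply pow3_inj. pose proof (fermatUV_cubic t0 ltac:(lra)) as E. rewrite Hv0 in E. simpl in *; lra. }
  assert (L : c * (varpi - t1) = 2 * fermatI).
  { apply (fermat_transit_time fermatU fermatV); [assumption|lra| | |].
    - intros t Ht. split; [apply is_derive_fermatU; lra|]. split; [|apply fermatUV_cubic; lra].
      apply Rdiv_lt_0_compat; [|apply Hden; lra].
      pose proof (dwpR_increasing t1 t ltac:(lra) ltac:(lra) ltac:(lra)). fold s; lra.
    - intros e He. destruct (is_derive_small fermatU t1 _ (is_derive_fermatU t1 ltac:(lra)) Hu1 e He) as [d [Hd H]].
      exists d; split; [assumption|]. intros t Ht Htd.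
      eapply Rle_lt_trans; [apply Rle_abs|]. apply H. apply Rabs_def1; lra.
    (* Divergence is shown for v first: y^2 >= 3 x^3 for large x, so v^2 >= y^2 / (12 k^2 x^2) >= x
       / (4 k^2) > m^2. If u <= M held, then v^3 = 1 + u^3 <= 1 + (m - 1)^3 <= m^3, a
       contradiction. *)
    - intros M. set (m := 1 + Rabs M). pose proof (Rabs_pos M). pose proof (Rle_abs M).
      destruct (wpR_blowup (1 + g3 + 4 * g3root ^ 2 * m ^ 2)) as [d [Hd Hbig]].
      exists d; split; [assumption|]. intros t Ht Htd.
      assert (Ht' : 0 < t < varpi) by lra. specialize (Hbig t Ht' ltac:(lra)).
      pose proof (wpR_dwpR_cubic t Ht') as E. pose proof g3_pos as Hg.
      pose proof (dwpR_increasing t1 t ltac:(lra) ltac:(lra) ltac:(lra)) as Hy.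
      assert (Hkm : 0 <= 4 * g3root ^ 2 * m ^ 2).
      { apply Rmult_le_pos; [|apply pow2_ge_0]. apply Rmult_le_pos; [lra|apply pow2_ge_0]. }
      set (x := wpR t) in *. set (y := dwpR t) in *.
      assert (Hx3 : x <= x ^ 3) by (simpl; assert (1 <= x * x) by nra; nra).
      assert (Hy2 : 3 * x ^ 3 <= y ^ 2) by lra.
      assert (Hv2 : m ^ 2 < fermatV t ^ 2).
      { unfold fermatV. fold x y s. unfold Rdiv. rewrite Rpow_mult_distr, pow_inv.
        replace ((2 * sqrt 3 * g3root * x) ^ 2) with (12 * g3root ^ 2 * x ^ 2)
          by (rewrite !Rpow_mult_distr, sqrt3_pow; ring).
        assert (Hk2 : 0 < g3root ^ 2) by (apply pow_lt; lra).
        assert (Hx2 : 0 < x ^ 2) by (apply pow_lt; lra).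
        apply Rmult_lt_reg_r with (12 * g3root ^ 2 * x ^ 2); [repeat apply Rmult_lt_0_compat; lra|].
        replace ((y + s) ^ 2 * / (12 * g3root ^ 2 * x ^ 2) * (12 * g3root ^ 2 * x ^ 2)) with ((y + s) ^ 2)
          by (field; split; lra).
        apply Rlt_le_trans with (3 * x ^ 3).
        - replace (m ^ 2 * (12 * g3root ^ 2 * x ^ 2)) with (3 * x ^ 2 * (4 * g3root ^ 2 * m ^ 2)) by ring.
          replace (3 * x ^ 3) with (3 * x ^ 2 * x) by ring. apply Rmult_lt_compat_l; lra.
        - apply Rle_trans with (y ^ 2); [assumption|].
          apply pow_incr. split; lra. }
      assert (Hvm : m < fermatV t).
      { assert (0 < fermatV t) by (apply Rdiv_lt_0_compat; [fold y s; lra|apply Hden; lra]).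
        assert (0 < m) by (unfold m; lra). simpl in Hv2. nra. }
      pose proof (fermatUV_cubic t Ht') as F.
      apply Rnot_le_lt; intros HuM.
      assert (Hu : 0 < fermatU t) by (apply Rdiv_lt_0_compat; [fold y s; lra|apply Hden; lra]).
      assert (Hum : fermatU t <= m - 1) by (unfold m; lra).
      assert (Hm3 : m ^ 3 < fermatV t ^ 3) by (simpl; assert (0 < m) by (unfold m; lra); assert (m * m < fermatV t * fermatV t) by nra; nra).
      assert (Hu3 : fermatU t ^ 3 <= (m - 1) ^ 3) by (apply pow_incr; lra).
      assert (1 + (m - 1) ^ 3 <= m ^ 3); [|lra].
      assert (1 <= m) by (unfold m; lra).
      replace (m ^ 3) with (1 + (m - 1) ^ 3 + 3 * (m * (m - 1))) by ring. nra. }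
  assert (Mid : c * (t1 - t0) = 2 * fermatI).
  { assert (Hin : forall t, t0 < t < t1 -> fermatU t < 0 /\ 0 < fermatV t).
    { intros t Ht. pose proof (dwpR_increasing t0 t ltac:(lra) ltac:(lra) ltac:(lra)).
      pose proof (dwpR_increasing t t1 ltac:(lra) ltac:(lra) ltac:(lra)).
      pose proof (Hden t ltac:(lra)) as HD. split.
      - unfold fermatU. fold s. apply Ropp_lt_cancel. rewrite Ropp_0.
        unfold Rdiv; rewrite Ropp_mult_distr_l. apply Rdiv_lt_0_compat; lra.
      - apply Rdiv_lt_0_compat; [fold s; lra|assumption]. }
    apply (fermat_transit_time (fun t => - fermatV t / fermatU t) (fun t => - / fermatU t)); [assumption|unfold t0; lra| | |].
    - intros t Ht. destruct (Hin t Ht) as [H1 H2]. split; [apply is_derive_fermatVU; lra|]. split.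
      + replace (- fermatV t / fermatU t) with (fermatV t / - fermatU t) by (field; lra). apply Rdiv_lt_0_compat; lra.
      + pose proof (fermatUV_cubic t ltac:(lra)) as F.
        replace (1 + (- fermatV t / fermatU t) ^ 3) with ((fermatU t ^ 3 - fermatV t ^ 3) / fermatU t ^ 3) by (field; lra).
        rewrite F. field. lra.
    - intros e He.
      destruct (is_derive_small (fun t => - fermatV t / fermatU t) t0 _
                  (is_derive_fermatVU t0 ltac:(lra) ltac:(lra)) ltac:(cbv beta; rewrite Hv0; unfold Rdiv; ring) e He)
        as [d [Hd H]].
      exists d; split; [assumption|]. intros t Ht Htd.
      eapply Rle_lt_trans; [apply Rle_abs|]. apply H. apply Rabs_def1; lra.
    - intros M. set (m := 1 + Rabs M). pose proof (Rabs_pos M). pose proof (Rle_abs M).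
      assert (Hm : 0 < / m) by (apply Rinv_0_lt_compat; unfold m; lra).
      (* As t tends to t1 the new coordinate -v/u tends to infinity; this is read off from u/v,
         which is differentiable at t1 with value 0 there. *)
      assert (Hdq : is_derive (fun t => fermatU t / fermatV t) t1
                (((sqrt 3 * g3root * fermatV t1 ^ 2) * fermatV t1 - fermatU t1 * (sqrt 3 * g3root * fermatU t1 ^ 2)) / fermatV t1 ^ 2)).
      { apply is_derive_div; [apply is_derive_fermatU; lra|apply is_derive_fermatV; lra|lra]. }
      destruct (is_derive_small (fun t => fermatU t / fermatV t) t1 _ Hdq
                  ltac:(cbv beta; rewrite Hu1; unfold Rdiv; ring) (/ m) Hm) as [d [Hd H1]].
      exists d; split; [assumption|]. intros t Ht Htd. destruct (Hin t Ht) as [H2 H3].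
      specialize (H1 t ltac:(apply Rabs_def1; lra)).
      rewrite Rabs_left in H1.
      2:{ apply Ropp_lt_cancel. rewrite Ropp_0. unfold Rdiv; rewrite Ropp_mult_distr_l.
          apply Rdiv_lt_0_compat; lra. }
      apply Rlt_trans with m; [unfold m; lra|].
      replace (- fermatV t / fermatU t) with (/ (- (fermatU t / fermatV t))) by (field; lra).
      rewrite <- (Rinv_inv m). apply Rinv_lt_contravar; [|assumption].
      apply Rmult_lt_0_compat; [|assumption].
      replace (- (fermatU t / fermatV t)) with (- fermatU t / fermatV t) by (field; lra).
      apply Rdiv_lt_0_compat; lra. }
  assert (E : t1 = 2 * varpi / 3).
  { assert (E : varpi - t1 = t1 - t0) by (apply Rmult_eq_reg_l with c; lra). unfold t0 in E. lra. }
  rewrite <- E. split; [assumption|]. rewrite <- L, E. field.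
Qed.

Lemma g3root_1 : g3root = 1.
Proof.
  destruct period_thirds as [_ E]. pose proof fermatI_pos as HI. pose proof sqrt3_sq as H3.
  rewrite varpi_fermatI in E.
  replace (sqrt 3 * g3root * (2 * sqrt 3 * fermatI / 3))
    with (g3root * (sqrt 3 * sqrt 3 / 3 * (2 * fermatI))) in E by field.
  rewrite H3 in E. apply Rmult_eq_reg_r with (2 * fermatI); lra.
Qed.

Lemma g3_1 : g3 = 1.
Proof. rewrite <- g3root_pow6, g3root_1. ring. Qed.

Lemma wpD1_third : wpD1 (RtoC (varpi / 3)) = RtoC (- sqrt 3).
Proof.
  pose proof varpi_pos. rewrite wpD1_dwpR by lra. f_equal.
  destruct period_thirds as [E _]. rewrite g3root_1 in E.
  replace (2 * varpi / 3) with (varpi - varpi / 3) in E by field.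
  rewrite dwpR_symm in E by lra. simpl in E. lra.
Qed.

Lemma wp_third : wp (RtoC (varpi / 3)) = 1%C.
Proof.
  pose proof varpi_pos. rewrite wp_wpR by lra. f_equal. apply pow3_inj.
  pose proof (wpR_dwpR_cubic (varpi / 3) ltac:(lra)) as E.
  assert (Hy : dwpR (varpi / 3) = - sqrt 3).
  { apply RtoC_inj. rewrite <- wpD1_dwpR, wpD1_third by lra. reflexivity. }
  rewrite Hy, g3_1 in E. replace ((- sqrt 3) ^ 2) with (sqrt 3 ^ 2) in E by ring.
  rewrite sqrt3_pow in E. lra.
Qed.

(** * The zeros *)

Open Scope C_scope.

Lemma third_nhexT : ~ hexT (RtoC (varpi / 3)).
Proof. apply real_nhexT. pose proof varpi_pos; lra. Qed.

Lemma expi_2PI3 : expi (2 * PI / 3) = rho * rho.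
Proof.
  rewrite rho_sq, rho_eq. unfold expi. replace (2 * PI / 3)%R with (2 * (PI / 3))%R by field.
  rewrite cos_2PI3, sin_2PI3.
  apply injective_projections; simpl; lra.
Qed.

(** Modulo the lattice, the second family is the image of varpi/3 under -rho, and the third, with
    rho^2 = (-rho)^2, is its image under the square. The three families thus form the orbit of
    varpi/3 under a rotation of order three that leaves wp' invariant. *)
Lemma rho_two_thirds :
  rho * RtoC (2 * varpi / 3) = - (rho * RtoC (varpi / 3)) + rho * varpi.
Proof.
  replace (RtoC (2 * varpi / 3)) with (RtoC varpi - RtoC (varpi / 3))
    by (rewrite <- RtoC_minus; f_equal; field). ring.
Qed.

Lemma wp'_value_at_listed_points (z w : C) : hexT w ->
  z = RtoC (varpi / 3) + w \/
  z = expi (PI / 3) * RtoC (2 * varpi / 3) + w \/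
  z = expi (2 * PI / 3) * RtoC (varpi / 3) + w -> ~ hexT z /\ wpD1 z = RtoC (- sqrt 3).
Proof.
  intros Hw. pose proof third_nhexT as Ha. rewrite expi_2PI3. fold rho. rewrite rho_two_thirds.
  intros [->|[->| ->]].
  - split; [now apply nhexT_plus|]. rewrite wpD1_periodic by assumption. apply wpD1_third.
  - rewrite <- Cplus_assoc. pose proof (hexT_plus _ _ (hexT_rho _ hexT_varpi) Hw) as Hv.
    assert (Hn : ~ hexT (- (rho * RtoC (varpi / 3)))) by now apply nhexT_opp, nhexT_rho.
    split; [now apply nhexT_plus|].
    rewrite wpD1_periodic, wpD1_opp, wpD1_rho, wpD1_third by auto using nhexT_rho. ring.
  - rewrite <- Cmult_assoc.
    assert (Hn : ~ hexT (rho * (rho * RtoC (varpi / 3)))) by now apply nhexT_rho, nhexT_rho.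
    split; [now apply nhexT_plus|].
    rewrite wpD1_periodic, !wpD1_rho, wpD1_third by auto using nhexT_rho. ring.
Qed.

(** The nontrivial roots are rho^2 and rho^4, reduced by rho^2 = rho - 1. *)
Lemma cube_roots_of_unity (x : C) : x * (x * x) = 1 -> x = 1 \/ x = rho - 1 \/ x = - rho.
Proof.
  intros H.
  assert (E : (x - 1) * ((x - (rho - 1)) * (x - - rho)) = 0).
  { replace ((x - 1) * ((x - (rho - 1)) * (x - - rho)))
      with (x * (x * x) - 1 - (x - 1) * (rho * rho - (rho - 1))) by ring.
    rewrite H, rho_sq. ring. }
  destruct (Ceq_dec x 1) as [|H1]; [now left|].
  destruct (Ceq_dec x (rho - 1)) as [|H2]; [now right; left|].
  destruct (Ceq_dec x (- rho)) as [|H3]; [now right; right|].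
  exfalso. revert E. repeat apply Cmult_neq_0; now apply Cminus_eq_contra.
Qed.

Lemma wp_cube_at_zero (z : C) : ~ hexT z -> wpD1 z = RtoC (- sqrt 3) -> wp z * (wp z * wp z) = 1.
Proof.
  intros Hz HS. pose proof (wp_cubic z Hz) as E. rewrite HS, g3_1, <- RtoC_mult in E.
  replace (- sqrt 3 * - sqrt 3)%R with 3%R in E by (rewrite Rmult_opp_opp, sqrt3_sq; reflexivity).
  assert (E4 : 4 * (wp z * (wp z * wp z)) = 4).
  { replace (4 * (wp z * (wp z * wp z))) with (4 * (wp z * (wp z * wp z)) - 1 + 1) by ring.
    rewrite <- E, <- RtoC_plus. f_equal. ring. }
  assert (H4 : RtoC 4 <> 0) by (intros H; apply RtoC_inj in H; lra).
  replace (wp z * (wp z * wp z)) with (4 * (wp z * (wp z * wp z)) / 4) by (field; assumption).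
  rewrite E4. now field.
Qed.

Lemma congruent_third (z : C) : ~ hexT z -> wp z = 1 -> wpD1 z = RtoC (- sqrt 3) ->
  hexT (z - RtoC (varpi / 3)).
Proof.
  intros Hz Hw HS. pose proof varpi_pos as Hv.
  apply (wp_initial_values (RtoC (varpi / 3)) z (- RtoC (varpi / 3))).
  - apply third_nhexT.
  - assumption.
  - now rewrite Hw, wp_third.
  - now rewrite HS, wpD1_third.
  - rewrite Cmod_opp, Cmod_R, Rabs_pos_eq; lra.
  - replace (RtoC (varpi / 3) + - RtoC (varpi / 3)) with (RtoC 0) by ring. apply hexT_0.
Qed.

(** The rotation is chosen so that wp becomes 1 while wp' keeps its value. For wp z = rho^2 it is z
    -> -rho z, so z is congruent to rho^2 varpi/3. For wp z = -rho it is z -> rho^2 z, so z is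
    congruent to -rho varpi/3, that is, to rho times 2 varpi/3. *)
Lemma zeros_listed (z : C) : ~ hexT z -> wpD1 z = RtoC (- sqrt 3) ->
  exists w, hexT w /\
    (z = RtoC (varpi / 3) + w \/
     z = expi (PI / 3) * RtoC (2 * varpi / 3) + w \/
     z = expi (2 * PI / 3) * RtoC (varpi / 3) + w).
Proof.
  intros Hz HS. rewrite expi_2PI3. fold rho. rewrite rho_two_thirds.
  set (a := RtoC (varpi / 3)).
  destruct (cube_roots_of_unity (wp z) (wp_cube_at_zero z Hz HS)) as [Hw|[Hw|Hw]].
  - exists (z - a). split; [now apply congruent_third|]. left; ring.
  - assert (H : hexT (- (rho * z) - a)).
    { apply congruent_third.
      - now apply nhexT_opp, nhexT_rho.
      - rewrite wp_opp, wp_rho, inv_rho_pow2, Hw by auto using nhexT_rho.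
        replace (- rho * (rho - 1)) with (rho - rho * rho) by ring. rewrite rho_sq; ring.
      - rewrite wpD1_opp, wpD1_rho, HS by auto using nhexT_rho. ring. }
    exists (rho * (rho * (- (rho * z) - a))). split; [now apply hexT_rho, hexT_rho|].
    right; right. rewrite (opp_rho (rho * z)).
    replace z with (rho ^ 3 * rho ^ 3 * z) at 1 by (rewrite rho_pow3; ring). simpl; ring.
  - assert (H : hexT (rho * (rho * z) - a)).
    { apply congruent_third.
      - now apply nhexT_rho, nhexT_rho.
      - rewrite !wp_rho, inv_rho_pow2, Hw by auto using nhexT_rho.
        replace (- rho * (- rho * - rho)) with (- rho ^ 3) by (simpl; ring). rewrite rho_pow3; ring.
      - rewrite !wpD1_rho, HS by auto using nhexT_rho. ring. }
    exists (- (rho * (rho * (rho * z) - a)) - rho * varpi). split.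
    + apply hexT_minus; [now apply hexT_opp, hexT_rho|]. apply hexT_rho, hexT_varpi.
    + right; left. replace z with (- rho ^ 3 * z) at 1 by (rewrite rho_pow3; ring). simpl; ring.
Qed.

Lemma wp'_plus_sqrt3_zero (z : C) : ~ hexT z -> (wp' z + sqrt 3 = 0 <-> wpD1 z = RtoC (- sqrt 3)).
Proof.
  intros Hz. rewrite wp'_wpD1, RtoC_opp by assumption. split; intros H.
  - replace (wpD1 z) with (wpD1 z + sqrt 3 - sqrt 3) by ring. rewrite H. ring.
  - rewrite H. ring.
Qed.

(* The first conjunct guarantees that wp' is the derivative of wp off the poles. *)
Theorem proposition3 :
  (forall z : C, ~ hexT z -> holomorphic_at wp z) /\
  (forall z : C,
     (~ hexT z /\ wp' z + sqrt 3 = 0) <->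
     (exists w : C, hexT w /\
        (z = RtoC (varpi / 3) + w \/
         z = expi (PI / 3) * RtoC (2 * varpi / 3) + w \/
         z = expi (2 * PI / 3) * RtoC (varpi / 3) + w))) /\
  (forall z : C,
     ~ hexT z -> wp' z + sqrt 3 = 0 -> simple_zero (fun x : C => wp' x + sqrt 3) z).
Proof.
  split; [exact holomorphic_wp|split].
  - intros z; split.
    + intros [Hz H]. apply zeros_listed; [assumption|]. now apply wp'_plus_sqrt3_zero.
    + intros [w [Hw H]]. destruct (wp'_value_at_listed_points z w Hw H) as [Hz HS].
      split; [assumption|]. now apply wp'_plus_sqrt3_zero.
  - intros z Hz H.
    assert (Hd : forall y, ~ hexT y -> cder (fun x => wp' x + sqrt 3) y (wpD2 y)).
    { intros y Hy. replace (wpD2 y) with (wpD2 y + 0) by ring.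
      apply cder_plus; [now apply cder_wp'|apply cder_const]. }
    split; [|split; [assumption|]].
    + apply locally_nhexT; [assumption|]. intros y Hy. exists (wpD2 y). now apply cder_is_derive, Hd.
    + rewrite (cder_C_derive _ z (wpD2 z)), wp_ode by auto.
      assert (Hw : wp z <> 0).
      { intros E. apply wp'_plus_sqrt3_zero in H; [|assumption].
        pose proof (wp_cube_at_zero z Hz H) as E3. rewrite E, Cmult_0_l in E3.
        now apply C1_nz. }
      apply Cmult_neq_0; [|now apply Cmult_neq_0].
      intros E. apply RtoC_inj in E. lra.
Qed.
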